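(* Let $\mathfrak g=\mathrm{cgl}(V)$ be infinite dimensional, let $\chi\in\mathfrak g^*_{f,\bar0}$ be standard semisimple, let $\mathbf Fv$ be a one-dimensional (simple) $u_\chi(B)$-$T_0$-module in category $\mathcal O$, with $N^+v=0$ and $H$-weight $\lambda\in H^*$ (that is, $hv=\lambda(h)v$ for $h\in H$), and let $Z^\chi(\lambda)=u_\chi(\mathfrak g)\otimes_{u_\chi(B)}\mathbf Fv$ be the baby Verma module. For each $n\ge1$ let $\delta_1,\dots,\delta_{k_n}$ be an ordering of the positive roots of $\mathfrak g_n$ such that $(\mathfrak g_n,H_n,(\delta_i)_{i=1}^{k_n})$ is an FP triple, and put $$f_n(\lambda(h))=\prod_{i=1}^{k_n}\big[(\lambda_i(H_{\delta_i})+1)^{\bar p-1}-1\big],\qquad \lambda_i=\lambda-[(\bar p-1)\delta_1+\cdots+(\bar p-1)\delta_{i-1}].$$ Then $Z^\chi(\lambda)$ is simple if and only if $f_n(\lambda(h))\ne0$ for all $n\ge1$.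
   Context: $\mathbf F$ is an algebraically closed field of characteristic $p>3$. $\Gamma=\{\alpha_1,\alpha_2,\dots\}$ is a countable abelian group with a bicharacter $(,):\Gamma\times\Gamma\to\mathbf F^\times$: $(\alpha,\beta)(\beta,\alpha)=1$, multiplicative in each argument; $\Gamma^\pm=\{\gamma:(\gamma,\gamma)=\pm1\}$. $V=\oplus_{\alpha\in\Gamma}V_\alpha$ with $\dim V_\alpha=m_\alpha<\infty$ and $\dim V=\infty$. $\mathrm{gl}(V)=\oplus_\alpha\mathrm{gl}(V)_\alpha$ ($\mathrm{gl}(V)_\alpha$ = linear maps of degree $\alpha$), $[f,g]=fg-(\alpha,\beta)gf$ for $f,g$ of degrees $\alpha,\beta$, and $\mathrm{cgl}(V)=\{f\in\mathrm{gl}(V):f(V_\alpha)=0\text{ for all but finitely many }\alpha\}$, a restricted Lie color algebra with $x^{[p]}=x^p$ for $x$ homogeneous of degree in $\Gamma^+$. Fix a homogeneous basis $v_1,v_2,\dots$ of $V$ such that basis vectors of $V_{\alpha_i}$ precede those of $V_{\alpha_j}$ for $i<j$; $e_{ij}$ are the matrix units, of degree $\deg v_i-\deg v_j$, forming a basis of $\mathfrak g=\mathrm{cgl}(V)$. $H=\sum_i\mathbf Fe_{ii}$, roots $\varepsilon_i-\varepsilon_j$ ($i\ne j$) with root vectors $e_{ij}$, positive if $i<j$; $N^\pm$ the spans of the $e_{ij}$ with $i<j$, resp. $i>j$; $B=H\oplus N^+$. For a positive root $\delta=\varepsilon_i-\varepsilon_j$: $H_\delta=e_{ii}-e_{jj}$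 and $\bar p=p$ if $\deg e_{ij}\in\Gamma^+$; $H_\delta=e_{ii}+e_{jj}$ and $\bar p=2$ if $\deg e_{ij}\in\Gamma^-$ (the value of $\bar p$ in each factor and each coefficient is the one attached to the root concerned). $\varepsilon_i\in H^*$ is $\varepsilon_i(e_{jj})=\delta_{ij}$. $\mathfrak g_n=\mathrm{gl}(V_{\alpha_1}\oplus\cdots\oplus V_{\alpha_n})\subseteq\mathfrak g$ and $H_n$ is its subalgebra of diagonal matrices. $(\mathfrak g_n,H_n,(\delta_i)_{i=1}^{k_n})$ is an FP triple if $\{\delta_1,\dots,\delta_{k_n}\}$ is the set of all positive roots of $\mathfrak g_n$ and for each $i$ the set $\{-\delta_1,\dots,-\delta_{i-1},\delta_i,\dots,\delta_{k_n}\}$ is a system of positive roots of $\mathfrak g_n$ in which $\delta_i$ is simple and $\{-\delta_1,\dots,-\delta_i\}$ is additive (contains every root that is a sum of two of its elements). Such orderings exist. $\mathfrak g^*_{f,\bar0}$: linear functions on $\mathfrak g$ vanishing on $\mathfrak g_\alpha$ for $\alpha\neq\bar0$ and on all but finitely many blocks $\mathrm{gl}(V_{\alpha_i})$ of $\mathfrak g_{\bar0}=\oplus_i\mathrm{gl}(V_{\alpha_i})$; $\chi$ is standard semisimple if $\chi(N^\pm)=0$. $u_\chi(\mathfrak g)$ is the quotient of the universal enveloping algebra (tensor algebra modulo $x\otimes y-(\alpha,\beta)y\otimes x-[x,y]$) by the ideal generated by $x^p-x^{[p]}-\chi(x)^p$, $x\in\mathfrak g_\alpha$, $\alpha\in\Gamma^+$;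 similarly for restricted subalgebras. Modules are $\Gamma$-graded; simple means no nontrivial $\Gamma$-graded submodules. Choose $N$ with $\chi(\mathrm{gl}(V_{\alpha_i}))=0$ for all $i\ge N$, and let $T_0=\prod_{i\ge N}T_{\alpha_i}$, $T_{\alpha_i}\subset\mathrm{GL}(V_{\alpha_i})$ the diagonal torus (identity in blocks $i<N$). For a restricted subalgebra $\mathscr S\supseteq\mathrm{Lie}(T_0)$, a $u_\chi(\mathscr S)$-$T_0$-module is a $\Gamma$-graded space that is both a $u_\chi(\mathscr S)$-module and a $T_0$-module with $t(xw)=(\mathrm{Ad}(t)x)(tw)$ and such that the action of $\mathrm{Lie}(T_0)$ from $\mathscr S$ is the derivative of the $T_0$-action. Category $\mathcal O$ consists of such modules which are finitely generated, are direct sums of weight spaces for $H$ and for $T_0$ (weights in $X(T_0)$), and in which $u(N^+)w$ is finite dimensional for every homogeneous $w$. *)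

(* Defs.v *)
From HB Require Import structures.
From mathcomp Require Import all_boot all_algebra finmap.
From mathcomp Require Import boolp classical_sets functions.
From mathcomp.multinomials Require Import monalg.

Set Implicit Arguments.
Unset Strict Implicit.
Unset Printing Implicit Defensive.

Import GRing.Theory.
Local Open Scope classical_set_scope.
Local Open Scope quotient_scope.
Local Open Scope ring_scope.

Definition is_subgroup (A : zmodType) (I : set A) : Prop :=
  I 0 /\ forall x y, I x -> I y -> I (x - y).

Section QuotientGroup.
Variables (A : zmodType) (R : set A).

Definition gen_subgroup (x : A) : bool :=
  `[< forall I : set A, is_subgroup I -> R `<=` I -> I x >].

Lemma gen_subgroup_closed : zmod_closed gen_subgroup.
Proof.
split=> [|x y /asboolP Ix /asboolP Iy]; apply/asboolP=> I sI RI; first exact: sI.1.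
by apply: sI.2; [exact: Ix | exact: Iy].
Qed.

Definition gen_subgroup_zmod : zmodClosed A :=
  HB.pack gen_subgroup (GRing.isZmodClosed.Build A gen_subgroup gen_subgroup_closed).

Lemma gen_subgroupR x : R x -> gen_subgroup x.
Proof. by move=> Rx; apply/asboolP=> I _; exact. Qed.

Lemma gen_subgroup_ind (I : set A) :
  is_subgroup I -> R `<=` I -> forall x, gen_subgroup x -> I x.
Proof. by move=> sI RI x /asboolP; exact. Qed.

Definition quot_group : Type := Quotient.quot gen_subgroup_zmod.
HB.instance Definition _ := GRing.Zmodule.on quot_group.

End QuotientGroup.

Definition is_ideal2 (A : nzRingType) (I : set A) : Prop :=
  [/\ is_subgroup I, (forall a x, I x -> I (a * x))
    & (forall a x, I x -> I (x * a))].

Section QuotientRing.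
Variables (A : nzRingType) (R : set A).

Definition gen_ideal2 (x : A) : bool :=
  `[< forall I : set A, is_ideal2 I -> R `<=` I -> I x >].

Lemma gen_ideal2_closed : zmod_closed gen_ideal2.
Proof.
split=> [|x y /asboolP Ix /asboolP Iy]; apply/asboolP=> I sI RI;
  have [[I0 IB] _ _] := sI => //.
by apply: IB; [exact: Ix | exact: Iy].
Qed.

Definition gen_ideal2_zmod : zmodClosed A :=
  HB.pack gen_ideal2 (GRing.isZmodClosed.Build A gen_ideal2 gen_ideal2_closed).

Lemma gen_ideal2R x : R x -> gen_ideal2 x.
Proof. by move=> Rx; apply/asboolP=> I _; exact. Qed.

Lemma gen_ideal2_ind (I : set A) :
  is_ideal2 I -> R `<=` I -> forall x, gen_ideal2 x -> I x.
Proof. by move=> sI RI x /asboolP; exact. Qed.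

Lemma gen_ideal2Ml a x : gen_ideal2 x -> gen_ideal2 (a * x).
Proof.
move=> /asboolP Ix; apply/asboolP=> I sI RI; have [_ Il _] := sI.
exact: Il (Ix I sI RI).
Qed.

Lemma gen_ideal2Mr a x : gen_ideal2 x -> gen_ideal2 (x * a).
Proof.
move=> /asboolP Ix; apply/asboolP=> I sI RI; have [_ _ Ir] := sI.
exact: Ir (Ix I sI RI).
Qed.

Definition quot_ring : Type := Quotient.quot gen_ideal2_zmod.
HB.instance Definition _ := GRing.Zmodule.on quot_ring.

Definition qpi (x : A) : quot_ring := \pi_(Quotient.quot gen_ideal2_zmod) x.
Definition qrepr (u : quot_ring) : A := repr (u : Quotient.quot gen_ideal2_zmod).

Lemma qreprK u : qpi (qrepr u) = u.
Proof. exact: reprK. Qed.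

Lemma qpi_eqP x y : (qpi x = qpi y) <-> gen_ideal2 (x - y).
Proof.
have := Quotient.idealrBE gen_ideal2_zmod x y.
rewrite unfold_in -[asbool _]/(gen_ideal2 (x - y)) => ->; by split=> /eqP.
Qed.

Lemma qpiD x y : qpi (x + y) = qpi x + qpi y.
Proof. exact: raddfD. Qed.
Lemma qpiB x y : qpi (x - y) = qpi x - qpi y.
Proof. exact: raddfB. Qed.
Lemma qpi0 : qpi 0 = 0.
Proof. exact: raddf0. Qed.

Definition qone : quot_ring := qpi 1.
Definition qmul (u v : quot_ring) : quot_ring := qpi (qrepr u * qrepr v).

Lemma qpiM_ x y : qpi (x * y) = qmul (qpi x) (qpi y).
Proof.
apply/qpi_eqP; set x' := qrepr _; set y' := qrepr _.
have Ix : gen_ideal2 (x - x') by apply/qpi_eqP; rewrite qreprK.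
have Iy : gen_ideal2 (y - y') by apply/qpi_eqP; rewrite qreprK.
have -> : x * y - x' * y' = x * (y - y') + (x - x') * y'.
  by rewrite mulrBr mulrBl addrA subrK.
by apply: (@rpredD _ gen_ideal2_zmod); [exact: gen_ideal2Ml | exact: gen_ideal2Mr].
Qed.

Lemma qmulA : associative qmul.
Proof.
by move=> u v w; rewrite -(qreprK u) -(qreprK v) -(qreprK w) -!qpiM_ mulrA.
Qed.
Lemma qmul1 : left_id qone qmul.
Proof. by move=> u; rewrite -(qreprK u) -qpiM_ mul1r. Qed.
Lemma qmulr1 : right_id qone qmul.
Proof. by move=> u; rewrite -(qreprK u) -qpiM_ mulr1. Qed.
Lemma qmulDl : left_distributive qmul +%R.
Proof.
move=> u v w; rewrite -(qreprK u) -(qreprK v) -(qreprK w).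
by rewrite -qpiD -!qpiM_ -qpiD mulrDl.
Qed.
Lemma qmulDr : right_distributive qmul +%R.
Proof.
move=> u v w; rewrite -(qreprK u) -(qreprK v) -(qreprK w).
by rewrite -qpiD -!qpiM_ -qpiD mulrDr.
Qed.

HB.instance Definition _ := GRing.Zmodule_isPzRing.Build quot_ring
  qmulA qmul1 qmulr1 qmulDl qmulDr.

Lemma qpiM x y : qpi (x * y) = qpi x * qpi y.
Proof. exact: qpiM_. Qed.
Lemma qpi1 : qpi 1 = 1.
Proof. by []. Qed.

End QuotientRing.

(* [ext_scalars f W] is A (x)_B W, where A is a right B-module through f : the
   free abelian group on A * W modulo biadditivity and [(a * f b) (x) w =
   a (x) (b *: w)]. *)
Section ExtScalars.
Variables (B A : pzRingType) (f : B -> A) (W : lmodType B).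
Local Notation free := {malg int[(A * W)%type]}.

Inductive tensor_rel : free -> Prop :=
| tensor_Dl a b w : tensor_rel (<< (a + b, w) >> - << (a, w) >> - << (b, w) >>)
| tensor_Dr a w x : tensor_rel (<< (a, w + x) >> - << (a, w) >> - << (a, x) >>)
| tensor_bal a b w : tensor_rel (<< (a * f b, w) >> - << (a, b *: w) >>).

Definition ext_scalars : Type := quot_group tensor_rel.
HB.instance Definition _ := GRing.Zmodule.on ext_scalars.

Definition tpi (t : free) : ext_scalars :=
  \pi_(Quotient.quot (gen_subgroup_zmod tensor_rel)) t.
Definition trepr (z : ext_scalars) : free :=
  repr (z : Quotient.quot (gen_subgroup_zmod tensor_rel)).
Definition tensor (a : A) (w : W) : ext_scalars := tpi << (a, w) >>.

Lemma treprK z : tpi (trepr z) = z.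
Proof. exact: reprK. Qed.

Lemma tpi_eqP x y : (tpi x = tpi y) <-> gen_subgroup tensor_rel (x - y).
Proof.
have := Quotient.idealrBE (gen_subgroup_zmod tensor_rel) x y.
rewrite unfold_in -[asbool _]/(gen_subgroup tensor_rel (x - y)) => ->.
by split=> /eqP.
Qed.

Lemma tpiB x y : tpi (x - y) = tpi x - tpi y.
Proof. exact: raddfB. Qed.
Lemma tpiD x y : tpi (x + y) = tpi x + tpi y.
Proof. exact: raddfD. Qed.
Lemma tpi0 : tpi 0 = 0.
Proof. exact: raddf0. Qed.

Definition free_act (a : A) (t : free) : free :=
  \sum_(k <- msupp t) << t@_k *g (a * k.1, k.2) >>.

Lemma free_actEw (d : {fset (A * W)%type}) a t : fsubset (msupp t) d ->
  free_act a t = \sum_(k <- d) << t@_k *g (a * k.1, k.2) >>.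
Proof.
move=> le; rewrite [LHS](big_fset_incl _ le) => //= x xd /mcoeff_outdom ->.
by rewrite monalgU0.
Qed.

Lemma free_actB a x y : free_act a (x - y) = free_act a x - free_act a y.
Proof.
pose d := (msupp x `|` msupp y `|` msupp (x - y))%fset.
have [dx dy dxy] : [/\ fsubset (msupp x) d, fsubset (msupp y) d
  & fsubset (msupp (x - y)) d].
  by split; apply/fsubsetP => k; rewrite !inE => ->; rewrite ?orbT.
rewrite (free_actEw _ dx) (free_actEw _ dy) (free_actEw _ dxy).
rewrite -sumrB; apply: eq_bigr => k _; by rewrite mcoeffB monalgUB.
Qed.

Lemma free_act0 a : free_act a 0 = 0.
Proof. by have := free_actB a 0 0; rewrite !subrr. Qed.

Lemma free_actD a x y : free_act a (x + y) = free_act a x + free_act a y.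
Proof.
by rewrite -{1}(opprK y) free_actB -(sub0r y) free_actB free_act0 sub0r opprK.
Qed.

Lemma free_actU a b w : free_act a << (b, w) >> = << (a * b, w) >>.
Proof. by rewrite (free_actEw _ msuppU_le) big_seq_fset1 mcoeffUU. Qed.

Lemma free_act_rel a x :
  gen_subgroup tensor_rel x -> gen_subgroup tensor_rel (free_act a x).
Proof.
apply: (gen_subgroup_ind (I := fun x => gen_subgroup tensor_rel (free_act a x))).
  split=> [|y z]; first by rewrite free_act0; apply: (rpred0 (gen_subgroup_zmod _)).
  rewrite free_actB; exact: (@rpredB _ (gen_subgroup_zmod tensor_rel)).
move=> _ [b c w|b w y|b c w]; rewrite !free_actB !free_actU; apply: gen_subgroupR.
- by rewrite mulrDr; exact: tensor_Dl.
- exact: tensor_Dr.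
- by rewrite mulrA; exact: tensor_bal.
Qed.

Definition ext_scale (a : A) (z : ext_scalars) : ext_scalars :=
  tpi (free_act a (trepr z)).

Lemma ext_scale_tpi a t : ext_scale a (tpi t) = tpi (free_act a t).
Proof.
apply/tpi_eqP; rewrite -free_actB; apply: free_act_rel.
by apply/tpi_eqP; rewrite treprK.
Qed.

Lemma ext_scale_tensor a b w : ext_scale a (tensor b w) = tensor (a * b) w.
Proof. by rewrite ext_scale_tpi free_actU. Qed.

Lemma ext_scaleDr a : {morph ext_scale a : x y / x + y}.
Proof.
move=> x y; rewrite -(treprK x) -(treprK y) -tpiD !ext_scale_tpi.
by rewrite free_actD tpiD.
Qed.

Lemma ext_scaleB a : {morph ext_scale a : x y / x - y}.
Proof.
move=> x y; rewrite -(treprK x) -(treprK y) -tpiB !ext_scale_tpi.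
by rewrite free_actB tpiB.
Qed.

Lemma tensor_ind (P : set ext_scalars) :
  is_subgroup P -> (forall a w, P (tensor a w)) -> forall z, P z.
Proof.
move=> [P0 PB] Pt z; rewrite -(treprK z) (monalgE (trepr z)).
have PN x : P x -> P (- x) by rewrite -sub0r; apply: PB.
have PD x y : P x -> P y -> P (x + y).
  by move=> Px Py; rewrite -(opprK y); apply: PB => //; apply: PN.
elim: (enum_fset _) => [|k s IHs]; first by rewrite big_nil tpi0.
rewrite big_cons tpiD; apply: (PD _ _ _ IHs).
have PnU n : P (tpi << n%:Z *g k >>).
  elim: n => [|n IHn]; first by rewrite monalgU0 tpi0.
  rewrite intS monalgUD tpiD; apply: (PD _ _ _ IHn).
  by case: k {IHs IHn} => a w; exact: Pt.
case: (_@__) => n; first exact: PnU.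
by rewrite NegzE monalgUN -sub0r tpiB tpi0 sub0r; apply: (PN _ (PnU _)).
Qed.

Lemma tensorDl a b w : tensor (a + b) w = tensor a w + tensor b w.
Proof.
apply/eqP; rewrite -subr_eq0 opprD addrA -!tpiB -tpi0; apply/eqP/tpi_eqP.
by rewrite subr0; apply: gen_subgroupR; exact: tensor_Dl.
Qed.

Lemma tensorDr a w x : tensor a (w + x) = tensor a w + tensor a x.
Proof.
apply/eqP; rewrite -subr_eq0 opprD addrA -!tpiB -tpi0; apply/eqP/tpi_eqP.
by rewrite subr0; apply: gen_subgroupR; exact: tensor_Dr.
Qed.

Lemma tensorZ a b w : tensor (a * f b) w = tensor a (b *: w).
Proof. by apply/tpi_eqP/gen_subgroupR; exact: tensor_bal. Qed.

Lemma ext_scaleA a b z : ext_scale a (ext_scale b z) = ext_scale (a * b) z.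
Proof.
move: z; apply: (@tensor_ind (fun z => _ = _)).
  split=> [|x y ex ey]; first by rewrite -(subrr 0) !ext_scaleB !subrr.
  by rewrite !ext_scaleB ex ey.
by move=> c w; rewrite !ext_scale_tensor mulrA.
Qed.

Lemma ext_scale1 : left_id 1 ext_scale.
Proof.
apply: (@tensor_ind (fun z => _ = _)).
  split=> [|x y ex ey]; first by rewrite -(subrr 0) !ext_scaleB !subrr.
  by rewrite !ext_scaleB ex ey.
by move=> c w; rewrite !ext_scale_tensor mul1r.
Qed.

Lemma ext_scaleDl z : {morph ext_scale^~ z : a b / a + b}.
Proof.
move=> a b; move: z; apply: (@tensor_ind (fun z => _ = _)).
  split=> [|x y ex ey].
    by rewrite /= -(subrr 0) !ext_scaleB !subrr addr0.
  by rewrite /= !ext_scaleB ex ey opprD addrACA.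
by move=> c w; rewrite /= !ext_scale_tensor mulrDl tensorDl.
Qed.

HB.instance Definition _ := GRing.Zmodule_isLmodule.Build A ext_scalars
  ext_scaleA ext_scale1 ext_scaleDr ext_scaleDl.

End ExtScalars.

Definition direct_sum (M : zmodType) (I : eqType) (P : I -> set M) : Prop :=
  [/\ forall i, is_subgroup (P i),
      forall m, exists (s : seq I) (c : I -> M),
        (forall i, P i (c i)) /\ m = \sum_(i <- s) c i
    & forall (s : seq I) (c : I -> M), uniq s -> (forall i, P i (c i)) ->
        \sum_(i <- s) c i = 0 -> forall i, i \in s -> c i = 0].

Definition lspan (F : pzRingType) (W : lmodType F) (X : set W) : set W :=
  fun w => exists s : seq (F * W),
    (forall t, t \in s -> X t.2) /\ w = \sum_(t <- s) t.1 *: t.2.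

Record bicharacter (F : fieldType) (Gamma : zmodType)
    (c : Gamma -> Gamma -> F) : Prop := Bicharacter {
  bichar_skew : forall a b, c a b * c b a = 1;
  bichar_Dl : forall a b d, c (a + b) d = c a d * c b d;
  bichar_Dr : forall a b d, c a (b + d) = c a b * c a d }.

(* The graded space V with its fixed ordered homogeneous basis. Everything is
   indexed from 0: [alpha i] is the (i+1)-st element of Gamma, [vb k] the
   (k+1)-st basis vector, of degree [alpha (blk k)]. The family [crd] is dual
   to [vb]. The space V_(alpha i) is spanned by the [vb k] with [blk k = i];
   its dimension is finite, possibly 0, by [blk_fin]. That Gamma is infinite,
   hence enumerated bijectively by nat, is forced by dim V being infinite. *)
Record colorSpace (F : fieldType) := ColorSpace {
  Gamma : zmodType;
  alpha : nat -> Gamma;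
  alpha_bij : bijective alpha;
  bichar : Gamma -> Gamma -> F;
  bicharP : bicharacter bichar;
  Vsp : lmodType F;
  vb : nat -> Vsp;
  crd : nat -> Vsp -> F;
  crd_lin : forall k a x y, crd k (a *: x + y) = a * crd k x + crd k y;
  crd_vb : forall k l, crd k (vb l) = (k == l)%:R;
  vb_span : forall x, exists n, x = \sum_(k < n) crd k x *: vb k;
  blk : nat -> nat;
  blk_mono : forall k l, (k <= l)%N -> (blk k <= blk l)%N;
  blk_fin : forall i, exists n, forall k, blk k = i -> (k < n)%N }.

Section Cgl.
Variables (F : fieldType) (D : colorSpace F).
Local Notation G := (Gamma D).
Local Notation V := (Vsp D).
Local Notation v := (@vb F D).
Local Notation bc := (@bichar F D).
Local Notation E := (V -> V).

Definition vdeg (k : nat) : G := alpha D (blk D k).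

Definition Vgr (g : G) : set V :=
  [set x | forall k, crd k x != 0 -> vdeg k = g].

(* Gamma^+; Gamma^- is its complement, because (g, g)^2 = 1. *)
Definition gammaP : set G := [set g | bc g g = 1].

Definition is_linear (f : E) : Prop :=
  forall a x y, f (a *: x + y) = a *: f x + f y.

Definition glhom (g : G) : set E :=
  [set f | is_linear f /\ forall d x, Vgr d x -> Vgr (g + d) (f x)].

Definition gl : set E :=
  [set f | exists (s : seq G) (c : G -> E),
     (forall g, glhom g (c g)) /\ f = \sum_(g <- s) c g].

Definition cgl : set E :=
  [set f | gl f /\ exists s : seq G,
     forall g, g \notin s -> forall x, Vgr g x -> f x = 0].

Definition glblock (i : nat) : set E :=
  [set f | is_linear f /\ forall x,
     Vgr (alpha D i) (f x) /\ forall j, j != i -> Vgr (alpha D j) x -> f x = 0].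

Definition cbracket (g h : G) (x y : E) : E := x \o y - bc g h *: (y \o x).

Definition eij (i j : nat) : E := fun x => crd j x *: v i.
Definition edeg (i j : nat) : G := vdeg i - vdeg j.

Definition Hsub : set E := lspan [set eij i i | i in setT].
Definition Nplus : set E := lspan [set eij d.1 d.2 | d in [set d | d.1 < d.2]%N].
Definition Nminus : set E := lspan [set eij d.1 d.2 | d in [set d | d.2 < d.1]%N].
Definition Bsub : set E := [set h + n | h in Hsub & n in Nplus].
Definition Hn (n : nat) : set E := lspan [set eij i i | i in [set i | blk D i < n]%N].

(* Roots. The pair d = (i, j) stands for the root eps_i - eps_j, whose value as
   a linear function on H is [rootf d]. *)
Definition rootpair := (nat * nat)%type.

Definition eps (i : nat) (h : E) : F := crd i (h (v i)).
Definition rootf (d : rootpair) (h : E) : F := eps d.1 h - eps d.2 h.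

Definition ropp (d : rootpair) : rootpair := (d.2, d.1).
Definition is_root (n : nat) (d : rootpair) : Prop :=
  [/\ d.1 != d.2, (blk D d.1 < n)%N & (blk D d.2 < n)%N].
Definition pos_root (n : nat) (d : rootpair) : Prop :=
  is_root n d /\ (d.1 < d.2)%N.

Definition is_root_sum (n : nat) (d d1 d2 : rootpair) : Prop :=
  forall h, Hn n h -> rootf d h = rootf d1 h + rootf d2 h.

Definition additive_roots (n : nat) (P : set rootpair) : Prop :=
  forall d1 d2 d, P d1 -> P d2 -> is_root n d -> is_root_sum n d d1 d2 -> P d.

Definition positive_system (n : nat) (P : set rootpair) : Prop :=
  [/\ P `<=` is_root n,
      forall d, is_root n d -> P d \/ P (ropp d),
      forall d, ~ (P d /\ P (ropp d))
    & additive_roots n P].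

Definition simple_root (n : nat) (P : set rootpair) (d : rootpair) : Prop :=
  P d /\ forall d1 d2, P d1 -> P d2 -> ~ is_root_sum n d d1 d2.

Definition FP_triple (n : nat) (s : seq rootpair) : Prop :=
  [/\ uniq s, forall d, d \in s <-> pos_root n d
    & forall i, (i < size s)%N ->
      let d := nth (0, 0)%N s i in
      let P := [set x | x \in [seq ropp y | y <- take i s] ++ drop i s] in
      [/\ positive_system n P, simple_root n P d
        & additive_roots n [set x | x \in [seq ropp y | y <- take i.+1 s]]]].

Section Prime.
Variable p : nat.

Definition pbar (d : rootpair) : nat :=
  if `[< gammaP (edeg d.1 d.2) >] then p else 2.

Definition Hroot (d : rootpair) : E :=
  if `[< gammaP (edeg d.1 d.2) >] then eij d.1 d.1 - eij d.2 d.2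
  else eij d.1 d.1 + eij d.2 d.2.

Definition lam_shift (lam : E -> F) (s : seq rootpair) (i : nat) : E -> F :=
  lam - \sum_(d <- take i s) rootf d *+ (pbar d).-1.

Definition fpoly (lam : E -> F) (s : seq rootpair) : F :=
  \prod_(i < size s) let d := nth (0, 0)%N s i in
     ((lam_shift lam s i (Hroot d) + 1) ^+ (pbar d).-1 - 1).

Definition linear_on (S : set E) (f : E -> F) : Prop :=
  forall a x y, S x -> S y -> f (a *: x + y) = a * f x + f y.

Definition finite_dual0 (chi : E -> F) : Prop :=
  [/\ linear_on cgl chi,
      forall g x, g != 0 -> cgl x -> glhom g x -> chi x = 0
    & exists s : seq nat, forall i x, i \notin s -> glblock i x -> chi x = 0].

Definition standard_semisimple (chi : E -> F) : Prop :=
  (forall x, Nplus x -> chi x = 0) /\ (forall x, Nminus x -> chi x = 0).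

(* u_chi(S) for a homogeneous restricted subalgebra S of cgl(V): the free
   algebra on the set S modulo the two-sided ideal generated by
   - linearity of S -> u_chi(S), which turns the free algebra on the set S into
     the tensor algebra of the space S;
   - the relations of the universal enveloping algebra;
   - the relations x^p - x^[p] - chi(x)^p. *)
Section Enveloping.
Variables (chi : E -> F) (S : set E).

Definition freealg := {malg F[{fmonom S}]}.
Definition gen (x : S) : freealg := << fmu x >>.

Inductive urel : set freealg :=
| urel_lin a (x y z : S) : val z = a *: val x + val y ->
    urel (gen z - (a *: gen x + gen y))
| urel_bracket g h (x y z : S) : glhom g (val x) -> glhom h (val y) ->
    val z = cbracket g h (val x) (val y) ->
    urel (gen x * gen y - bc g h *: (gen y * gen x) - gen z)
| urel_power g (x z : S) : gammaP g -> glhom g (val x) ->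
    val z = iter p (comp (val x)) id ->
    urel (gen x ^+ p - gen z - (chi (val x) ^+ p) *: 1).

Definition uchi : Type := quot_ring urel.
HB.instance Definition _ := GRing.PzRing.on uchi.

(* the image in u_chi(S) of x in S, and 0 for x outside S *)
Definition uin (x : E) : uchi := if insub x is Some y then qpi urel (gen y) else 0.

Definition uscal (a : F) : uchi := qpi urel (a *: 1).
Definition fscale (M : lmodType uchi) (a : F) (m : M) : M := uscal a *: m.

Inductive uchi_gr : G -> uchi -> Prop :=
| uchi_gr_scal a : uchi_gr 0 (uscal a)
| uchi_gr_in g x : S x -> glhom g x -> uchi_gr g (uin x)
| uchi_gr_mul g h u w : uchi_gr g u -> uchi_gr h w -> uchi_gr (g + h) (u * w)
| uchi_gr_add g u w : uchi_gr g u -> uchi_gr g w -> uchi_gr g (u + w).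

(* the image in u_chi(S) of the enveloping algebra of a subalgebra X of S *)
Inductive usub (X : set E) : uchi -> Prop :=
| usub_scal a : usub X (uscal a)
| usub_in x : X x -> usub X (uin x)
| usub_mul u w : usub X u -> usub X w -> usub X (u * w)
| usub_add u w : usub X u -> usub X w -> usub X (u + w).

Definition graded_module (M : lmodType uchi) (gr : G -> set M) : Prop :=
  direct_sum gr /\ forall g h u m, uchi_gr g u -> gr h m -> gr (g + h) (u *: m).

Definition graded_submodule (M : lmodType uchi) (gr : G -> set M) (P : set M) :=
  [/\ is_subgroup P, forall u m, P m -> P (u *: m)
    & forall m, P m -> exists (s : seq G) (c : G -> M),
        (forall g, P (c g) /\ gr g (c g)) /\ m = \sum_(g <- s) c g].

Definition graded_simple (M : lmodType uchi) (gr : G -> set M) : Prop :=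
  (exists m : M, m != 0) /\
  forall P, graded_submodule gr P ->
    (forall m, P m -> m = 0) \/ (forall m, P m).

Section Torus.
Variable N : nat.

(* T_0: the product of the diagonal tori of the GL(V_(alpha i)), i >= N *)
Definition T0 : set E := [set t | is_linear t /\ forall k, exists c : F,
  [/\ c != 0, t (v k) = c *: v k & ((blk D k < N)%N -> c = 1)]].

(* the one-parameter subgroup of T_0 in the direction of e_kk, at c *)
Definition cochar (k : nat) (c : F) (t : E) : Prop :=
  t (v k) = c *: v k /\ forall l, l != k -> t (v l) = v l.

(* r is the derivative at e_kk of the character mu *)
Definition char_exponent (mu : T0 -> F) (k : nat) (r : int) : Prop :=
  forall (c : F) (t : T0), c != 0 -> cochar k c (val t) -> mu t = c ^ r.

(* X(T_0): homomorphisms T_0 -> F^* which are algebraic on each T_(alpha i).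
   As T_(alpha i) is generated by its finitely many coordinate one-parameter
   subgroups, it is enough to ask that mu be algebraic on those. *)
Definition XT0 : set (T0 -> F) := [set mu |
  [/\ forall t, mu t != 0,
      forall t t' t'' : T0, val t'' = val t \o val t' -> mu t'' = mu t * mu t'
    & forall k, (N <= blk D k)%N -> exists r, char_exponent mu k r]].

Record uTmodule := UTModule {
  utcar :> lmodType uchi;
  utgr : G -> set utcar;
  utgrP : graded_module utgr;
  tact : T0 -> utcar -> utcar;
  tact_id : forall t m, val t = id -> tact t m = m;
  tact_comp : forall (t t' t'' : T0) m, val t'' = val t \o val t' ->
    tact t'' m = tact t (tact t' m);
  tact_lin : forall t a m m',
    tact t (fscale a m + m') = fscale a (tact t m) + tact t m';
  tact_gr : forall t g m, utgr g m -> utgr g (tact t m);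
  (* y is Ad(t) x = t x t^-1 *)
  tact_Ad : forall (t : T0) x y m, S x -> S y -> y \o val t = val t \o x ->
    tact t (uin x *: m) = uin y *: tact t m;
  (* the differential of the T_0-action on a vector of weight mu *)
  tact_Lie : forall mu m k r, XT0 mu -> (forall t, tact t m = fscale (mu t) m) ->
    (N <= blk D k)%N -> char_exponent mu k r ->
    uin (eij k k) *: m = fscale r%:~R m }.

Definition Tweight (M : uTmodule) (mu : XT0) : set M :=
  [set m | forall t, tact t m = fscale (val mu t) m].

Definition Hweight (M : uTmodule) (mu : Hsub -> F) : set M :=
  [set m | forall h : Hsub, uin (val h) *: m = fscale (mu h) m].

Definition finitely_generated (M : uTmodule) : Prop :=
  exists s : seq M, forall m, exists a : nat -> uchi,
    m = \sum_(i < size s) a i *: s`_i.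

Definition Nplus_locally_finite (M : uTmodule) : Prop :=
  forall g (w : M), utgr g w -> exists s : seq M,
    forall u, usub Nplus u -> exists c : nat -> F,
      u *: w = \sum_(i < size s) fscale (c i) s`_i.

Definition categoryO (M : uTmodule) : Prop :=
  [/\ finitely_generated M, direct_sum (@Hweight M), direct_sum (@Tweight M)
    & Nplus_locally_finite M].

End Torus.
End Enveloping.

(* u_chi(S) -> u_chi(S') for S a subset of S' *)
Definition uchi_incl (chi : E -> F) (S S' : set E) (u : uchi chi S) : uchi chi S' :=
  let t := qrepr u in
  \sum_(k <- msupp t) uscal chi S' t@_k * \prod_(x <- k : seq S) uin chi S' (val x).

Definition babyVerma (chi : E -> F) (M : lmodType (uchi chi Bsub)) : Type :=
  ext_scalars (@uchi_incl chi Bsub cgl) M.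
HB.instance Definition _ chi (M : lmodType (uchi chi Bsub)) :=
  GRing.Lmodule.on (babyVerma M).

Inductive babyVerma_gr (chi : E -> F) (M : lmodType (uchi chi Bsub))
    (gr : G -> set M) : G -> babyVerma M -> Prop :=
| bV_zero g : babyVerma_gr gr g 0
| bV_tensor g h u m : uchi_gr g u -> gr h m -> babyVerma_gr gr (g + h) (tensor _ u m)
| bV_add g z z' : babyVerma_gr gr g z -> babyVerma_gr gr g z' ->
    babyVerma_gr gr g (z + z').

End Prime.
End Cgl.

Arguments gammaP {F} D.
Arguments cgl {F} D.
Arguments glblock {F} D.
Arguments Hsub {F} D.
Arguments Nplus {F} D.
Arguments Nminus {F} D.
Arguments Bsub {F} D.

(* Main.v *)
(** Let v be the highest weight vector of the baby Verma module, e_d and f_d the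
    root vectors of d and -d, and v_i = f_i^(pbar-1) v_(i-1), along the FP ordering
    of the roots of g_n. As the i-th root is simple in the i-th positive system, v_i
    is killed by the next positive system, has weight lambda_(i+1), and rank one
    computations give e_i^(pbar-1) v_i = c * (i-th factor of f_n) * v_(i-1), c <> 0.

    If all factors are nonzero one climbs back from v_k to v. Any nonzero vector z
    lies in some u(n_n^-) v, and multiplying z, or v_k, by the missing powers of the
    f_d, highest roots first, leads to a nonzero multiple of the same vector, the
    ordered product of all f_d^(pbar-1) applied to v; every f_d kills v_k, so v_k is
    itself such a multiple. Thus z generates v.

    If the i-th factor vanishes, e_i^(pbar-1) kills v_i, and straightening shows
    that all that v_i generates has height < 0 relative to v.

    Both directions need that restricted monomials in the f_d do not vanish on v and
    that v is not a combination of vectors of negative height. Instead of proving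
    the PBW theorem for u_chi(cgl(V)) we evaluate in explicit modules: with
    oscillators A_(i,r), B_(i,r), i, r <= m, subject to color Weyl relations,
    e_ij -> sum_r A_(i,r) B_(j,r) represents gl_(m+1), and the p-th power relations,
    additive by Jacobson's formula, have to be checked on matrix units only. *)

From HB Require Import structures.
Require Import Defs.
From mathcomp Require Import all_boot all_order all_algebra finmap.
From mathcomp Require Import ring.
From mathcomp Require Import boolp classical_sets functions.
From mathcomp.multinomials Require Import monalg.

Set Implicit Arguments.
Unset Strict Implicit.
Unset Printing Implicit Defensive.

Import GRing.Theory Order.TTheory Num.Theory.
Local Open Scope classical_set_scope.
Local Open Scope ring_scope.

(** * Straightening and flipped highest weight vectors *)

(** Two orderings of the roots are needed. The FP ordering turns each step into a calculation of
    rank one, but only the ordering by height makes the commutator of two lowering vectors higher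
    than both, so that single exponents can be isolated. Nonvanishing is therefore asked of
    restricted words in any order. The module is a quotient with no height grading given in advance.
    Negative height is a property of an expression by words, and only the models show that v has no
    such expression. Infinite rank enters twice. The roots of N^+ outside g_n must be seen to kill
    whatever is built from v inside g_n, and no finite model carries u_chi(cgl(V)), so identities
    are tested for all large m. The vacuum can be given the weight lambda because v itself forces
    lambda(e_kk)^p - lambda(e_kk) = chi(e_kk)^p, which is what the diagonal operators need for the
    p-th power relation. *)

Lemma natr_fermat (F : fieldType) p (n : nat) : p \in [pchar F] -> n%:R ^+ p = n%:R :> F.
Proof. by move=> pchF; have := pFrobenius_aut_nat pchF n; rewrite pFrobenius_autE. Qed.

(** By Fermat, the roots of X^(p-1) - 1 are the nonzero elements of the prime field; put X = x + 1.
    The left side is what a string of e_d on powers of f_d produces, the right side a factor of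
    f_n. *)
Lemma prod_falling (F : fieldType) p (x : F) : p \in [pchar F] ->
  \prod_(k < p.-1) (x - k%:R) = (x + 1) ^+ p.-1 - 1.
Proof.
move=> pchF; have p_pr := pcharf_prime pchF; have p_gt0 := prime_gt0 p_pr.
pose rs : seq F := [seq k.+1%:R | k <- iota 0 p.-1].
have nz (k : nat) : (0 < k < p)%N -> k%:R != 0 :> F.
  by case/andP=> k0 kp; rewrite -(dvdn_pcharf pchF) gtnNdvd.
have p1 : (0 < p.-1)%N by rewrite -subn1 subn_gt0 prime_gt1.
have eP : 'X^(p.-1) - 1%:P = \prod_(r <- rs) ('X - r%:P).
  rewrite [LHS](@all_roots_prod_XsubC _ _ rs).
  - by rewrite (eqP (monicXnsubC _ _)) ?scale1r.
  - by rewrite size_XnsubC // size_map size_iota.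
  - apply/allP => _ /mapP[k + ->]; rewrite mem_iota => /= lt.
    have nzk : k.+1%:R != 0 :> F by rewrite nz //= -ltn_predRL.
    rewrite /root !hornerE subr_eq0; apply/eqP/(mulfI nzk).
    by rewrite -exprS prednK // natr_fermat // mulr1.
  - rewrite uniq_rootsE map_inj_in_uniq ?iota_uniq // => k l.
    rewrite !mem_iota /=; wlog lekl : k l / (k <= l)%N => [H|] lk ll e.
      by case/orP: (leq_total k l) => le; [apply: H | apply/esym/H].
    apply/eqP; rewrite eqn_leq lekl /= leqNgt; apply/negP => lt.
    have /eqP[] : (l - k)%:R != 0 :> F.
      by rewrite nz // subn_gt0 lt (leq_ltn_trans (leq_subr _ _)) // (leq_trans ll) ?leq_pred.
    by rewrite -subSS natrB // -e subrr.
have := congr1 (horner^~ (x + 1)) eP; rewrite !hornerE => ->.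
rewrite big_map horner_prod -[in RHS](subn0 p.-1) -/(index_iota 0 p.-1) big_mkord.
by apply: eq_bigr => k _; rewrite !hornerE -natr1 opprD addrACA subrr addr0.
Qed.

Lemma exprD_comm_pchar p (A : nzRingType) (I : eqType) (s : seq I) (f : I -> A) :
  p \in [pchar A] -> uniq s ->
  (forall i j, i != j -> f i * f j = f j * f i) ->
  (\sum_(i <- s) f i) ^+ p = \sum_(i <- s) f i ^+ p.
Proof.
move=> pchA us fC; have p_gt0 := prime_gt0 (pcharf_prime pchA); elim: s us => [|i s IHs] /=.
  by rewrite !big_nil expr0n gtn_eqF.
move=> /andP[si us]; rewrite !big_cons -(pFrobenius_autE pchA) pFrobenius_autD_comm.
  by rewrite !pFrobenius_autE IHs.
rewrite /GRing.comm mulr_sumr mulr_suml big_seq [RHS]big_seq.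
by apply: eq_bigr => j js; apply: fC; apply: contraNneq si => ->.
Qed.

Section Straightening.
Variables (F : fieldType) (Z : lmodType F).
Variables (E : rootpair -> {linear Z -> Z}) (q : rootpair -> rootpair -> F).
Variable pb : rootpair -> nat.
Implicit Types (d s : rootpair) (w : seq rootpair) (X Y : set Z) (x y z : Z).

(** The color commutator as an exchange rule. The contraction terms are again matrix units, so
    straightening never leaves the family [E]. *)
Hypothesis E_bracket : forall a b i j z,
  E (a, b) (E (i, j) z) = q (a, b) (i, j) *: E (i, j) (E (a, b) z)
    + (b == i)%:R *: E (a, j) z - (q (a, b) (i, j) * (j == a)%:R) *: E (i, b) z.
Hypothesis E_nilp : forall d z, d.1 != d.2 -> iter (pb d) (E d) z = 0.
Hypothesis pb_gt0 : forall d, (0 < pb d)%N.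

Definition act w z : Z := foldr (fun d => E d) z w.

Lemma act_cat w1 w2 z : act (w1 ++ w2) z = act w1 (act w2 z).
Proof. exact: foldr_cat. Qed.

Lemma act_linear w : linear (act w).
Proof. by elim: w => [|d w IHw] a x y //; rewrite /= -!/(act w _) IHw linearP. Qed.
HB.instance Definition _ w := GRing.isLinear.Build F Z Z *:%R (act w) (act_linear w).

Lemma act_nseq k d z : act (nseq k d) z = iter k (E d) z.
Proof. by elim: k => //= k ->. Qed.

Lemma iterE_linear k d : linear (iter k (E d)).
Proof. by elim: k => [|k IHk] a x y //; rewrite !iterS IHk linearP. Qed.
HB.instance Definition _ k d :=
  GRing.isLinear.Build F Z Z *:%R (iter k (E d)) (iterE_linear k d).

Lemma iterE_eq0 k d z : d.1 != d.2 -> (pb d <= k)%N -> iter k (E d) z = 0.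
Proof. by move=> dd /subnK <-; rewrite iterD E_nilp // linear0. Qed.

Definition subspace X : Prop :=
  [/\ X 0, forall x y, X x -> X y -> X (x + y) & forall a x, X x -> X (a *: x)].

Lemma subspace_sum X (I : Type) (r : seq I) (P : pred I) (f : I -> Z) :
  subspace X -> (forall i, P i -> X (f i)) -> X (\sum_(i <- r | P i) f i).
Proof. by case=> X0 XD _ Xf; apply: big_ind. Qed.

(** [Mon w X] is the space of ordered restricted monomials in the root vectors of [w] applied to
    [X], the head of [w] acting last. Each exponent has its own vector of [X], which makes it a
    subspace. *)
Definition Mon1 d X : set Z :=
  [set z | exists zs : nat -> Z, (forall a, X (zs a)) /\
     z = \sum_(a < pb d) iter a (E d) (zs a)].
Definition Mon w X : set Z := foldr Mon1 X w.

Lemma Mon1_subspace d X : subspace X -> subspace (Mon1 d X).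
Proof.
case=> X0 XD XZ; split.
- by exists (fun=> 0); split=> //; rewrite big1 // => i _; rewrite linear0.
- move=> _ _ [f [Xf ->]] [g [Xg ->]]; exists (f \+ g); split=> [a|]; first exact: XD.
  by rewrite -big_split; apply: eq_bigr => i _; rewrite /= linearD.
- move=> a _ [f [Xf ->]]; exists (fun i => a *: f i); split=> [i|]; first exact: XZ.
  by rewrite scaler_sumr; apply: eq_bigr => i _; rewrite /= linearZ.
Qed.

Lemma Mon_subspace w X : subspace X -> subspace (Mon w X).
Proof. by move=> sX; elim: w => //= d w; exact: Mon1_subspace. Qed.

Lemma subset_Mon1 d X : subspace X -> X `<=` Mon1 d X.
Proof.
case=> X0 _ _ x Xx; exists (fun a => if a == 0%N then x else 0).
split=> [a|]; first by case: ifP.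
rewrite -(prednK (pb_gt0 d)) big_ord_recl /= big1 ?addr0 // => i _.
by rewrite linear0 /= linear0.
Qed.

(** Multiplication shifts the exponents by one, and the overflow at exponent [pb d] vanishes by
    nilpotency. *)
Lemma Mon1_E d X z : d.1 != d.2 -> subspace X -> Mon1 d X z -> Mon1 d X (E d z).
Proof.
move=> dd [X0 _ _] [f [Xf ->]]; exists (fun a => if a is b.+1 then f b else 0).
split=> [[]//|]; rewrite linear_sum /=.
move: (E_nilp (f (pb d).-1) dd); case: (pb d) (pb_gt0 d) => // n _ /= nil.
rewrite big_ord_recr big_ord_recl /= add0r nil addr0.
by apply: eq_bigr.
Qed.

(* Every sum of the root [d] at the head of the list and of a root coming later,
   or lying in [K], is no root or comes later itself, or lies in [K]. *)
Fixpoint sum_closed (K : set rootpair) w : Prop :=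
  if w is d :: w' then
    [/\ d.1 != d.2, forall s, s \in w' \/ K s ->
          (s.2 = d.1 -> (s.1, d.2) \in w' \/ K (s.1, d.2)) /\
          (d.2 = s.1 -> (d.1, s.2) \in w' \/ K (d.1, s.2))
      & sum_closed K w']
  else True.

(** Induction on [w] and, inside, on the exponent of its head d. A later root vector moved past one
    e_d leaves contractions that are later or in [K] and meet a smaller power of e_d; e_d itself
    only shifts exponents. *)
Lemma Mon_stable (K : set rootpair) w X : subspace X ->
  (forall s x, K s -> X x -> X (E s x)) -> sum_closed K w ->
  forall s z, s \in w \/ K s -> Mon w X z -> Mon w X (E s z).
Proof.
move=> sX KX; elim: w => [|[i j] w IHw] /=.
  by move=> _ s z [|Ks] //; exact: KX.
case=> dd cl {}/IHw IHw.
have sY := Mon_subspace w sX; have sdY := Mon1_subspace (i, j) sY.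
have [Y0 YD YZ] := sdY.
have later s z : s \in w \/ K s -> Mon1 (i, j) (Mon w X) z ->
    Mon1 (i, j) (Mon w X) (E s z).
  move=> ws [f [Xf ->]]; rewrite linear_sum; apply: subspace_sum => // a _ /=.
  elim: {a}(a : nat) (f a) (Xf a) s ws => [|a IHa] x Xx [b c] ws.
    by apply: subset_Mon1 => //; exact: IHw.
  have /= [cl1 cl2] := cl _ ws.
  rewrite E_bracket; apply: (YD); first apply: (YD).
  - by apply/YZ/Mon1_E => //; apply: IHa.
  - by case: eqP => [/cl1 u|_]; rewrite ?scale0r ?scale1r //; apply: IHa.
  - by rewrite -scaleNr; case: eqP => [/cl2 u|_];
      rewrite ?mulr0 ?oppr0 ?scale0r //; apply: YZ; apply: IHa.
move=> s z; rewrite inE => -[/orP[/eqP->|ws]|Ks]; first exact: Mon1_E.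
  by apply: later; left.
by apply: later; right.
Qed.

Inductive Gen (P : set rootpair) X : set Z :=
| Gen_in z of X z : Gen P X z
| Gen_E d z of P d & Gen P X z : Gen P X (E d z)
| Gen_D y z of Gen P X y & Gen P X z : Gen P X (y + z)
| Gen_Z a z of Gen P X z : Gen P X (a *: z).

Definition line x : set Z := [set z | exists c, z = c *: x].

Lemma line_subspace x : subspace (line x).
Proof.
split; first by exists 0; rewrite scale0r.
  by move=> _ _ [a ->] [b ->]; exists (a + b); rewrite scalerDl.
by move=> a _ [b ->]; exists (a * b); rewrite scalerA.
Qed.

Lemma line_id x : line x x.
Proof. by exists 1; rewrite scale1r. Qed.

Definition lower : set rootpair := [set d | (d.2 < d.1)%N].
(* [Low X] is u(N^-) X. *)
Notation Low := (Gen lower).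

(** This is u(g) X = u(N^-) X for a B-stable [X]. The induction keeps [s] arbitrary, because
    exchanging with a lowering vector produces other matrix units. *)
Lemma Low_stable X : subspace X ->
  (forall s x, (s.1 <= s.2)%N -> X x -> X (E s x)) ->
  forall s z, Low X z -> Low X (E s z).
Proof.
move=> [X0 _ _] EX s z Lz; elim: Lz s => {z}
  [z Xz|[i j] z lt_d Lz IHz|y z Ly IHy Lz IHz|a z Lz IHz] s.
- case: (leqP s.1 s.2) => ss; first exact/Gen_in/EX.
  exact/Gen_E/Gen_in.
- case: s => a b; rewrite E_bracket; apply: Gen_D; first apply: Gen_D.
  + by apply/Gen_Z/Gen_E.
  + by apply/Gen_Z.
  + by rewrite -scaleNr; apply/Gen_Z.
- by rewrite linearD; exact: Gen_D.
- by rewrite linearZ /=; apply: Gen_Z.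
Qed.

Lemma Gen_sub (P : set rootpair) X Y : subspace Y -> X `<=` Y ->
  (forall d z, P d -> Y z -> Y (E d z)) -> Gen P X `<=` Y.
Proof.
case=> Y0 YD YZ XY YE z; elim=> {z} [z /XY //|d z ld _|y z _ Yy _|a z _].
- exact: YE.
- exact: YD.
- exact: YZ.
Qed.

Definition Span z : set Z :=
  [set y | exists t : seq (F * seq rootpair), y = \sum_(u <- t) u.1 *: act u.2 z].

Lemma Span_subspace z : subspace (Span z).
Proof.
split; first by exists [::]; rewrite big_nil.
  by move=> _ _ [t ->] [u ->]; exists (t ++ u); rewrite big_cat.
move=> a _ [t ->]; exists [seq (a * u.1, u.2) | u <- t].
by rewrite big_map scaler_sumr; apply: eq_bigr => i _; rewrite scalerA.
Qed.

Lemma Span_act z w : Span z (act w z).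
Proof. by exists [:: (1, w)]; rewrite big_seq1 scale1r. Qed.

Lemma Span_actE z w y : Span z y -> Span z (act w y).
Proof.
move=> [t ->]; exists [seq (u.1, w ++ u.2) | u <- t].
rewrite big_map linear_sum; apply: eq_bigr => u _ /=.
by rewrite linearZ /= act_cat.
Qed.

Lemma Span_trans x y z : Span x y -> Span y z -> Span x z.
Proof.
move=> xy [t ->]; have [S0 SD SZ] := Span_subspace x.
by apply: subspace_sum => // u _; apply/SZ/Span_actE.
Qed.

Definition ht w : int := \sum_(d <- w) ((d.2)%:Z - (d.1)%:Z).

(** The bound concerns the words in some expression of [y], not [y] itself: linear relations between
    words of different heights are not excluded by the definition. *)
Definition Below v (b : int) : set Z :=
  [set y | exists2 t : seq (F * seq rootpair), (forall u, u \in t -> ht u.2 <= b) &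
     y = \sum_(u <- t) u.1 *: act u.2 v].

Lemma Below_subspace v b : subspace (Below v b).
Proof.
split; first by exists [::]; rewrite ?big_nil.
  move=> _ _ [t tb ->] [u ub ->]; exists (t ++ u); rewrite ?big_cat // => w.
  by rewrite mem_cat => /orP[/tb|/ub].
move=> a _ [t tb ->]; exists [seq (a * u.1, u.2) | u <- t].
  by move=> w /mapP[u /tb ub ->].
by rewrite big_map scaler_sumr; apply: eq_bigr => i _; rewrite scalerA.
Qed.

Lemma Below_act v w : Below v (ht w) (act w v).
Proof.
exists [:: (1, w)]; last by rewrite big_seq1 scale1r.
by move=> u; rewrite inE => /eqP->.
Qed.

Lemma Below_le v b c : b <= c -> Below v b `<=` Below v c.
Proof. by move=> bc z [t tb ->]; exists t => // u /tb /le_trans; exact. Qed.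

Lemma Below_E v b d z : Below v b z -> Below v (b + ((d.2)%:Z - (d.1)%:Z)) (E d z).
Proof.
move=> [t tb ->]; exists [seq (u.1, d :: u.2) | u <- t].
  move=> w /mapP[u /tb ub ->]; rewrite /ht /= big_cons addrC.
  by rewrite lerD2r.
by rewrite big_map linear_sum; apply: eq_bigr => u _ /=; rewrite linearZ.
Qed.

Lemma Below_iter v b d k z : Below v b z ->
  Below v (b + ((d.2)%:Z - (d.1)%:Z) *+ k) (iter k (E d) z).
Proof.
move=> Bz; elim: k => [|k IHk] /=; first by rewrite addr0.
by rewrite mulrSr addrA; exact: Below_E.
Qed.

Lemma Below_Mon1 v b d X : (d.1 <= d.2)%N -> X `<=` Below v b ->
  Mon1 d X `<=` Below v (b + ((d.2)%:Z - (d.1)%:Z) *+ (pb d).-1).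
Proof.
move=> dd Xb _ [f [Xf ->]]; apply: subspace_sum; first exact: Below_subspace.
move=> a _; apply: (@Below_le _ (b + ((d.2)%:Z - (d.1)%:Z) *+ a)).
  rewrite lerD2l ler_wpMn2l //; first by rewrite subr_ge0 lez_nat.
  by rewrite -ltnS prednK.
exact/Below_iter/Xb.
Qed.

Lemma Below_Mon v b w X : (forall d, d \in w -> (d.1 <= d.2)%N) ->
  X `<=` Below v b -> Mon w X `<=`
    Below v (b + \sum_(d <- w) ((d.2)%:Z - (d.1)%:Z) *+ (pb d).-1).
Proof.
move=> ww Xb; elim: w ww => [|d w IHw] ww /=; first by rewrite big_nil addr0.
rewrite big_cons addrCA addrC; apply: Below_Mon1; first by rewrite ww ?mem_head.
by apply: IHw => s sw; rewrite ww // inE sw orbT.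
Qed.

Lemma Mon_cat w1 w2 X : Mon (w1 ++ w2) X = Mon w1 (Mon w2 X).
Proof. exact: foldr_cat. Qed.

(** This brings a splitting of the innermost factor, by its exponent, to the outside of the
    monomials, as [Comb] requires. *)
Lemma Mon_sum w X n (Xs : nat -> set Z) : (forall a, subspace (Xs a)) ->
  (forall x, X x -> exists xs : nat -> Z,
     (forall a, Xs a (xs a)) /\ x = \sum_(a < n) xs a) ->
  forall z, Mon w X z -> exists zs : nat -> Z,
    (forall a, Mon w (Xs a) (zs a)) /\ z = \sum_(a < n) zs a.
Proof.
move=> sXs XX; elim: w => [|d w IHw] //= z [f [Xf ->]].
have /choice[g Hg] b := IHw _ (Xf b).
exists (fun a => \sum_(b < pb d) iter b (E d) (g b a)); split=> [a|].
  by exists (g^~ a); split=> // b; case: (Hg b).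
rewrite exchange_big; apply: eq_bigr => b _ /=.
by have [_ {1}->] := Hg b; rewrite linear_sum.
Qed.

(** Combinations of restricted monomials unfolded from the side of [x]: the head of [w] acts first,
    and the terms are sorted by its exponent. *)
Fixpoint Comb w x z : Prop :=
  if w is d :: w' then exists zs : nat -> Z,
    z = \sum_(a < pb d) zs a /\ forall a, Comb w' (iter a (E d) x) (zs a)
  else exists c, z = c *: x.

(* [z] is a formally nonzero combination of restricted monomials. *)
Fixpoint CombNZ w x z : Prop :=
  if w is d :: w' then exists zs : nat -> Z,
    [/\ z = \sum_(a < pb d) zs a, forall a, Comb w' (iter a (E d) x) (zs a)
      & exists2 a, (a < pb d)%N & CombNZ w' (iter a (E d) x) (zs a)]
  else exists2 c, c != 0 & z = c *: x.

Lemma Comb_neq0 w x z : Comb w x z -> z != 0 -> CombNZ w x z.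
Proof.
elim: w x z => [|d w IHw] x z /=.
  by move=> [c ->] nz; exists c => //; apply: contraNneq nz => ->; rewrite scale0r.
move=> [zs [-> Hzs]] nz; exists zs; split=> //; apply: contrapT => no.
case/eqP: nz; apply: big1 => a _; apply: contrapT => /eqP nza; apply: no.
by exists a => //; exact: IHw.
Qed.

Lemma Comb0 w z : Comb w 0 z -> z = 0.
Proof.
elim: w z => [|d w IHw] z /=; first by move=> [c ->]; rewrite scaler0.
by move=> [zs [-> H]]; apply: big1 => a _; apply: IHw; have := H a; rewrite linear0.
Qed.

Lemma CombZ w c x z : Comb w (c *: x) z -> Comb w x z.
Proof.
elim: w x z => [|d w IHw] x z /=; first by move=> [a ->]; exists (a * c); rewrite scalerA.
move=> [zs [-> H]]; exists zs; split=> // a; apply: IHw.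
by have := H a; rewrite linearZ.
Qed.

Lemma CombNZZ w c x z : c != 0 -> CombNZ w (c *: x) z -> CombNZ w x z.
Proof.
move=> c0; elim: w x z => [|d w IHw] x z /=.
  by move=> [a a0 ->]; exists (a * c); rewrite ?mulf_neq0 ?scalerA.
move=> [zs [-> H [a lta Ha]]]; exists zs; split=> //.
  by move=> b; apply: (@CombZ _ c); have := H b; rewrite linearZ.
by exists a => //; apply: IHw; move: Ha; rewrite linearZ.
Qed.

Lemma Mon_rev_Comb w x z : Mon (rev w) (line x) z -> Comb w x z.
Proof.
elim: w x z => [|d w IHw] x z //=.
rewrite rev_cons -cats1 Mon_cat /= => /(@Mon_sum _ _ (pb d)
  (fun a => line (iter a (E d) x))) [|y [f [/choice[c Hc] ->]]|zs [Hzs ->]].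
- by move=> a; exact: line_subspace.
- exists (fun a => c a *: iter a (E d) x); split=> [a|]; first by exists (c a).
  by apply: eq_bigr => a _; rewrite Hc linearZ.
- by exists zs; split=> // a; apply: IHw.
Qed.

(** * Extracting the monomial of maximal powers *)

Section Top.
Variable full : seq rootpair.
Hypothesis full_lower : forall d, d \in full -> (d.2 < d.1)%N.
Hypothesis full_closed : forall d1 d2, d1 \in full -> d2 \in full ->
  d1.2 = d2.1 -> (d1.1, d2.2) \in full.
Hypothesis q_neq0 : forall d1 d2, q d1 d2 != 0.
Notation words x := (Gen [set d | d \in full] (line x)).

Definition hgt d := (d.1 - d.2)%N.
Definition hgt_ge : rel rootpair := fun d1 d2 => (hgt d2 <= hgt d1)%N.

Lemma hgt_sum d1 d2 : d1 \in full -> d2 \in full -> d1.2 = d2.1 ->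
  hgt (d1.1, d2.2) = (hgt d1 + hgt d2)%N.
Proof.
move=> /full_lower + /full_lower; case: d1 d2 => a b [c d]; rewrite /hgt /= => + + e.
rewrite {b}e => lt1 lt2.
by rewrite addnBA ?(ltnW lt2) // subnK // ltnW.
Qed.

Lemma hgt_gt0 d : d \in full -> (0 < hgt d)%N.
Proof. by move/full_lower; rewrite subn_gt0. Qed.

Lemma words_subspace x : subspace (words x).
Proof.
split; [|exact: Gen_D|exact: Gen_Z].
by apply: Gen_in; case: (line_subspace x).
Qed.

Lemma words_trans x y : words x y -> words y `<=` words x.
Proof.
move=> xy; apply: Gen_sub; first exact: words_subspace.
  by move=> _ [c ->]; exact: Gen_Z.
by move=> d z; exact: Gen_E.
Qed.

Lemma words_iter x d k : d \in full -> words x (iter k (E d) x).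
Proof. by move=> df; elim: k => [|k IHk] /=; [exact/Gen_in/line_id|exact: Gen_E]. Qed.

(** A substitute for centrality of e_t. The commutator of e_t with a root vector of [full] is higher
    than t, so on the words over [x] it vanishes and e_t commutes with the others up to the factor
    [q]. *)
Definition higher_vanish t x := forall d y, d \in full -> (hgt t < hgt d)%N ->
  words x y -> E d y = 0.

Lemma higher_vanish_words t x y : words x y -> higher_vanish t x -> higher_vanish t y.
Proof. by move=> xy H d z df lt /(words_trans xy) xz; exact: (H d). Qed.

Lemma E_comm t d x y : t \in full -> d \in full -> higher_vanish t x ->
  words x y -> E t (E d y) = q t d *: E d (E t y).
Proof.
case: t d => a b [i j] tf df H xy; rewrite E_bracket.
have -> : (b == i)%:R *: E (a, j) y = 0.
  case: eqP => [e|_]; rewrite ?scale0r // (H (a, j)) ?scaler0 //.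
    exact: full_closed tf df e.
  by rewrite (hgt_sum tf df e) -[X in (X < _)%N]addn0 ltn_add2l hgt_gt0.
rewrite addr0; case: eqP => [e|_]; rewrite ?mulr0 ?scale0r ?subr0 //.
rewrite (H (i, b)) ?scaler0 ?subr0 //; first exact: full_closed df tf e.
by rewrite (hgt_sum df tf e) -[X in (X < _)%N]add0n ltn_add2r hgt_gt0.
Qed.

Lemma E_comm_iter t d x k : t \in full -> d \in full -> higher_vanish t x ->
  E t (iter k (E d) x) = q t d ^+ k *: iter k (E d) (E t x).
Proof.
move=> tf df H; elim: k => [|k IHk]; first by rewrite scale1r.
rewrite !iterS (E_comm tf df H); last exact: words_iter.
by rewrite IHk linearZ /= scalerA -exprS.
Qed.

Lemma Comb_E w t x z : {subset w <= full} -> t \in full -> higher_vanish t x ->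
  Comb w x z -> Comb w (E t x) (E t z).
Proof.
move=> + tf; elim: w x z => [|d w IHw] x z /= wf H.
  by move=> [c ->]; exists c; rewrite linearZ.
have df : d \in full by rewrite wf ?mem_head.
move=> [zs [-> Hzs]]; exists (fun a => E t (zs a)); split=> [|a].
  by rewrite linear_sum.
apply: (@CombZ _ (q t d ^+ a)); rewrite -E_comm_iter //.
apply: IHw => //; first by move=> s sw; rewrite wf // inE sw orbT.
by apply: higher_vanish_words H; exact: words_iter.
Qed.

Lemma CombNZ_E w t x z : {subset w <= full} -> t \in full -> higher_vanish t x ->
  CombNZ w x z -> CombNZ w (E t x) (E t z).
Proof.
move=> + tf; elim: w x z => [|d w IHw] x z /= wf H.
  by move=> [c c0 ->]; exists c; rewrite ?linearZ.
have df : d \in full by rewrite wf ?mem_head.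
have wf' : {subset w <= full} by move=> s sw; rewrite wf // inE sw orbT.
have Ha a : higher_vanish t (iter a (E d) x).
  by apply: higher_vanish_words H; exact: words_iter.
move=> [zs [-> Hzs [a lta Hza]]]; exists (fun a => E t (zs a)); split=> [|b|].
- by rewrite linear_sum.
- apply: (@CombZ _ (q t d ^+ b)); rewrite -E_comm_iter //.
  exact: Comb_E.
- exists a => //; apply: (@CombNZZ _ (q t d ^+ a)); first exact: expf_neq0.
  by rewrite -E_comm_iter //; exact: IHw.
Qed.

Lemma Comb_iter w t x z k : {subset w <= full} -> t \in full -> higher_vanish t x ->
  Comb w x z -> Comb w (iter k (E t) x) (iter k (E t) z).
Proof.
move=> wf tf H xz; elim: k => //= k IHk; apply: Comb_E => //.
by apply: higher_vanish_words H; exact: words_iter.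
Qed.

Lemma CombNZ_iter w t x z k : {subset w <= full} -> t \in full -> higher_vanish t x ->
  CombNZ w x z -> CombNZ w (iter k (E t) x) (iter k (E t) z).
Proof.
move=> wf tf H xz; elim: k => //= k IHk; apply: CombNZ_E => //.
by apply: higher_vanish_words H; exact: words_iter.
Qed.

Definition top w x := foldl (fun y d => iter (pb d).-1 (E d) y) x w.

(* Multiplying by the missing powers of the highest root vector, which commutes
   with the others modulo vectors that already vanish, isolates the terms with
   the smallest exponent. *)
Lemma CombNZ_top w x z : {subset w <= full} -> sorted hgt_ge w ->
  (forall d y, d \in full -> d \notin w -> words x y -> E d y = 0) ->
  (forall d t, d \in full -> t \in w -> d \notin w -> (hgt t <= hgt d)%N) ->
  CombNZ w x z -> exists u c, [/\ {subset u <= full}, c != 0 & act u z = c *: top w x].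
Proof.
elim: w x z => [|d w IHw] x z /= wf dw kx hw.
  by move=> [c c0 ->]; exists [::], c.
have df : d \in full by rewrite wf ?mem_head.
have dd : d.1 != d.2 by rewrite neq_ltn full_lower ?orbT.
have wf' : {subset w <= full} by move=> s sw; rewrite wf // inE sw orbT.
have ge_d s : s \in w -> (hgt s <= hgt d)%N.
  by move: dw => /(order_path_min _) /allP; apply=> // a b c /[swap]; exact: leq_trans.
have Hd : higher_vanish d x.
  move=> t y tf lt xy; apply: kx => //; rewrite inE negb_or; apply/andP; split.
    by apply: contraTneq lt => ->; rewrite ltnn.
  by apply: contraTN lt => /ge_d; rewrite -leqNgt.
move=> [zs [-> Hzs ex]].
have {ex} : exists a, `[< (a < pb d)%N /\ CombNZ w (iter a (E d) x) (zs a) >].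
  by case: ex => a lta Ha; exists a; apply/asboolP.
move=> /ex_minnP[a /asboolP[lta Ha] min_a].
(* The missing power of e_d for the minimal exponent a. Terms below a are zero by minimality, and
   terms above a overflow [pb d]. *)
pose k := ((pb d).-1 - a)%N.
have ka : (k + a = (pb d).-1)%N by rewrite subnK // -ltnS prednK.
have Hi i : higher_vanish d (iter i (E d) x).
  by apply: higher_vanish_words Hd; exact: words_iter.
have dzs : iter k (E d) (\sum_(i < pb d) zs i) = iter k (E d) (zs a).
  rewrite linear_sum (bigD1 (Ordinal lta)) //= big1 ?addr0 // => i /eqP ne_i.
  have [lt_i|] := ltnP i a.
    have -> : zs i = 0; last by rewrite linear0.
    apply: contrapT => /eqP nzi; suff /min_a : `[< (i < pb d)%N /\
        CombNZ w (iter i (E d) x) (zs i) >] by rewrite leqNgt lt_i.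
    by apply/asboolP; split=> //; exact: Comb_neq0.
  rewrite leq_eqVlt => /orP[/eqP e|lt_i]; first by case: ne_i; apply: val_inj.
  apply: (@Comb0 w); have := Comb_iter k wf' df (Hi i) (Hzs i).
  rewrite -iterD iterE_eq0 //.
  by apply: (leq_trans (leqSpred _)); rewrite -ka -addnS leq_add2l.
pose x' := iter (pb d).-1 (E d) x.
have xx' : words x x' by exact: words_iter.
(* The vector x' carries the full power of e_d. As e_d moves past all other letters, it kills every
   word over x', so d joins the roots known to vanish when the induction passes to the tail. *)
have kd y : words x' y -> E d y = 0.
  move: y; suff sub : words x' `<=` [set y | E d y = 0 /\ words x y].
    by move=> y /sub[].
  apply: Gen_sub.
  - have [w0 wD wZ] := words_subspace x; split=> /=; first by rewrite linear0.
      by move=> y1 y2 [e1 w1] [e2 w2]; rewrite linearD e1 e2 addr0; split=> //; exact: wD.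
    by move=> b y [e1 w1]; rewrite linearZ /= e1 scaler0; split=> //; exact: wZ.
  - move=> _ [b ->] /=; rewrite linearZ /= -iterS prednK // E_nilp // scaler0.
    by split=> //; exact: Gen_Z.
  - move=> t y /= tf [e w1]; rewrite (E_comm df tf Hd) // e linear0 scaler0; split=> //.
    exact: Gen_E.
have [|t y tf tw|t s tf sw tw||] := IHw x' (iter k (E d) (zs a)) wf'.
- exact: path_sorted dw.
- have [->|ne] := eqVneq t d; first exact: kd.
  by move/(words_trans xx'); apply: kx; rewrite // inE negb_or tw andbT.
- have [->|ne] := eqVneq t d; first exact: ge_d.
  by apply: hw; rewrite // inE ?sw ?orbT // negb_or ne.
- by rewrite /x' -ka iterD; apply: CombNZ_iter.
move=> u [c [uf c0 uz]]; exists (u ++ nseq k d), c; split=> //.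
  by move=> s; rewrite mem_cat => /orP[/uf//|]; rewrite mem_nseq => /andP[_ /eqP->].
by rewrite act_cat act_nseq dzs.
Qed.

Definition desc := sort hgt_ge full.

Lemma desc_sorted : sorted hgt_ge desc.
Proof. by apply: sort_sorted => a b; exact: leq_total. Qed.

(** Heights add, so in ascending order a sum of two roots comes after both. *)
Lemma asc_sum_closed : sum_closed set0 (rev desc).
Proof.
have : {subset rev desc <= full} by move=> d; rewrite mem_rev mem_sort.
have : sorted (fun d1 d2 => hgt d1 <= hgt d2)%N (rev desc).
  by rewrite rev_sorted desc_sorted.
have : forall u d, u \in full -> d \in rev desc -> (hgt d < hgt u)%N -> u \in rev desc.
  by move=> u d uf _ _; rewrite mem_rev mem_sort.
elim: (rev desc) => [|d w IHw] //= up dw wf.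
have df : d \in full by rewrite wf ?mem_head.
have wf' : {subset w <= full} by move=> s sw; rewrite wf // inE sw orbT.
have upd u : u \in full -> (hgt d < hgt u)%N -> u \in w.
  move=> uf lt; have := up u d uf (mem_head _ _) lt.
  by rewrite inE => /orP[/eqP e|//]; rewrite e ltnn in lt.
split; first by rewrite neq_ltn full_lower ?orbT.
  move=> s [sw|//]; have sf := wf' _ sw; split=> e; left; apply: upd.
  - exact: full_closed sf df e.
  - by rewrite (hgt_sum sf df e) -[X in (X < _)%N]add0n ltn_add2r hgt_gt0.
  - exact: full_closed df sf e.
  - by rewrite (hgt_sum df sf e) -[X in (X < _)%N]addn0 ltn_add2l hgt_gt0.
apply: IHw => //; last exact: path_sorted dw.
move=> u t uf tw lt; apply: upd => //; apply: leq_ltn_trans lt.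
by move: dw => /(order_path_min _) /allP; apply=> // a b c; exact: leq_trans.
Qed.

(** The vector reached depends on [x] only. This is what allows two different nonzero [z] to be
    compared. *)
Lemma words_top x z : words x z -> z != 0 ->
  exists u c, [/\ {subset u <= full}, c != 0 & act u z = c *: top desc x].
Proof.
move=> xz nz; apply: CombNZ_top => //.
- by move=> d; rewrite mem_sort.
- exact: desc_sorted.
- by move=> d y df; rewrite mem_sort df.
- by move=> d t df _; rewrite mem_sort df.
apply: Comb_neq0 => //; apply: Mon_rev_Comb; move: z xz {nz}.
apply: Gen_sub; first exact/Mon_subspace/line_subspace.
  elim: (rev desc) => //= d w IHw; apply: subset_trans IHw _.
  exact/subset_Mon1/Mon_subspace/line_subspace.
move=> d z /= df; apply: (Mon_stable (line_subspace x) _ asc_sum_closed) => //.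
by left; rewrite mem_rev mem_sort.
Qed.

Lemma top_act w x : top w x = act (flatten (rev [seq nseq (pb d).-1 d | d <- w])) x.
Proof.
elim: w x => //= d w IHw x; rewrite IHw rev_cons flatten_rcons act_cat.
by rewrite act_nseq.
Qed.

End Top.

(** * Rank one calculations along the FP ordering *)

Section FPChain.
Variables (p : nat) (evn : rootpair -> bool).
Hypothesis pchF : p \in [pchar F].
Hypothesis pbE : forall d, pb d = if evn d then p else 2%N.
Hypothesis evn_ropp : forall d, evn (ropp d) = evn d.
Hypothesis q_neq0 : forall d1 d2, q d1 d2 != 0.
Hypothesis q_ropp : forall d, q d (ropp d) = if evn d then 1 else -1.
Hypothesis q_diag : forall k d, q (k, k) d = 1.

Lemma pb_ropp d : pb (ropp d) = pb d.
Proof. by rewrite !pbE evn_ropp. Qed.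

Definition weight (L : nat -> F) z := forall k, E (k, k) z = L k *: z.

Lemma weight_E L d z : weight L z ->
  weight (fun k => L k + ((k == d.1)%:R - (k == d.2)%:R)) (E d z).
Proof.
case: d => a b Lz k; rewrite E_bracket q_diag scale1r mul1r Lz linearZ /= (eq_sym b).
rewrite !scalerDl scaleNr addrA; congr (_ + _ - _).
  by case: eqP => [->|_] //; rewrite !scale0r.
by case: eqP => [->|_] //; rewrite !scale0r.
Qed.

Lemma weight_iter L d n z : weight L z ->
  weight (fun k => L k + ((k == d.1)%:R - (k == d.2)%:R) *+ n) (iter n (E d) z).
Proof.
move=> Lz; elim: n => [|n IHn] /= k; first by rewrite mulr0n addr0 Lz.
by rewrite (weight_E d IHn) mulrSr -addrA.
Qed.

Definition Hval (L : nat -> F) d := if evn d then L d.1 - L d.2 else L d.1 + L d.2.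

Lemma even_string L d z n : evn d -> d.1 != d.2 -> weight L z -> E d z = 0 ->
  E d (iter n.+1 (E (ropp d)) z) =
    (n.+1%:R * (Hval L d - n%:R)) *: iter n (E (ropp d)) z.
Proof.
case: d => i j; rewrite /Hval => ev; rewrite ev /= => ij Lz ez.
have br y : E (i, j) (E (j, i) y) =
    E (j, i) (E (i, j) y) + E (i, i) y - E (j, j) y.
  by rewrite E_bracket !eqxx mulr1 (q_ropp (i, j)) ev !scale1r.
elim: n => [|n IHn].
  rewrite /= br ez linear0 add0r !Lz -scalerBl; congr (_ *: _).
  by rewrite mul1r subr0.
rewrite iterS br IHn linearZ /= -iterS.
have wn := weight_iter (j, i) n.+1 Lz.
rewrite !wn /= !eqxx (negPf ij) (eq_sym j) (negPf ij) -scalerDl -scalerBl.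
congr (_ *: _); rewrite sub0r subr0 mulNrn -!natr1; ring.
Qed.

Lemma pchar_fact_neq0 n : (n < p)%N -> \prod_(k < n) k.+1%:R != 0 :> F.
Proof.
move=> ltn; apply/prodf_neq0 => k _; rewrite -(dvdn_pcharf pchF) gtnNdvd //.
exact: leq_ltn_trans ltn.
Qed.

(** For d even, each of the p - 1 steps of the sl_2 string contributes (k + 1)(h - k); the numbers k
    + 1 give the unit c = (p - 1)!, and [prod_falling] collects the rest. For d odd there is a
    single step with value h = (h + 1)^1 - 1. *)
Lemma rank_one d L z : d.1 != d.2 -> weight L z -> E d z = 0 ->
  exists2 c : F, c != 0 &
    iter (pb d).-1 (E d) (iter (pb d).-1 (E (ropp d)) z) =
      (c * ((Hval L d + 1) ^+ (pb d).-1 - 1)) *: z.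
Proof.
move=> dd Lz ez; case ev: (evn d); rewrite !pbE ev; last first.
  exists 1; rewrite ?oner_neq0 //= mul1r expr1 addrK /Hval ev.
  move: ev Lz ez dd; case: d => i j /= ev Lz ez _.
  rewrite E_bracket !eqxx mulr1 (q_ropp (i, j)) ev ez linear0 scaler0 add0r.
  by rewrite scale1r scaleN1r opprK !Lz -scalerDl.
exists (\prod_(k < p.-1) k.+1%:R).
  by rewrite pchar_fact_neq0 // prednK // prime_gt0 // (pcharf_prime pchF).
rewrite -prod_falling // -big_split /=; elim: p.-1 => [|n IHn].
  by rewrite big_ord0 scale1r.
by rewrite iterSr (even_string n ev dd Lz ez) linearZ /= IHn scalerA mulrC big_ord_recr.
Qed.

(** The pairs (b.1, d.1) and (d.2, b.2) are the two shapes of the root b - d. They are exactly the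
    contractions that appear when e_b is moved past f_d. *)
Definition simple_closed (P : set rootpair) d : Prop := forall b, P b -> b != d ->
  (b.2 = d.2 -> P (b.1, d.1) /\ (b.1, d.1) != d) /\
  (b.1 = d.1 -> P (d.2, b.2) /\ (d.2, b.2) != d).

Lemma simple_kills (P : set rootpair) d z n : simple_closed P d ->
  (forall b, P b -> b != d -> E b z = 0) ->
  forall b, P b -> b != d -> E b (iter n (E (ropp d)) z) = 0.
Proof.
move=> sP Pz; elim: n => [|n IHn] //= [a b] Pb bd.
have [] := sP _ Pb bd; case: d sP Pz IHn bd => i j /= sP Pz IHn bd s1 s2.
rewrite E_bracket IHn // linear0 scaler0 add0r.
have -> : (b == j)%:R *: E (a, i) (iter n (E (j, i)) z) = 0.
  by case: eqP => [/s1[? ?]|_]; rewrite ?scale0r // IHn ?scaler0.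
by rewrite sub0r; case: eqP => [/esym/s2[? ?]|_];
  rewrite ?mulr0 ?scale0r ?oppr0 // IHn // scaler0 oppr0.
Qed.

Definition flip z d := iter (pb d).-1 (E (ropp d)) z.
Definition flips (s : seq rootpair) z := foldl flip z s.
Definition flipped (s : seq rootpair) i : set rootpair :=
  [set b | b \in [seq ropp d | d <- take i s] ++ drop i s].

Definition shift (L : nat -> F) (s : seq rootpair) : nat -> F := fun k =>
  L k - \sum_(d <- s) ((k == d.1)%:R - (k == d.2)%:R) *+ (pb d).-1.

Lemma flips_weight L (s : seq rootpair) z : weight L z -> weight (shift L s) (flips s z).
Proof.
move=> Lz; elim/last_ind: s => [|s d IHs] k.
  by rewrite /shift big_nil subr0 Lz.
rewrite /flips -cats1 foldl_cat /= (weight_iter (ropp d) _ IHs); congr (_ *: _).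
rewrite /shift big_cat big_seq1 /= opprD addrA; congr (_ + _).
by rewrite -[RHS]mulNrn opprB.
Qed.

Lemma flips_top (s : seq rootpair) z : flips s z = top [seq ropp d | d <- s] z.
Proof. by elim: s z => //= d s IHs z; rewrite IHs pb_ropp. Qed.

(** The multiplicity condition under which [v_free] applies to the word behind [top]. *)
Lemma count_top (s : seq rootpair) d : uniq s ->
  (count_mem d (flatten (rev [seq nseq (pb e).-1 e | e <- s])) < pb d)%N.
Proof.
move=> us; rewrite count_flatten map_rev sumn_rev -map_comp.
suff -> : sumn (map (count_mem d \o (fun e => nseq (pb e).-1 e)) s) =
    if d \in s then (pb d).-1 else 0%N by case: ifP; rewrite ?prednK.
elim: s us => //= e s IHs /andP[es us]; rewrite count_nseq IHs // inE /=.
have [->|ne] := eqVneq d e; first by rewrite (negPf es) mem_head /= mul1n addn0.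
by rewrite in_cons (negPf ne).
Qed.

Section Chain.
Variables (s : seq rootpair) (L : nat -> F) (v : Z).
Hypothesis s_uniq : uniq s.
Hypothesis s_pos : forall d, d \in s -> (d.1 < d.2)%N.
Hypothesis s_simple : forall i, (i < size s)%N ->
  simple_closed (flipped s i) (nth (0, 0)%N s i).
Hypothesis s_closed : forall i, (i < size s)%N -> forall d1 d2,
  d1 \in drop i s -> d2 \in drop i s -> d1.2 = d2.1 -> (d1.1, d2.2) \in drop i s.
Hypothesis v_kills : forall d, (d.1 < d.2)%N -> E d v = 0.
Hypothesis v_weight : weight L v.
Hypothesis v_low : forall z, Low (line v) z.
Hypothesis v_free : forall w, (forall d, d \in w -> lower d) ->
  (forall d, (count_mem d w < pb d)%N) -> act w v != 0.
Hypothesis v_Below : ~ Below v (-1) v.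

Definition factor i :=
  let d := nth (0, 0)%N s i in (Hval (shift L (take i s)) d + 1) ^+ (pb d).-1 - 1.

Lemma nth_dd i : (i < size s)%N -> let d := nth (0, 0)%N s i in d.1 != d.2.
Proof. by move=> lti /=; rewrite neq_ltn s_pos ?mem_nth. Qed.

(** From one system to the next only d is replaced by -d. The vector f_d kills the new vector
    because it carries the maximal power of f_d, and the other roots are handled by
    [simple_kills]. *)
Lemma flips_kills i : (i <= size s)%N ->
  forall b, flipped s i b -> E b (flips (take i s) v) = 0.
Proof.
elim: i => [|i IHi] lti b.
  by rewrite /flipped take0 drop0 /= => /s_pos; exact: v_kills.
rewrite (take_nth (0, 0)%N lti) -cats1 /flips foldl_cat /= -/(flips _ v).
set d := nth _ s i => fb.
have dd : d.1 != d.2 := nth_dd lti.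
have dr : drop i s = d :: drop i.+1 s := drop_nth _ lti.
have [->|bd] := eqVneq b (ropp d).
  by rewrite /flip -iterS prednK // -pb_ropp E_nilp //= eq_sym.
have [] : flipped s i b /\ b != d.
  move: fb; rewrite /flipped /= (take_nth (0, 0)%N lti) map_rcons dr -/d.
  rewrite !mem_cat mem_rcons !inE (negPf bd) /= => /orP[bt|bdr].
    rewrite bt; split=> //; apply: contraTneq bt => ->; apply/mapP => -[e et de].
    have := s_pos (mem_take et); rewrite de in dd *.
    have : (d.1 < d.2)%N by rewrite s_pos ?mem_nth.
    by rewrite de /= => /ltn_trans lt /lt; rewrite ltnn.
  rewrite bdr !orbT; split=> //; apply: contraTneq bdr => ->.
  by have := drop_uniq i s_uniq; rewrite dr => /andP[].
apply: simple_kills; first exact: s_simple.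
by move=> c Pc _; apply: IHi => //; exact: ltnW.
Qed.

Lemma factor_step i : (i < size s)%N -> exists2 c : F, c != 0 &
  let d := nth (0, 0)%N s i in
  iter (pb d).-1 (E d) (flips (take i.+1 s) v) = (c * factor i) *: flips (take i s) v.
Proof.
move=> lti; rewrite (take_nth (0, 0)%N lti) -cats1 /flips foldl_cat /= -/(flips _ v).
apply: rank_one; first exact: nth_dd.
  exact: flips_weight.
apply: flips_kills (ltnW lti) _ _; rewrite /flipped /=.
by rewrite (drop_nth (0, 0)%N lti) mem_cat inE eqxx orbT.
Qed.

(** Sums of roots in a tail of [s] stay in that tail, and a sum of the head with another positive
    root is never the head again. *)
Lemma s_sum_closed l1 l2 l3 : s = l1 ++ l2 ++ l3 -> sum_closed [set d | d \in l3] l2.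
Proof.
elim: l2 l1 => //= d l2 IHl l1 e; have lt1 : (size l1 < size s)%N.
  by rewrite e size_cat /= addnS ltnS leq_addr.
have sd : drop (size l1) s = d :: l2 ++ l3 by rewrite e drop_size_cat.
have ds : d \in s by rewrite e mem_cat inE eqxx orbT.
have cl := s_closed lt1; rewrite sd in cl.
split; first by rewrite neq_ltn s_pos.
  move=> t tl; have {}tl : t \in l2 ++ l3.
    by rewrite mem_cat; case: tl => [->|/= ->]; rewrite ?orbT.
  have ts : t \in s by rewrite e mem_cat inE tl !orbT.
  have later u : u \in d :: l2 ++ l3 -> u != d -> u \in l2 \/ u \in l3.
    by rewrite inE => /orP[->//|]; rewrite mem_cat => /orP[] ? _; [left|right].
  split=> et; apply: later.
  - by apply: cl et; rewrite ?mem_head // inE tl orbT.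
  - have := s_pos ts; rewrite et => ltt.
    by apply: contraTneq ltt => -[<-]; rewrite ltnn.
  - by apply: cl et; rewrite ?mem_head // inE tl orbT.
  - have := s_pos ts; rewrite -et => ltt.
    by apply: contraTneq ltt => <-; rewrite ltnn.
by apply: (IHl (rcons l1 d)); rewrite cat_rcons.
Qed.

Definition drops d : int := ((d.2)%:Z - (d.1)%:Z) *+ (pb d).-1.

Lemma flips_Below l : Below v (- \sum_(d <- l) drops d) (flips l v).
Proof.
elim/last_ind: l => [|l d IHl]; first by have := Below_act v [::]; rewrite /ht !big_nil oppr0.
rewrite -cats1 /flips foldl_cat big_cat big_seq1 /= opprD /drops.
have := Below_iter (ropp d) (pb d).-1 IHl.
by rewrite /= -[in - (_ *+ _)]opprB mulNrn opprK.
Qed.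

(** Cartan elements are beyond [Mon_stable]: their commutator with e_d is a multiple of e_d itself,
    not of a later root. They pass a power of e_d at the cost of a scalar multiple of that power. *)
Lemma Mon_diag l X k : subspace X -> (forall x, X x -> X (E (k, k) x)) ->
  forall z, Mon l X z -> Mon l X (E (k, k) z).
Proof.
move=> sX EX; elim: l => //= d l IHl _ [f [Xf ->]].
have [X0 XD XZ] := Mon_subspace l sX.
have Ek z a : exists c, E (k, k) (iter a (E d) z) = iter a (E d) (E (k, k) z + c *: z).
  elim: a => [|a [c IHa]]; first by exists 0; rewrite scale0r addr0.
  case: d IHa {Xf} => i j IHa /=.
  exists (c + ((k == i)%:R - (k == j)%:R)).
  rewrite E_bracket q_diag scale1r mul1r IHa (eq_sym j) scalerDl addrA -!iterS.
  rewrite [RHS]linearD -addrA linearZ scalerBl /=; congr (_ + _).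
  rewrite -iterS linearB !linearZ /=; congr (_ + _).
    by case: eqP => [->|] //; rewrite !scale0r.
  by case: eqP => [->|] //; rewrite !scale0r.
have /choice[c Hc] a := Ek (f a) a.
exists (fun a => E (k, k) (f a) + c a *: f a); split=> [a|].
  by apply: XD; [exact: IHl | exact: XZ].
by rewrite linear_sum; apply: eq_bigr => a _; rewrite Hc.
Qed.

Variable inn : pred nat.
Hypothesis inn_down : forall a b, (a <= b)%N -> inn b -> inn a.
Hypothesis s_complete : forall d, (d.1 < d.2)%N -> inn d.2 -> d \in s.
Hypothesis s_inn : forall d, d \in s -> inn d.2.

(** The list [s] exhausts only the positive roots of g_n. The remaining raising vectors e_kl end at
    an index l outside g_n, and they annihilate whatever g_n builds from [v]. *)
Definition out_kills : set Z :=
  [set z | forall k l, ~~ inn l -> (k < l)%N -> E (k, l) z = 0].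

Lemma out_kills_subspace : subspace out_kills.
Proof.
split=> [k l *|x y Hx Hy k l nl kl|a x Hx k l nl kl]; rewrite ?linear0 //.
  by rewrite linearD Hx ?Hy ?addr0.
by rewrite linearZ /= Hx ?scaler0.
Qed.

Lemma out_kills_E a b z : inn a -> inn b -> out_kills z -> out_kills (E (a, b) z).
Proof.
move=> ia ib Hz k l nl kl; rewrite E_bracket Hz // linear0 scaler0 add0r.
have -> : (l == a) = false by apply: contraNF nl => /eqP ->.
rewrite scale0r Hz ?scaler0 ?subr0 //; rewrite ltnNge; apply: contra nl => la.
exact: inn_down la ia.
Qed.

Lemma out_kills_flips l : {subset l <= s} -> out_kills (flips l v).
Proof.
elim/last_ind: l => [|l d IHl] ls; first by move=> k m _ km; exact: v_kills.
have ds : d \in s by rewrite ls // mem_rcons mem_head.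
rewrite -cats1 /flips foldl_cat /= /flip.
elim: (pb d).-1 => [|n IHn] /=.
  by apply: IHl => e el; rewrite ls // mem_rcons inE el orbT.
apply: out_kills_E => //; first exact: s_inn.
exact: inn_down (ltnW (s_pos ds)) (s_inn ds).
Qed.

Lemma out_kills_Mon l X : {subset l <= s} -> X `<=` out_kills -> Mon l X `<=` out_kills.
Proof.
move=> + Xo; elim: l => [|d l IHl] //= ls _ [f [Xf ->]].
apply: subspace_sum => [|a _]; first exact: out_kills_subspace.
have ds : d \in s by rewrite ls // mem_head.
have {}Xf : out_kills (f a) by apply: IHl => // e el; rewrite ls // inE el orbT.
elim: {a}(a : nat) (f a) Xf => //= a IHa z Hz.
case: d ds => i j ds in ls f IHa *; apply: out_kills_E; last exact: IHa.
  exact: inn_down (ltnW (s_pos ds)) (s_inn ds).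
exact: (s_inn ds).
Qed.

(* If the factor at [d] vanishes then so does the top power of e_d on the flipped
   vector, so everything the latter generates lies strictly below [v]. *)
Lemma factor_zero i : (i < size s)%N -> factor i = 0 ->
  forall y, Span (flips (take i.+1 s) v) y -> Below v (-1) y.
Proof.
move=> lti f0; set w := flips _ v; set X := Mon (take i.+1 s) (line w).
have sX : subspace X by exact/Mon_subspace/line_subspace.
have ts : {subset take i.+1 s <= s} by move=> d; exact: mem_take.
have Xw : X w.
  have [_ _] : subspace X := sX; rewrite /X.
  elim: (take i.+1 s) => [|d l IHl] _ /=; first exact: line_id.
  apply: subset_Mon1; first exact/Mon_subspace/line_subspace.
  by case: (Mon_subspace l (line_subspace w)) => _ _; exact: IHl.
(* Cartan elements, roots leaving g_n and roots of [s] are treated separately. Among the last, those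
   after position i kill the flipped vector and play the part of [K] in [Mon_stable]. *)
have X_stable t x : (t.1 <= t.2)%N -> X x -> X (E t x).
  case: t => a b /=; rewrite leq_eqVlt => /orP[/eqP <-|ab] Xx.
    apply: Mon_diag Xx; first exact: line_subspace.
    move=> _ [c ->]; rewrite linearZ /= (flips_weight _ v_weight).
    by rewrite scalerA; eexists.
  have [ib|nib] := boolP (inn b); last first.
    have -> : E (a, b) x = 0; last by case: sX.
    apply: out_kills_Mon Xx a b nib ab => // _ [c ->].
    have [_ _] := out_kills_subspace; apply; exact: out_kills_flips.
  have abs : (a, b) \in s by exact: s_complete.
  apply: (@Mon_stable [set d | d \in drop i.+1 s]) Xx.
  - exact: line_subspace.
  - move=> t _ /= td [c ->]; rewrite linearZ /= flips_kills ?scaler0 //.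
      by exists 0; rewrite scale0r.
    by rewrite /flipped /= mem_cat td orbT.
  - by apply: (@s_sum_closed [::]); rewrite cat_take_drop.
  - by move: abs; rewrite -{1}(cat_take_drop i.+1 s) mem_cat => /orP[|]; [left|right].
(* The flipped vector has lost (pbar - 1) delta for each of the roots up to d. The earlier roots can
   regain all of their share, but e_d can be used at most pbar - 2 times, since its power pbar - 1
   gives 0. So at least one copy of d, of height at least 1, is missing. *)
have Xb : X `<=` Below v (-1).
  have [c c0] := factor_step lti; rewrite f0 mulr0 scale0r.
  set d := nth _ s i => top0.
  have dd : (d.1 < d.2)%N by rewrite s_pos ?mem_nth.
  have tE : take i.+1 s = take i s ++ [:: d] by rewrite (take_nth (0, 0)%N lti) -cats1.
  rewrite /X tE Mon_cat.
  apply: subset_trans (@Below_Mon v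
    (- \sum_(e <- take i s) drops e - ((d.2)%:Z - (d.1)%:Z)) _ _ _ _) _.
  - by move=> e /mem_take /s_pos /ltnW.
  - move=> _ [f [/choice[g Hg] ->]]; apply: subspace_sum; first exact: Below_subspace.
    move=> a _; rewrite Hg linearZ /=.
    have [_ _] := Below_subspace v
      (- \sum_(e <- take i s) drops e - ((d.2)%:Z - (d.1)%:Z)); apply.
    have [ea|na] := eqVneq (a : nat) (pb d).-1.
      by rewrite ea top0; case: (Below_subspace v
        (- \sum_(e <- take i s) drops e - ((d.2)%:Z - (d.1)%:Z))).
    have lta : (a < (pb d).-1)%N.
      by rewrite ltn_neqAle na -ltnS prednK ?pb_gt0 ?ltn_ord.
    apply: Below_le (Below_iter d a (flips_Below (take i.+1 s))).
    rewrite tE big_cat big_seq1 opprD -addrA lerD2l /drops addrC lerBlDr.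
    rewrite [X in _ <= X]addrC lerBrDr -mulrSr; apply: ler_wpMn2l => //.
    by rewrite subr_ge0 lez_nat ltnW.
  - apply: Below_le; rewrite addrAC addNr add0r lerN2 lerBrDr.
    by rewrite -PoszD lez_nat add1n.
move=> _ [t ->]; apply: subspace_sum => [|u _]; first exact: Below_subspace.
have [_ _] := Below_subspace v (-1); apply.
(* As [X] is stable under B, u(N^-) X contains all that w generates, and lowering vectors only
   decrease the height. *)
have : Low X (act u.2 w).
  elim: u.2 => [|d l IHl] /=; first exact: Gen_in.
  exact: Low_stable.
apply: Gen_sub => //; first exact: Below_subspace.
move=> d z dl Bz; apply: Below_le (Below_E d Bz).
by rewrite gerDl subr_le0 lez_nat ltnW.
Qed.

Let full := [seq ropp d | d <- s].

Lemma ropp_inj : injective ropp.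
Proof. by move=> [a b] [c d] [-> ->]. Qed.

Lemma mem_full d : (d \in full) = (ropp d \in s).
Proof. by case: d => a b; rewrite -(mem_map ropp_inj s). Qed.

Lemma full_is_lower d : d \in full -> lower d.
Proof. by rewrite mem_full => ds; exact: (s_pos ds). Qed.

Lemma full_is_closed d1 d2 : d1 \in full -> d2 \in full -> d1.2 = d2.1 ->
  (d1.1, d2.2) \in full.
Proof.
rewrite !mem_full => d1s d2s e.
have s0 : (0 < size s)%N by case: (s) d1s.
have := s_closed s0; rewrite drop0 => cl.
by have := cl _ _ d2s d1s; rewrite /= => ->.
Qed.

Lemma top_neq0 l : uniq l -> {subset l <= full} -> top l v != 0.
Proof.
move=> ul lf; rewrite top_act; apply: v_free; last by move=> d; exact: count_top.
move=> d /flattenP[w]; rewrite mem_rev => /mapP[e /lf /full_is_lower el ->].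
by rewrite mem_nseq => /andP[_ /eqP->].
Qed.

Lemma words_act (w : seq rootpair) x : {subset w <= full} ->
  Gen [set d | d \in full] (line x) (act w x).
Proof.
elim: w => [|d w IHw] wf /=; first exact/Gen_in/line_id.
apply: Gen_E; first by rewrite /= wf // mem_head.
by apply: IHw => e ew; rewrite wf // inE ew orbT.
Qed.

Lemma factor_neq0 z : (forall i, (i < size s)%N -> factor i != 0) ->
  Gen [set d | d \in full] (line v) z -> z != 0 -> Span z v.
Proof.
move=> fs vz nz; pose y := flips s v.
have fu : uniq full by rewrite map_inj_uniq //; exact: ropp_inj.
have y0 : y != 0 by rewrite /y flips_top top_neq0.
have vy : Gen [set d | d \in full] (line v) y.
  rewrite /y flips_top top_act; apply: words_act => d /flattenP[w].
  rewrite mem_rev => /mapP[e ef ->].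
  by rewrite mem_nseq => /andP[_ /eqP->].
have [u [c [_ c0 uz]]] :=
  words_top full_is_lower full_is_closed q_neq0 vz nz.
have [u' [c' [uf' c'0 uy]]] :=
  words_top full_is_lower full_is_closed q_neq0 vy y0.
have t0 : top (desc full) v != 0.
  by apply: top_neq0; [rewrite sort_uniq | move=> d; rewrite mem_sort].
(* In the last flipped system all roots are negative, so a letter of u' would kill y, whereas the
   top vector is nonzero. Hence y is already a multiple of the top vector. *)
have u'0 : u' = [::].
  case/lastP: u' uf' uy => // u' d uf' uy.
  have df : d \in full by rewrite uf' // mem_rcons mem_head.
  move: uy; rewrite -cats1 act_cat /= /y -[s in flips s v]take_size.
  rewrite flips_kills ?linear0; last by rewrite /flipped take_size drop_size /= cats0.
    by move/esym/eqP; rewrite scaler_eq0 (negPf c'0) (negPf t0).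
  by [].
have zy : Span z y.
  have yc : y = (c' / c) *: act u z.
    by rewrite uz scalerA divfK // -uy u'0.
  by rewrite yc; have [_ _ SZ] := Span_subspace z; apply/SZ/Span_act.
apply: Span_trans zy _; rewrite /y -[s]take_size.
have : (size s <= size s)%N by [].
elim: {1 3}(size s) => [|i IHi] lti.
  by rewrite take0; exact: (Span_act v [::]).
apply: Span_trans _ (IHi (ltnW lti)).
have [k k0 e] := factor_step lti.
have kf : k * factor i != 0 by rewrite mulf_neq0 ?fs.
set d := nth _ _ _ in e.
have -> : flips (take i s) v = (k * factor i)^-1 *: iter (pb d).-1 (E d) (flips (take i.+1 s) v).
  by rewrite e scalerA mulVf // scale1r.
by rewrite -act_nseq; have [_ _ SZ] := Span_subspace (flips (take i.+1 s) v);
  apply/SZ/Span_act.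
Qed.

End Chain.
End FPChain.

End Straightening.

(** * Jacobson's formula for p-th powers *)

Section PthPower.
Variables (A : nzRingType) (p : nat).
Hypothesis pchA : p \in [pchar A].
Implicit Types P Q : A.

Definition ad P Q := P * Q - Q * P.

Lemma iter_ad P Q k : iter k (ad P) Q =
  \sum_(i < k.+1) ((-1) ^+ i * (P ^+ (k - i) * Q * P ^+ i)) *+ 'C(k, i).
Proof.
elim: k => [|k IHk]; first by rewrite big_ord1 bin0 !expr0 !mul1r mulr1.
rewrite iterS IHk /ad mulr_sumr mulr_suml.
pose a i := P ^+ (k.+1 - i) * Q * P ^+ i.
have -> : \sum_(i < k.+1) P * (((-1) ^+ i * (P ^+ (k - i) * Q * P ^+ i)) *+ 'C(k, i)) =
    \sum_(i < k.+1) ((-1) ^+ i * a i) *+ 'C(k, i).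
  apply: eq_bigr => i _; rewrite mulrnAr; congr (_ *+ _).
  have ik : (i <= k)%N by rewrite -ltnS.
  by rewrite /a subSn // exprS !mulrA -commr_sign.
have -> : \sum_(i < k.+1) ((-1) ^+ i * (P ^+ (k - i) * Q * P ^+ i)) *+ 'C(k, i) * P =
    - \sum_(i < k.+1) ((-1) ^+ i.+1 * a i.+1) *+ 'C(k, i).
  rewrite -sumrN; apply: eq_bigr => i _; rewrite mulrnAl -[RHS]mulNrn; congr (_ *+ _).
  by rewrite exprS mulN1r mulNr opprK /a subSS exprSr !mulrA.
rewrite opprK big_ord_recl [in RHS]big_ord_recl /= !bin0 -addrA; congr (_ + _).
under [in RHS]eq_bigr => i _ do rewrite /bump /= !add1n binS mulrnDr.
rewrite big_split /= -/(a _) [in RHS]big_ord_recr /= bin_small // mulr0n addr0.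
by congr (_ + _); apply: eq_bigr.
Qed.

Lemma bin_pred_pchar i : (i < p)%N -> (-1) ^+ i *+ 'C(p.-1, i) = 1 :> A.
Proof.
have p_pr := pcharf_prime pchA.
have p1 : p.-1.+1 = p by rewrite prednK ?prime_gt0.
elim: i => [|i IHi] lti; first by rewrite bin0.
rewrite exprS mulN1r mulNrn.
have /eqP : 'C(p, i.+1)%:R = 0 :> A.
  by apply/eqP; rewrite -(dvdn_pcharf pchA) prime_dvd_bin.
rewrite -{1}p1 binS natrD addr_eq0 => /eqP e.
by rewrite -mulr_natr e mulrN opprK mulr_natr IHi // ltnW.
Qed.

(** The binomial coefficients of p - 1 are alternating signs modulo p and cancel those of [iter_ad].
    The sum that remains is the noncommutative derivative of a p-th power in direction Q, as in
    [derivX_sum]. *)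
Lemma iter_ad_pchar P Q :
  iter p.-1 (ad P) Q = \sum_(i < p) P ^+ (p.-1 - i) * Q * P ^+ i.
Proof.
have p1 : p.-1.+1 = p by rewrite prednK ?prime_gt0 // (pcharf_prime pchA).
rewrite iter_ad p1; apply: eq_bigr => i _.
by rewrite -mulrnAl bin_pred_pchar // mul1r.
Qed.

Lemma derivX_sum (R : nzRingType) (P : {poly R}) k :
  (P ^+ k)^`() = \sum_(i < k) P ^+ (k.-1 - i) * P^`() * P ^+ i.
Proof.
elim: k => [|k IHk]; first by rewrite big_ord0 expr0 derivC.
rewrite exprS derivM IHk big_ord_recr /= subnn expr0 mul1r addrC; congr (_ + _).
rewrite mulr_sumr; apply: eq_bigr => i _; rewrite !mulrA -exprS; congr (_ ^+ _ * _ * _).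
by case: k i {IHk} => [[]//|k] i /=; rewrite subSn // -ltnS.
Qed.

End PthPower.

Section Jacobson.
Variables (A : nzRingType) (p : nat).
Hypothesis pchA : p \in [pchar A].
Variables x y : A.

(** The polynomial x t + y with t central. Jacobson's terms are the inner coefficients of its p-th
    power. *)
Definition pencil : {poly A} := x%:P * 'X + y%:P.

Lemma coef_pencilM (Q : {poly A}) j :
  (pencil * Q)`_j = (if j is j'.+1 then x * Q`_j' else 0) + y * Q`_j.
Proof.
rewrite /pencil mulrDl coefD coefCM -mulrA -commr_polyX mulrA coefMX coefCM.
by case: j.
Qed.

Lemma coef_Mpencil (Q : {poly A}) j :
  (Q * pencil)`_j = (if j is j'.+1 then Q`_j' * x else 0) + Q`_j * y.
Proof. by rewrite /pencil mulrDr coefD mulrA coefMX !coefMC; case: j. Qed.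

Lemma coef_pencilX_gt k j : (k < j)%N -> (pencil ^+ k)`_j = 0.
Proof.
elim: k j => [|k IHk] [|j] // lt; first by rewrite expr0 coef1.
by rewrite exprS coef_pencilM !IHk ?mulr0 ?addr0 // ltnW.
Qed.

Lemma coef_pencilX k : (pencil ^+ k)`_k = x ^+ k.
Proof.
elim: k => [|k IHk]; first by rewrite !expr0 coef1.
by rewrite !exprS coef_pencilM IHk coef_pencilX_gt ?mulr0 ?addr0.
Qed.

Lemma coef0_pencilX k : (pencil ^+ k)`_0 = y ^+ k.
Proof.
elim: k => [|k IHk]; first by rewrite !expr0 coef1.
by rewrite !exprS coef_pencilM IHk add0r.
Qed.

Lemma sum_pencilX k : \sum_(j < k.+1) (pencil ^+ k)`_j = (x + y) ^+ k.
Proof.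
elim: k => [|k IHk]; first by rewrite big_ord1 !expr0 coef1.
rewrite !exprS -IHk; under eq_bigr => j _ do rewrite coef_pencilM.
rewrite mulrDl !mulr_sumr big_split /=; congr (_ + _); first by rewrite big_ord_recl add0r.
by rewrite big_ord_recr /= coef_pencilX_gt ?mulr0 ?addr0.
Qed.

Definition pencil_ad k i : A := (iter k (ad pencil) x%:P)`_i.

Lemma pencil_ad0 i : pencil_ad 0 i = x *+ (i == 0%N).
Proof. by rewrite /pencil_ad /= coefC; case: i. Qed.

Lemma pencil_adS k i : pencil_ad k.+1 i =
  (if i is i'.+1 then ad x (pencil_ad k i') else 0) + ad y (pencil_ad k i).
Proof.
rewrite /pencil_ad iterS; move: (iter k _ _) => Q.
rewrite {1}/ad coefB coef_pencilM coef_Mpencil /ad.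
by case: i => [|i]; [rewrite !add0r | rewrite opprD addrACA].
Qed.

(* The derivative of the p-th power of x t + y is ad(x t + y)^(p-1) x. *)
Lemma coef_pencil_pchar i :
  (pencil ^+ p)`_i.+1 *+ i.+1 = pencil_ad p.-1 i.
Proof.
have pchP : p \in [pchar {poly A}] by rewrite pchar_poly.
rewrite -coef_deriv derivX_sum /pencil_ad (iter_ad_pchar pchP).
suff -> : pencil^`() = x%:P by [].
by rewrite /pencil derivD derivC addr0 derivM derivC mul0r add0r derivX mulr1.
Qed.

(** Evaluation of the p-th power of the pencil at t = 1, with the two outer coefficients split
    off. *)
Lemma expr_add_pchar : (x + y) ^+ p =
  y ^+ p + \sum_(j < p.-1) (pencil ^+ p)`_j.+1 + x ^+ p.
Proof.
have p1 : p.-1.+1 = p by rewrite prednK ?prime_gt0 // (pcharf_prime pchA).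
rewrite -sum_pencilX big_ord_recr /= coef_pencilX; congr (_ + _).
by case: (p) p1 => // m _; rewrite big_ord_recl coef0_pencilX.
Qed.

End Jacobson.

Section PthPowerTransfer.
Variables (F : fieldType) (p : nat) (B A : algType F) (rho : {linear B -> A}).
Hypothesis pchF : p \in [pchar F].
Variables (S : nat -> set B) (x y : B).
Hypothesis S0 : S 0 x.
Hypothesis Sn0 : forall k, S k 0.
Hypothesis SD : forall k Q Q', S k Q -> S k Q' -> S k (Q + Q').
Hypothesis Sx : forall k Q, S k Q -> S k.+1 (ad x Q).
Hypothesis Sy : forall k Q, S k Q -> S k.+1 (ad y Q).
Hypothesis rho_x : forall k Q, S k Q -> rho (ad x Q) = ad (rho x) (rho Q).
Hypothesis rho_y : forall k Q, S k Q -> rho (ad y Q) = ad (rho y) (rho Q).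

Lemma pchar_alg (C : algType F) : p \in [pchar C].
Proof.
have := pchF; rewrite !inE => /andP[-> /eqP e] /=.
have -> : p%:R = (p%:R : F) *: 1 :> C by rewrite scaler_nat.
by rewrite e scale0r.
Qed.

Lemma rho_pencil_ad k i :
  S k (pencil_ad x y k i) /\
  rho (pencil_ad x y k i) = pencil_ad (rho x) (rho y) k i.
Proof.
elim: k i => [|k IHk] i; first rewrite !pencil_ad0.
  by case: (i == 0%N); rewrite ?mulr1n ?mulr0n ?linear0.
have H := IHk i; rewrite !pencil_adS; split.
  apply: SD; last exact: Sy H.1.
  by case: i H => // i _; apply: Sx; case: (IHk i).
rewrite linearD (rho_y H.1) H.2; congr (_ + _).
case: i H => [|i] _; first by rewrite linear0.
by have [Hi ei] := IHk i; rewrite (rho_x Hi) ei.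
Qed.

Lemma coef_pencil_alg (C : algType F) (a b : C) i : (i < p.-1)%N ->
  (pencil a b ^+ p)`_i.+1 = (i.+1%:R : F)^-1 *: pencil_ad a b p.-1 i.
Proof.
move=> lti; rewrite -(coef_pencil_pchar (pchar_alg C)) -scaler_nat scalerA mulVf.
  by rewrite scale1r.
rewrite -(dvdn_pcharf pchF) gtnNdvd //.
by rewrite -[X in (_ < X)%N](@prednK p) // prime_gt0 // (pcharf_prime pchF).
Qed.

(** The map [rho] is only linear, but it respects ad x and ad y on the sets [S k] that contain the
    iterated commutators. The mixed terms of (x + y)^p are such commutators divided by some i + 1 <
    p, so they cancel and the defect is additive. *)
Lemma rho_pth_powerD : (rho x + rho y) ^+ p - rho ((x + y) ^+ p) =
  (rho x ^+ p - rho (x ^+ p)) + (rho y ^+ p - rho (y ^+ p)).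
Proof.
have cancel (a b c a' c' : A) : a + b + c - (a' + b + c') = (c - c') + (a - a').
  by rewrite (addrAC a) (addrAC a') opprD addrACA subrr addr0 opprD addrACA addrC.
have -> : rho ((x + y) ^+ p) = rho (y ^+ p) +
    \sum_(i < p.-1) (pencil (rho x) (rho y) ^+ p)`_i.+1 + rho (x ^+ p).
  rewrite (expr_add_pchar (pchar_alg B)) !linearD linear_sum; congr (_ + _ + _).
  by apply: eq_bigr => i _; rewrite !coef_pencil_alg // linearZ (rho_pencil_ad _ _).2.
by rewrite (expr_add_pchar (pchar_alg A)) cancel.
Qed.

End PthPowerTransfer.

(** * Matrix units from color oscillators *)

Section ColorWeyl.
Variables (F : fieldType) (A : algType F) (T : finType) (q : T -> T -> F).
Variables Aop Bop : T -> A.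
Hypothesis qK : forall s t, q s t * q t s = 1.
Hypothesis AopM : forall s t, Aop s * Aop t = q s t *: (Aop t * Aop s).
Hypothesis BopM : forall s t, Bop s * Bop t = q s t *: (Bop t * Bop s).
Hypothesis BopAop : forall s t,
  Bop s * Aop t = (q s t)^-1 *: (Aop t * Bop s) + (s == t)%:R *: 1.

Lemma q_neq0 s t : q s t != 0.
Proof. by apply/eqP => e; have := qK s t; rewrite e mul0r => /eqP; rewrite eq_sym oner_eq0. Qed.

Definition quad s t := Aop s * Bop t.

(** In normal order the two products have proportional quartic terms, by the four exchange factors.
    Only the contractions B A remain. *)
Lemma quadM s t u w : quad s t * quad u w =
  (q s u / q s w / q t u * q t w) *: (quad u w * quad s t)
  + (t == u)%:R *: quad s w
  - ((q s u / q s w / q t u * q t w) * (w == s)%:R) *: quad u t.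
Proof.
have nf s' t' u' w' : quad s' t' * quad u' w' =
    (q t' u')^-1 *: (Aop s' * Aop u' * (Bop t' * Bop w')) + (t' == u')%:R *: quad s' w'.
  rewrite /quad mulrA -(mulrA _ (Bop _)) BopAop mulrDr mulrDl.
  by rewrite -!scalerAr mulr1 -!scalerAl !mulrA.
rewrite !nf (AopM u s) (BopM w t) -scalerAl -scalerAr !scalerDr !scalerA.
rewrite [RHS]addrAC addrK; congr (_ *: _ + _).
have inv s' t' : q t' s' = (q s' t')^-1 
  by apply: (mulfI (q_neq0 s' t')); rewrite qK divff ?q_neq0.
rewrite (inv s u) (inv s w) (inv t w) !invrK.
by field; rewrite !q_neq0.
Qed.

End ColorWeyl.

Section ColorGl.
Variables (F : fieldType) (A : algType F) (n : nat) (G : zmodType).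
Variables (bc : G -> G -> F) (dg : 'I_n -> G) (th : 'I_n -> 'I_n -> F).
Hypothesis bcP : bicharacter bc.
Hypothesis thK : forall r r', th r r' * th r' r = 1.
Notation slot := ('I_n * 'I_n)%type.
Variables Aop Bop : slot -> A.
Definition slotq (s t : slot) := bc (dg s.1) (dg t.1) * th s.2 t.2.
Hypothesis AopM : forall s t, Aop s * Aop t = slotq s t *: (Aop t * Aop s).
Hypothesis BopM : forall s t, Bop s * Bop t = slotq s t *: (Bop t * Bop s).
Hypothesis BopAop : forall s t,
  Bop s * Aop t = (slotq s t)^-1 *: (Aop t * Bop s) + (s == t)%:R *: 1.

Lemma bc_neq0 a b : bc a b != 0.
Proof.
by apply/eqP => e; have := bichar_skew bcP a b; rewrite e mul0r => /eqP; rewrite eq_sym oner_eq0.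
Qed.

Lemma bc0l a : bc 0 a = 1.
Proof. by apply: (mulfI (bc_neq0 0 a)); rewrite -(bichar_Dl bcP) addr0 mulr1. Qed.

Lemma bc0r a : bc a 0 = 1.
Proof. by apply: (mulfI (bc_neq0 a 0)); rewrite -(bichar_Dr bcP) addr0 mulr1. Qed.

Lemma bcNl a b : bc (- a) b = (bc a b)^-1.
Proof.
by apply: (mulfI (bc_neq0 a b)); rewrite -(bichar_Dl bcP) subrr bc0l divff ?bc_neq0.
Qed.

Lemma bcNr a b : bc a (- b) = (bc a b)^-1.
Proof.
by apply: (mulfI (bc_neq0 a b)); rewrite -(bichar_Dr bcP) subrr bc0r divff ?bc_neq0.
Qed.

Lemma bcB a b d e : bc (a - b) (d - e) = bc a d / bc a e / bc b d * bc b e.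
Proof.
by rewrite (bichar_Dl bcP) !(bichar_Dr bcP) !bcNl !bcNr invrK mulrA.
Qed.

Lemma slotqK s t : slotq s t * slotq t s = 1.
Proof. by rewrite /slotq mulrACA (bichar_skew bcP) thK mul1r. Qed.

(** Within each quadratic operator a level enters once through A and once through B, so its twist
    [th] cancels. The exchange factor is that of the matrix units, whatever the levels. *)
Lemma slotq_edge i j k l r r' :
  slotq (i, r) (k, r') / slotq (i, r) (l, r') / slotq (j, r) (k, r')
    * slotq (j, r) (l, r') = bc (dg i - dg j) (dg k - dg l).
Proof.
have th0 : th r r' != 0.
  by apply/eqP => e; have := thK r r'; rewrite e mul0r => /eqP; rewrite eq_sym oner_eq0.
rewrite bcB /slotq /=; have [n1 n2] := (bc_neq0 (dg i) (dg l), bc_neq0 (dg j) (dg k)).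
by field; rewrite n1 n2 th0.
Qed.

Definition glop i j := \sum_r quad Aop Bop (i, r) (j, r).

Lemma glopM i j k l : glop i j * glop k l =
  bc (dg i - dg j) (dg k - dg l) *: (glop k l * glop i j)
  + (j == k)%:R *: glop i l
  - (bc (dg i - dg j) (dg k - dg l) * (l == i)%:R) *: glop k j.
Proof.
set kap := bc _ _.
have quadR r r' : quad Aop Bop (i, r) (j, r) * quad Aop Bop (k, r') (l, r') =
    kap *: (quad Aop Bop (k, r') (l, r') * quad Aop Bop (i, r) (j, r))
    + ((j == k)%:R * (r == r')%:R) *: quad Aop Bop (i, r) (l, r')
    - (kap * (l == i)%:R * (r == r')%:R) *: quad Aop Bop (k, r') (j, r).
  rewrite (quadM slotqK AopM BopM BopAop).
  rewrite slotq_edge -/kap.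
  by rewrite !xpair_eqE -!mulnb !natrM !mulrA (eq_sym r').
rewrite /glop mulr_suml.
under eq_bigr => r _ do (rewrite mulr_sumr; under eq_bigr => r' _ do rewrite quadR).
under eq_bigr => r _ do rewrite big_split big_split /=.
rewrite !big_split /=; congr (_ + _ + _).
- rewrite exchange_big mulr_suml scaler_sumr /=; apply: eq_bigr => r' _.
  by rewrite mulr_sumr scaler_sumr.
- rewrite scaler_sumr; apply: eq_bigr => r _.
  rewrite (bigD1 r) //= eqxx mulr1 big1 ?addr0 // => r' /negPf ne.
  by rewrite (eq_sym r) ne mulr0 scale0r.
- rewrite scaler_sumr -sumrN; apply: eq_bigr => r _.
  rewrite (bigD1 r) //= eqxx mulr1 big1 ?addr0 // => r' /negPf ne.
  by rewrite (eq_sym r) ne mulr0 scale0r oppr0.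
Qed.

Notation M := 'M[F]_n.
Definition glrep (X : M) : A := \sum_i \sum_j X i j *: glop i j.

Lemma glrep_linear : linear glrep.
Proof.
move=> a X Y; rewrite /glrep scaler_sumr -big_split; apply: eq_bigr => i _ /=.
rewrite scaler_sumr -big_split; apply: eq_bigr => j _ /=.
by rewrite !mxE scalerDl scalerA.
Qed.
HB.instance Definition _ := GRing.isLinear.Build F M A *:%R glrep glrep_linear.

Lemma glrep_delta i j : glrep (delta_mx i j) = glop i j.
Proof.
rewrite /glrep (bigD1 i) //= (bigD1 j) //= mxE !eqxx scale1r !big1 ?addr0 //.
  move=> k /negPf ki; apply: big1 => l _; by rewrite mxE ki scale0r.
by move=> l /negPf lj; rewrite mxE lj andbF scale0r.
Qed.

Definition mxhom (g : G) : set M := [set X | forall i j, X i j != 0 -> dg i - dg j = g].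

Lemma mxhom0 g : mxhom g 0.
Proof. by move=> i j; rewrite mxE eqxx. Qed.

Lemma mxhomD g X Y : mxhom g X -> mxhom g Y -> mxhom g (X + Y).
Proof.
move=> hX hY i j; rewrite mxE => nz; have [X0|] := eqVneq (X i j) 0; last exact: hX.
by apply: hY; rewrite X0 add0r in nz.
Qed.

Lemma mxhomZ g a X : mxhom g X -> mxhom g (a *: X).
Proof. by move=> hX i j; rewrite mxE mulf_eq0 negb_or => /andP[_ /hX]. Qed.

Lemma mxhomM g h X Y : mxhom g X -> mxhom h Y -> mxhom (g + h) (X *m Y).
Proof.
move=> hX hY i j; rewrite mxE => nz.
have [k] : exists k, X i k * Y k j != 0.
  apply: contrapT => no; case/eqP: nz; apply: big1 => k _.
  by apply/eqP/negPn/negP => nzk; apply: no; exists k.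
by rewrite mulf_eq0 negb_or => /andP[/hX <- /hY <-]; rewrite addrA subrK.
Qed.

Lemma mxhom_delta i j : mxhom (dg i - dg j) (delta_mx i j).
Proof. by move=> k l; rewrite mxE; have [->|_] := eqVneq k i; have [->|_] := eqVneq l j;
  rewrite ?eqxx. Qed.

(** Both sides are expanded in matrix units. Wherever the coefficient is nonzero the two units have
    degrees g and h, so the factor of [glopM] is the required one. *)
Lemma glrep_bracket g h X Y : mxhom g X -> mxhom h Y ->
  glrep X * glrep Y - bc g h *: (glrep Y * glrep X) =
    glrep (X *m Y - bc g h *: (Y *m X)).
Proof.
move=> hX hY; pose e (u : 'I_n * 'I_n) : M := delta_mx u.1 u.2.
have eX U : glrep U = \sum_u U u.1 u.2 *: glop u.1 u.2 by rewrite /glrep pair_bigA.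
have dX (U : M) : U = \sum_u U u.1 u.2 *: e u by apply: etrans (matrix_sum_delta U) _; exact: pair_bigA.
have mulU U V : U *m V =
    \sum_u \sum_w (U u.1 u.2 * V w.1 w.2) *: (e u *m e w).
  rewrite {1}(dX U) {1}(dX V) mulmx_suml; apply: eq_bigr => u _.
  rewrite mulmx_sumr; apply: eq_bigr => w _.
  by rewrite -scalemxAl -scalemxAr scalerA.
have mulR U V : glrep U * glrep V = \sum_u \sum_w
    (U u.1 u.2 * V w.1 w.2) *: (glop u.1 u.2 * glop w.1 w.2).
  rewrite !eX mulr_suml; apply: eq_bigr => u _.
  rewrite mulr_sumr; apply: eq_bigr => w _.
  by rewrite -scalerAl -scalerAr scalerA.
rewrite !mulR (mulU X) (mulU Y) [X in _ - _ *: X]exchange_big.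
rewrite [X in glrep (_ - _ *: X)]exchange_big /= !scaler_sumr -!sumrB linear_sum.
apply: eq_bigr => u _; rewrite !scaler_sumr -!sumrB linear_sum; apply: eq_bigr => w _ /=.
have [Xu|Xu] := eqVneq (X u.1 u.2) 0.
  by rewrite Xu mulr0 mul0r !scale0r !scaler0 !subr0 linear0.
have [Yw|Yw] := eqVneq (Y w.1 w.2) 0.
  by rewrite Yw mulr0 mul0r !scale0r !scaler0 !subr0 linear0.
have sw (C : lmodType F) a b (t : C) : a *: (b *: t) = b *: (a *: t).
  by rewrite !scalerA mulrC.
rewrite (mulrC (Y _ _)) !(sw _ (bc g h)) -!scalerBr [RHS]linearZ /=; congr (_ *: _).
have cancel (x y z : A) : x + y - z - x = y - z by rewrite addrAC (addrC x) addrK.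
rewrite [RHS]linearB /= [glrep (_ *: _)]linearZ /= glopM (hX _ _ Xu) (hY _ _ Yw) cancel.
rewrite !mul_delta_mx_cond ![glrep (_ *+ _)]linearMn /= !glrep_delta.
by case: (u.2 == w.1); case: (w.2 == u.1);
  rewrite ?mulr1n ?mulr0n ?mulr1 ?mulr0 ?scale1r ?scale0r ?scaler0.
Qed.

End ColorGl.

Section GlPthPower.
Variables (F : fieldType) (p : nat) (A : algType F) (n : nat) (G : zmodType).
Variables (bc : G -> G -> F) (dg : 'I_n.+1 -> G) (th : 'I_n.+1 -> 'I_n.+1 -> F).
Hypothesis pchF : p \in [pchar F].
Hypothesis bcP : bicharacter bc.
Hypothesis thK : forall r r', th r r' * th r' r = 1.
Variables Aop Bop : 'I_n.+1 * 'I_n.+1 -> A.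
Hypothesis AopM : forall s t, Aop s * Aop t = slotq bc dg th s t *: (Aop t * Aop s).
Hypothesis BopM : forall s t, Bop s * Bop t = slotq bc dg th s t *: (Bop t * Bop s).
Hypothesis BopAop : forall s t,
  Bop s * Aop t = (slotq bc dg th s t)^-1 *: (Aop t * Bop s) + (s == t)%:R *: 1.
Variable chi : 'I_n.+1 -> F.
Hypothesis glop_pow : forall i j, bc (dg i - dg j) (dg i - dg j) = 1 ->
  glop Aop Bop i j ^+ p = if i == j then glop Aop Bop i i + (chi i ^+ p) *: 1 else 0.
Notation rho := (glrep Aop Bop).
Implicit Types X Y Q : 'M[F]_n.+1.

Lemma bcMn g k : bc g g = 1 -> bc g (g *+ k) = 1.
Proof.
move=> gg; elim: k => [|k IHk]; first by rewrite bc0r.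
by rewrite mulrS (bichar_Dr bcP) gg IHk mulr1.
Qed.

Lemma glrep_ad g k X Q : bc g g = 1 -> mxhom dg g X -> mxhom dg (g *+ k) Q ->
  rho (ad X Q) = ad (rho X) (rho Q).
Proof.
move=> gg hX hQ; have := glrep_bracket bcP thK AopM BopM BopAop hX hQ.
by rewrite (bcMn k gg) !scale1r /ad => ->.
Qed.

Lemma mxhom_ad g k X Q : mxhom dg g X -> mxhom dg (g *+ k) Q ->
  mxhom dg (g *+ k.+1) (ad X Q).
Proof.
move=> hX hQ; rewrite /ad -scaleN1r; apply: mxhomD.
  by rewrite mulrS; exact: mxhomM.
by apply: mxhomZ; rewrite mulrSr; exact: mxhomM.
Qed.

Definition pdefect X : A := rho X ^+ p - rho (X ^+ p).

(** For g in Gamma^+, color brackets between degree g and its multiples are ordinary commutators.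
    Thus Jacobson's formula transfers along the degrees (k + 1) g. *)
Lemma pdefectD g X Y : bc g g = 1 -> mxhom dg g X -> mxhom dg g Y ->
  pdefect (X + Y) = pdefect X + pdefect Y.
Proof.
move=> gg hX hY; rewrite /pdefect linearD /=.
apply: (@rho_pth_powerD _ _ _ _ _ pchF (fun k => mxhom dg (g *+ k.+1))).
- by rewrite mulr1n.
- by move=> k; exact: mxhom0.
- by move=> k Q Q'; exact: mxhomD.
- by move=> k Q hQ; exact: mxhom_ad.
- by move=> k Q hQ; exact: mxhom_ad.
- by move=> k Q; exact: glrep_ad.
- by move=> k Q; exact: glrep_ad.
Qed.

Let p_gt0 : (0 < p)%N. Proof. exact/prime_gt0/(pcharf_prime pchF). Qed.
Let p_gt1 : (1 < p)%N. Proof. exact/prime_gt1/(pcharf_prime pchF). Qed.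

Lemma pdefect0 : pdefect 0 = 0.
Proof. by rewrite /pdefect linear0 expr0n -[_ == 0%N]negbK -lt0n p_gt0 expr0n -[_ == 0%N]negbK -lt0n p_gt0 /= linear0 subrr. Qed.

Lemma delta_mx_pth i j : (delta_mx i j : 'M[F]_n.+1) ^+ p =
  if i == j then delta_mx i j else 0.
Proof.
case: (p) p_gt1 => [|[|m]] // _; elim: m => [|m IHm].
  by rewrite expr2 -mulmxE mul_delta_mx_cond eq_sym; case: eqP => [->|_].
rewrite exprS IHm; case: eqP => [->|_]; last by rewrite mulr0.
by rewrite -mulmxE mul_delta_mx.
Qed.

Lemma pdefect_delta a i j : bc (dg i - dg j) (dg i - dg j) = 1 ->
  pdefect (a *: delta_mx i j) = if i == j then ((a * chi i) ^+ p) *: 1 else 0.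
Proof.
move=> ev; rewrite /pdefect exprZn ![rho (_ *: _)]linearZ /= exprZn -scalerBr.
rewrite glrep_delta glop_pow // delta_mx_pth.
case: eqP => [->|_]; last by rewrite linear0 subrr scaler0.
by rewrite glrep_delta addrAC subrr add0r scalerA exprMn.
Qed.

(** [X] is a sum of multiples of matrix units of the same degree g. The defects add up, and
    Frobenius merges the p-th powers of the diagonal contributions into one. *)
Lemma glrep_pth g X : bc g g = 1 -> mxhom dg g X ->
  rho X ^+ p = rho (X ^+ p) + ((\sum_i X i i * chi i) ^+ p) *: 1.
Proof.
move=> gg hX; apply/eqP; rewrite [X in _ == X]addrC -subr_eq -/(pdefect X); apply/eqP.
pose Y (u : 'I_n.+1 * 'I_n.+1) : 'M[F]_n.+1 := X u.1 u.2 *: delta_mx u.1 u.2.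
have hY u : mxhom dg g (Y u).
  have [e|nz] := eqVneq (X u.1 u.2) 0; first by rewrite /Y e scale0r; exact: mxhom0.
  by apply: mxhomZ; rewrite -(hX _ _ nz); exact: mxhom_delta.
have dY u : pdefect (Y u) = (((u.1 == u.2)%:R * X u.1 u.2 * chi u.1) ^+ p) *: 1.
  have [e|nz] := eqVneq (X u.1 u.2) 0.
    by rewrite /Y e scale0r pdefect0 mulr0 mul0r expr0n gtn_eqF // scale0r.
  rewrite pdefect_delta; last by rewrite (hX _ _ nz).
  case: eqP => _; rewrite ?mul1r // !mul0r expr0n gtn_eqF //.
  by rewrite scale0r.
have [hS dS] : mxhom dg g (\sum_u Y u) /\ pdefect (\sum_u Y u) =
    (\sum_u ((u.1 == u.2)%:R * X u.1 u.2 * chi u.1)) ^+ p *: 1.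
  elim/big_rec2: _ => [|u c Z _ [hZ dZ]].
    by rewrite pdefect0 expr0n gtn_eqF // scale0r; split=> //; exact: mxhom0.
  split; first exact: mxhomD.
  rewrite (pdefectD gg) // dZ dY -scalerDl; congr (_ *: _).
  by rewrite -!(pFrobenius_autE pchF) rmorphD.
have eX : X = \sum_u Y u.
  by apply: etrans (matrix_sum_delta X) _; exact: pair_bigA.
rewrite {1}eX dS; congr (_ ^+ _ *: _).
rewrite -(pair_bigA _ (fun i j => (i == j)%:R * X i j * chi i)) /=.
apply: eq_bigr => i _; rewrite (bigD1 i) //= eqxx mul1r big1 ?addr0 // => j /negPf ji.
by rewrite eq_sym ji !mul0r.
Qed.

End GlPthPower.

(** * Linear operators on functions and weighted shifts *)

Section OperatorAlgebra.
Variables (F : fieldType) (X : zmodType).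
Local Notation W := (X -> F).

Definition op_linear (T : W -> W) := forall a (f g : W),
  T (fun x => a * f x + g x) = (fun x => a * T f x + T g x).

Record opr := Opr { opf :> W -> W; oprP : op_linear opf }.

Lemma opr_eqP (S T : opr) : (forall f x, S f x = T f x) -> S = T.
Proof.
case: S T => [S HS] [T HT] /= e.
have eST : S = T by apply/funext => f; apply/funext => x.
by subst T; congr Opr; exact: Prop_irrelevance.
Qed.

HB.instance Definition _ := gen_eqMixin opr.
HB.instance Definition _ := gen_choiceMixin opr.

Program Definition op0 : opr := @Opr (fun _ _ => 0) _.
Next Obligation. by move=> a f g; apply/funext => x; rewrite mulr0 addr0. Qed.
Program Definition opN (T : opr) : opr := @Opr (fun f x => - T f x) _.
Next Obligation.
by move=> a f g; apply/funext => x; rewrite oprP opprD mulrN.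
Qed.
Program Definition opD (S T : opr) : opr := @Opr (fun f x => S f x + T f x) _.
Next Obligation.
by move=> a f g; apply/funext => x; rewrite !oprP mulrDr addrACA.
Qed.
Program Definition op1 : opr := @Opr id _.
Next Obligation. by []. Qed.
Program Definition opM (S T : opr) : opr := @Opr (fun f => S (T f)) _.
Next Obligation. by move=> a f g; rewrite !oprP. Qed.
Program Definition opZ (c : F) (T : opr) : opr := @Opr (fun f x => c * T f x) _.
Next Obligation.
by move=> a f g; apply/funext => x; rewrite oprP mulrDr mulrCA.
Qed.

Lemma opDA : associative opD.
Proof. by move=> *; apply: opr_eqP => f x /=; rewrite addrA. Qed.
Lemma opDC : commutative opD.
Proof. by move=> *; apply: opr_eqP => f x /=; rewrite addrC. Qed.
Lemma op0D : left_id op0 opD.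
Proof. by move=> *; apply: opr_eqP => f x /=; rewrite add0r. Qed.
Lemma opND : left_inverse op0 opN opD.
Proof. by move=> *; apply: opr_eqP => f x /=; rewrite addNr. Qed.
HB.instance Definition _ := GRing.isZmodule.Build opr opDA opDC op0D opND.

Lemma opMA : associative opM. Proof. by move=> *; apply: opr_eqP. Qed.
Lemma op1M : left_id op1 opM. Proof. by move=> *; apply: opr_eqP. Qed.
Lemma opM1 : right_id op1 opM. Proof. by move=> *; apply: opr_eqP. Qed.
Lemma opMDl : left_distributive opM opD.
Proof. by move=> *; apply: opr_eqP. Qed.
Lemma opMDr : right_distributive opM opD.
Proof.
move=> S T U; apply: opr_eqP => f x /=; rewrite -[S (T f) x]mul1r.
have -> : (fun y => T f y + U f y) = (fun y => 1 * T f y + U f y).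
  by apply/funext => y; rewrite mul1r.
by rewrite oprP.
Qed.
Lemma op1_neq0 : op1 != 0.
Proof.
apply/eqP => /(congr1 (fun T : opr => T (fun=> 1) 0)) /= /eqP.
by rewrite oner_eq0.
Qed.
HB.instance Definition _ := GRing.Zmodule_isNzRing.Build opr
  opMA op1M opM1 opMDl opMDr op1_neq0.

Lemma opZA a b (T : opr) : opZ a (opZ b T) = opZ (a * b) T.
Proof. by apply: opr_eqP => f x /=; rewrite mulrA. Qed.
Lemma op1Z : left_id 1 opZ.
Proof. by move=> T; apply: opr_eqP => f x /=; rewrite mul1r. Qed.
Lemma opZDr : right_distributive opZ +%R.
Proof. by move=> a S T; apply: opr_eqP => f x /=; rewrite mulrDr. Qed.
Lemma opZDl (T : opr) : {morph opZ^~ T : a b / a + b}.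
Proof. by move=> a b; apply: opr_eqP => f x /=; rewrite mulrDl. Qed.
HB.instance Definition _ := GRing.Zmodule_isLmodule.Build F opr opZA op1Z opZDr opZDl.

Lemma opZAl a (S T : opr) : a *: (S * T) = (a *: S) * T.
Proof. exact: opr_eqP. Qed.
HB.instance Definition _ := GRing.Lmodule_isLalgebra.Build F opr opZAl.
Lemma opZAr a (S T : opr) : a *: (S * T) = S * (a *: T).
Proof.
apply: opr_eqP => f x /=.
have -> : (fun y => a * T f y) = (fun y => a * T f y + 0).
  by apply/funext => y; rewrite addr0.
rewrite oprP; suff -> : S (fun=> 0) x = 0 by rewrite addr0.
have -> : (fun=> 0) = (fun y => -1 * (fun=> 0) y + (fun=> 0) y) :> W.
  by apply/funext => y; rewrite mulr0 addr0.
by rewrite oprP mulN1r addNr.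
Qed.
HB.instance Definition _ := GRing.Lalgebra_isAlgebra.Build F opr opZAr.

Lemma opDE (S T : opr) f x : (S + T) f x = S f x + T f x. Proof. by []. Qed.
Lemma op0E f x : (0 : opr) f x = 0. Proof. by []. Qed.
Lemma opZE a (T : opr) f x : (a *: T) f x = a * T f x. Proof. by []. Qed.
Lemma opME (S T : opr) f : (S * T) f = S (T f). Proof. by []. Qed.
Lemma op_sumE (I : Type) (r : seq I) (P : pred I) (S : I -> opr) f x :
  (\sum_(i <- r | P i) S i) f x = \sum_(i <- r | P i) S i f x.
Proof. by elim/big_rec2: _ => // i y T _ <-. Qed.
Lemma opZfun (T : opr) a f : T (fun x => a * f x) = fun x => a * T f x.
Proof. by have := congr1 (fun S : opr => S f) (opZAr a T 1). Qed.

(** The weighted shift moves the value at a - d to a. With [wshM] the relations between oscillators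
    become identities between weights at one exponent. *)
Program Definition wsh (w : X -> F) (d : X) : opr := @Opr (fun f a => w a * f (a - d)) _.
Next Obligation.
by move=> a f g; apply/funext => x; rewrite mulrDr mulrCA.
Qed.

Lemma wshE w d f a : wsh w d f a = w a * f (a - d). Proof. by []. Qed.

Lemma wshM w d w' d' : wsh w d * wsh w' d' = wsh (fun a => w a * w' (a - d)) (d + d').
Proof. by apply: opr_eqP => f a; rewrite opME !wshE mulrA opprD addrA. Qed.

Lemma wshZ c w d : c *: wsh w d = wsh (fun a => c * w a) d.
Proof. by apply: opr_eqP => f a; rewrite opZE !wshE mulrA. Qed.

Lemma wshX w d k :
  wsh w d ^+ k = wsh (fun a => \prod_(i < k) w (a - d *+ i)) (d *+ k).
Proof.
elim: k => [|k IHk].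
  by apply: opr_eqP => f a; rewrite wshE big_ord0 mul1r subr0.
rewrite exprSr IHk wshM mulrSr; congr wsh.
by apply/funext => a; rewrite big_ord_recr.
Qed.

End OperatorAlgebra.

Definition oddz (k : int) := odd `|k|%N.

Lemma oddzD1 k : oddz (k + 1) = ~~ oddz k.
Proof.
case: k => n; first by rewrite /oddz -PoszD addn1.
by rewrite NegzE /oddz abszN -[in LHS]addn1 PoszD opprD addrNK abszN /= negbK.
Qed.

Lemma oddzB1 k : oddz (k - 1) = ~~ oddz k.
Proof. by have := oddzD1 (k - 1); rewrite subrK => ->; rewrite negbK. Qed.

(** * Color oscillators and their vacuum *)

Section Oscillators.
Variables (F : fieldType) (n : nat) (G : zmodType).
Variables (bc : G -> G -> F) (dg : 'I_n.+1 -> G) (sv : 'I_n.+1 -> F).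
Hypothesis bcP : bicharacter bc.
Notation slot := ('I_n.+1 * 'I_n.+1)%type.
Notation X := {ffun slot -> int}.
Implicit Types (s t : slot) (a : X) (k : int) (i j r : 'I_n.+1).

Definition par r := bc (dg r) (dg r).

Lemma bc_sign (g : G) : bc g g = 1 \/ bc g g = -1.
Proof.
have := bichar_skew bcP g g; rewrite -expr2 => /eqP.
by rewrite sqrf_eq1 => /orP[]/eqP; [left|right].
Qed.

(* The degrees of the oscillators of level [r] are shifted by a formal odd element
   when v_r is odd, so that the oscillator in the slot (r, r) is bosonic. *)
Definition th r r' : F := if (par r == 1) || (par r' == 1) then 1 else -1.

Lemma thK r r' : th r r' * th r' r = 1.
Proof. by rewrite /th orbC; case: ifP; rewrite ?mulr1 // mulrNN mulr1. Qed.

Lemma th_diag r : th r r = par r.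
Proof.
rewrite /th orbb; case: eqP => [->//|/eqP ne].
by have [e|//] := bc_sign (dg r); rewrite /par e eqxx in ne.
Qed.

Notation q := (slotq bc dg th).

(** The twist [th] gives the slot (i, r) the parity of the root eps_i - eps_r, so that its capacity
    is the pbar of that root. *)
Lemma q_diagE s : q s s = bc (dg s.1 - dg s.2) (dg s.1 - dg s.2).
Proof.
rewrite /slotq th_diag (bcB bcP) -mulrA -[RHS]mulrA; congr (_ * _).
rewrite mulrA -invfM (bichar_skew bcP) invr1 mul1r //.
Qed.

Lemma q_diag_rr s : s.1 = s.2 -> q s s = 1.
Proof. by move=> e; rewrite q_diagE e subrr (bc0l bcP). Qed.

(* Matrix coefficients, between consecutive occupation numbers of the slot [s], of
   the creation and annihilation operators. They satisfy
   [beta (k + 1) * alpha k - q s s * alpha (k - 1) * beta k = 1], vanish where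
   needed for the operators of [e_ij], i <> j, to be nilpotent, and are shifted by
   [sv r] at (r, r), which gives the vacuum an arbitrary weight. *)
Definition alpha s k : F :=
  if s.1 == s.2 then sv s.1 + (k + 1)%:~R
  else if (s.2 < s.1)%N then
    if q s s == 1 then ((k + 1)%:~R != 0 :> F)%:R else (~~ oddz k)%:R
  else if q s s == 1 then k%:~R else (oddz k)%:R.

Definition beta s k : F :=
  if s.1 == s.2 then 1
  else if (s.2 < s.1)%N then if q s s == 1 then k%:~R else (oddz k)%:R
  else if q s s == 1 then ((k - 1)%:~R != 0 :> F)%:R else (~~ oddz k)%:R.

Lemma beta_alpha s k :
  beta s (k + 1) * alpha s k = (q s s)^-1 * (alpha s (k - 1) * beta s k) + 1.
Proof.
have indic (x : F) : x * (x != 0)%:R = x.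
  by have [->|] := eqVneq x 0; rewrite ?mul0r ?mulr1.
rewrite /alpha /beta; case: eqP => [e|_].
  by rewrite (q_diag_rr e) invr1 !mul1r mulr1 subrK -addrA rmorphD.
have qs : q s s = 1 \/ q s s = -1 by rewrite q_diagE; exact: bc_sign.
case: ifP => _; case: eqP => [->|].
- by rewrite invr1 mul1r subrK indic mulrC indic rmorphD.
- case: qs => -> // _; rewrite invrN1 oddzD1 oddzB1.
  by case: oddz; rewrite /= ?mulr0 ?mulr1 ?addr0 ?mulN1r ?addNr ?oppr0 ?add0r.
- rewrite invr1 mul1r addrK mulrC indic indic.
  by rewrite rmorphB /= subrK.
- case: qs => -> // _; rewrite invrN1 oddzD1 oddzB1.
  by case: oddz; rewrite /= ?mulr0 ?mulr1 ?addr0 ?mulN1r ?addNr ?oppr0 ?add0r.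
Qed.

Lemma alpha_sqr s k : q s s != 1 -> alpha s k * alpha s (k - 1) = 0.
Proof.
move=> qs; rewrite /alpha (negPf qs); case: eqP => [e|_].
  by rewrite (q_diag_rr e) eqxx in qs.
by case: ifP => _; rewrite oddzB1; case: oddz; rewrite ?mulr0 ?mul0r.
Qed.

Lemma beta_sqr s k : q s s != 1 -> beta s k * beta s (k + 1) = 0.
Proof.
move=> qs; rewrite /beta (negPf qs); case: eqP => [e|_].
  by rewrite (q_diag_rr e) eqxx in qs.
by case: ifP => _; rewrite oddzD1; case: oddz; rewrite ?mulr0 ?mul0r.
Qed.

(** A Jordan-Wigner factor: half of [q], with respect to an enumeration of the slots. For distinct
    slots sigma s t / sigma t s = q s t, so multiplying by [sgn] makes shifts in distinct slots
    commute up to [q]; within one slot the relations rest on [alpha] and [beta]. *)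
Definition sigma s t : F := if (enum_rank t < enum_rank s)%N then q s t else 1.

Lemma q_neq0' s t : q s t != 0.
Proof. exact: q_neq0 (slotqK dg bcP thK) s t. Qed.

Lemma sigma_neq0 s t : sigma s t != 0.
Proof. by rewrite /sigma; case: ifP; rewrite ?oner_neq0 ?q_neq0'. Qed.

Lemma sigma_diag s : sigma s s = 1.
Proof. by rewrite /sigma ltnn. Qed.

Lemma sigma_q s t : s != t -> sigma s t = q s t * sigma t s.
Proof.
rewrite /sigma => /eqP ne; case: ltngtP => // [_|_|/ord_inj/enum_rank_inj/esym//].
  by rewrite mulr1.
by rewrite (slotqK dg bcP thK).
Qed.

Definition sgn s a : F := \prod_t sigma s t ^ a t.

Lemma sgn_neq0 s a : sgn s a != 0.
Proof. by apply/prodf_neq0 => t _; rewrite expfz_neq0 ?sigma_neq0. Qed.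

Lemma sgnD s a b : sgn s (a + b) = sgn s a * sgn s b.
Proof.
rewrite /sgn -big_split; apply: eq_bigr => t _ /=.
by rewrite ffunE expfzDr ?sigma_neq0.
Qed.

(** Exponents are integers of either sign. The leading term of e_ij trades one unit of the slot (j,
    j) for one of (i, j), and annihilation in (j, j) never vanishes, so that exponent becomes
    negative. *)
Definition unit_exp s : X := [ffun t => (t == s)%:Z].
Notation u := unit_exp.

Lemma sgn_u s t : sgn s (u t) = sigma s t.
Proof.
rewrite /sgn (bigD1 t) //= ffunE eqxx expr1z big1 ?mulr1 // => w /negPf wt.
by rewrite ffunE wt expr0z.
Qed.

Lemma sgnBu s t a : sgn s (a - u t) = sgn s a / sigma s t.
Proof.
by apply: (canRL (mulfK (sigma_neq0 s t))); rewrite -sgn_u -sgnD subrK.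
Qed.

Lemma sgnDu s t a : sgn s (a + u t) = sgn s a * sigma s t.
Proof. by rewrite sgnD sgn_u. Qed.

Definition Aosc s : opr F X := wsh (fun a => sgn s a * alpha s (a s - 1)) (u s).
Definition Bosc s : opr F X := wsh (fun a => (sgn s a)^-1 * beta s (a s + 1)) (- u s).

Lemma AoscM s t : Aosc s * Aosc t = q s t *: (Aosc t * Aosc s).
Proof.
rewrite /Aosc !wshM wshZ (addrC (u t)); congr wsh; apply/funext => a /=.
have [->|ne] := eqVneq s t.
  have [->|/alpha_sqr H] := eqVneq (q t t) 1; first by rewrite mul1r.
  rewrite !ffunE eqxx mulrACA H mulr0 mulr0 //.
rewrite !sgnBu !ffunE eq_sym (negPf ne) subr0 (sigma_q ne).
have nq := q_neq0' s t; have ns := sigma_neq0 t s.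
by rewrite subr0; field; rewrite nq ns.
Qed.

Lemma BoscM s t : Bosc s * Bosc t = q s t *: (Bosc t * Bosc s).
Proof.
rewrite /Bosc !wshM wshZ (addrC (- u t)); congr wsh; apply/funext => a /=.
rewrite !opprK; have [->|ne] := eqVneq s t.
  have [->|/beta_sqr H] := eqVneq (q t t) 1; first by rewrite mul1r.
  rewrite !ffunE eqxx mulrACA H mulr0 mulr0 //.
rewrite !sgnDu !ffunE eq_sym (negPf ne) addr0 (sigma_q ne).
have nq := q_neq0' s t; have ns := sigma_neq0 t s.
have [n1 n2] := (sgn_neq0 s a, sgn_neq0 t a).
by rewrite addr0; field; rewrite nq ns n1 n2.
Qed.

Lemma BoscA s t :
  Bosc s * Aosc t = (q s t)^-1 *: (Aosc t * Bosc s) + (s == t)%:R *: 1.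
Proof.
have one : 1 = wsh (fun=> 1) 0 :> opr F X.
  by apply: opr_eqP => f a; rewrite wshE mul1r subr0.
rewrite /Aosc /Bosc !wshM wshZ one; have [<-|ne] := eqVneq s t.
  rewrite scale1r addNr subrr; apply: opr_eqP => f a; rewrite opDE !wshE -mulrDl.
  congr (_ * _); rewrite opprK sgnDu sgnBu sigma_diag !ffunE eqxx /= addrK subrK.
  rewrite invr1 !mulr1 mulrACA mulVf ?sgn_neq0 // mul1r beta_alpha; congr (_ + _).
  by rewrite mulrACA mulfV ?sgn_neq0 // mul1r.
rewrite scale0r addr0 addrC; congr wsh; apply/funext => a.
rewrite opprK sgnDu sgnBu (sigma_q ne) !ffunE (negPf ne) eq_sym (negPf ne) addr0 subr0.
have [n1 n2] := (sgn_neq0 s a, sgn_neq0 t a).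
by field; rewrite ?q_neq0' ?sigma_neq0 ?n1 ?n2.
Qed.

Definition coef i j r a : F :=
  sgn (i, r) a * alpha (i, r) (a (i, r) - 1)
    * ((sgn (j, r) (a - u (i, r)))^-1 * beta (j, r) ((a - u (i, r)) (j, r) + 1)).

Lemma quadE i j r : quad Aosc Bosc (i, r) (j, r) = wsh (coef i j r) (u (i, r) - u (j, r)).
Proof. by rewrite /quad /Aosc /Bosc wshM. Qed.

Notation glosc := (glop Aosc Bosc).

Lemma gloscE i j f a :
  glosc i j f a = \sum_r coef i j r a * f (a - u (i, r) + u (j, r)).
Proof.
rewrite /glop op_sumE; apply: eq_bigr => r _.
by rewrite quadE wshE opprB addrA addrAC.
Qed.

Definition occ i r a := alpha (i, r) (a (i, r) - 1) * beta (i, r) (a (i, r)).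

Lemma coef_diag i r a : coef i i r a = occ i r a.
Proof.
rewrite /coef sgnBu sigma_diag invr1 mulr1 !ffunE eqxx subrK.
by rewrite mulrACA mulfV ?sgn_neq0 // mul1r.
Qed.

Lemma glosc_diag i f a : glosc i i f a = (\sum_r occ i r a) * f a.
Proof.
rewrite gloscE mulr_suml; apply: eq_bigr => r _.
by rewrite coef_diag subrK.
Qed.

Section Vacuum.

Definition vac a : F := (a == 0)%:R.

Lemma oscB_eq0 a i j r : a - u (i, r) + u (j, r) = 0 -> a = u (i, r) - u (j, r).
Proof. by move=> e; apply/eqP; rewrite -subr_eq0 opprB addrA addrAC e. Qed.

(** Levels r < j die by annihilation in the slot (j, r) below the diagonal. Levels r >= j > i die by
    creation in (i, r): above the diagonal it is creation that vanishes at the vacuum. *)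
Lemma glosc_vac i j : (i < j)%N -> glosc i j vac = (fun=> 0).
Proof.
move=> ij; apply/funext => a; rewrite gloscE big1 // => r _; rewrite /vac.
case: eqP => [/oscB_eq0 ->|]; last by rewrite mulr0.
have ne : ((i, r) == (j, r)) = false.
  by rewrite xpair_eqE eqxx andbT -val_eqE /= ltn_eqF.
have ne' : ((j, r) == (i, r)) = false by rewrite eq_sym.
rewrite /coef !ffunE !eqxx ne ne' subr0 subrr.
rewrite mulr1 sub0r subr0 addNr /= /alpha /beta /=.
have [rj|jr] := ltnP r j.
  have -> : (j == r) = false by rewrite -val_eqE /= gtn_eqF.
  by rewrite [X in _ * (_ * X)](_ : _ = 0) ?mulr0 //; case: ifP.
have ir := leq_trans ij jr.
have -> : (i == r) = false by rewrite -val_eqE /= ltn_eqF.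
rewrite ltnNge (ltnW ir) /=.
by rewrite [X in _ * X * _](_ : _ = 0) ?mulr0 ?mul0r //; case: ifP.
Qed.

(** The zero-point value of e_ii on the vacuum, contributed by the slots above the diagonal. *)
Definition sub_vac i : F := \sum_(r < n.+1 | (i < r)%N) (if q (i, r) (i, r) == 1 then -1 else 1).

Lemma glosc_vac_diag i : glosc i i vac = (fun a => (sv i + sub_vac i) * vac a).
Proof.
apply/funext => a; rewrite glosc_diag /vac.
case: eqP => [->|]; last by rewrite !mulr0.
congr (_ * _); rewrite (bigD1 i) //= [X in X + _](_ : _ = sv i); last first.
  by rewrite /occ /alpha /beta /= eqxx ffunE mulr1 sub0r addNr addr0.
congr (_ + _); rewrite /sub_vac big_mkcond [RHS]big_mkcond /=; apply: eq_bigr => r _.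
rewrite /occ /alpha /beta /= ffunE sub0r (eq_sym i).
case: eqVneq => [->|ri] /=; first by rewrite ltnn.
case: ltngtP => [ri'|ir|/ord_inj e]; last by rewrite e eqxx in ri.
  by case: ifP; rewrite ?mulr0 // addNr eqxx mul0r.
by case: ifP; rewrite ?mulr1 // mulrN1z oppr_eq0 oner_eq0 mulr1.
Qed.

End Vacuum.

Definition owords (w : seq ('I_n.+1 * 'I_n.+1)) : X -> F :=
  foldr (fun d f => glosc d.1 d.2 f) vac w.

(** The matrix unit e_ij raises this number by i - j at every level. Hence it grades the model by
    height, with the sign opposite to [ht]. *)
Definition hgtX a : int := \sum_(s : slot) (s.1 : nat)%:Z * a s.

Lemma hgtXD a b : hgtX (a + b) = hgtX a + hgtX b.
Proof. by rewrite /hgtX -big_split; apply: eq_bigr => s _; rewrite ffunE mulrDr. Qed.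

Lemma hgtX_u s : hgtX (u s) = s.1.
Proof.
rewrite /hgtX (bigD1 s) //= ffunE eqxx mulr1 big1 ?addr0 // => t /negPf ts.
by rewrite ffunE ts mulr0.
Qed.

Lemma hgtXB a b : hgtX (a - b) = hgtX a - hgtX b.
Proof. by apply/eqP; rewrite eq_sym subr_eq -hgtXD subrK. Qed.

Lemma owords_hgt w a : owords w a != 0 ->
  hgtX a = \sum_(d <- w) ((d.1 : nat)%:Z - (d.2 : nat)%:Z).
Proof.
elim: w a => [|d w IHw] a /=.
  rewrite /vac; have [->|] := eqVneq a 0; rewrite ?eqxx // => _.
  by rewrite big_nil -(subrr (0 : X)) hgtXB subrr.
rewrite gloscE big_cons => nz.
have [r nzr] : exists r, owords w (a - u (d.1, r) + u (d.2, r)) != 0.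
  apply: contrapT => no; case/eqP: nz; apply: big1 => r _.
  by rewrite [owords _ _](_ : _ = 0) ?mulr0 //; apply/eqP/negPn/negP => H; apply: no; exists r.
by rewrite -(IHw _ nzr) hgtXD hgtXB !hgtX_u /=; ring.
Qed.

Lemma owords_hgt0 w : owords w 0 != 0 -> \sum_(d <- w) ((d.1 : nat)%:Z - (d.2 : nat)%:Z) = 0.
Proof. by move/owords_hgt <-; rewrite -(subrr (0 : X)) hgtXB subrr. Qed.

(** A factor e_ij with i > j raises this by at most one, and exactly when it draws on the slot (j,
    j). This bounds it by the length of the word. *)
Definition diagX a : int := - \sum_r a (r, r).

Lemma diagXD a b : diagX (a + b) = diagX a + diagX b.
Proof. by rewrite /diagX -opprD -big_split; congr (- _); apply: eq_bigr => r _; rewrite ffunE. Qed.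

Lemma diagX_u s : diagX (u s) = - (s.1 == s.2)%:Z.
Proof.
case: s => i r; rewrite /diagX (bigD1 r) //= ffunE xpair_eqE eqxx andbT big1 ?addr0.
  by rewrite eq_sym.
by move=> t /negPf tr; rewrite ffunE xpair_eqE tr andbF.
Qed.

Lemma diagXB a b : diagX (a - b) = diagX a - diagX b.
Proof. by apply/eqP; rewrite eq_sym subr_eq -diagXD subrK. Qed.

Definition lead (w : seq ('I_n.+1 * 'I_n.+1)) : X := \sum_(d <- w) (u d - u (d.2, d.2)).

Lemma lead_count w i j : i != j -> (forall d, d \in w -> d.1 != d.2) ->
  lead w (i, j) = (count_mem (i, j) w)%:Z.
Proof.
move=> ij; elim: w => [|d w IHw] ww; first by rewrite /lead big_nil ffunE.
rewrite /lead big_cons !ffunE -/(lead w) IHw; last first.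
  by move=> e ew; rewrite ww // inE ew orbT.
have -> : ((i, j) == (d.2, d.2)) = false.
  by rewrite xpair_eqE; apply/negP => /andP[/eqP e1 /eqP e2]; rewrite e1 e2 eqxx in ij.
by rewrite subr0 /= PoszD eq_sym.
Qed.

Variable p : nat.
Hypothesis pchF : p \in [pchar F].

(* Only the summand r = j of e_ij, i > j, lowers the total exponent of the slots
   (r, r); it multiplies by the oscillator (i, j), so that the coefficient at the
   extreme exponent is the one of a monomial. *)
Lemma owords_lead (w : seq slot) : (forall d, d \in w -> (d.2 < d.1)%N) ->
  (forall d, (count_mem d w < if q d d == 1%R then p else 2)%N) ->
  [/\ forall a, (size w)%:Z < diagX a -> owords w a = 0,
      forall a, diagX a = size w -> a <> lead w -> owords w a = 0
    & owords w (lead w) != 0].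
Proof.
have subBD (V : zmodType) (x y z : V) : x - y + z = x - (y - z).
  by rewrite opprB addrA addrAC.
have diag0 : diagX 0 = 0 by rewrite -(subrr (0 : X)) diagXB subrr.
elim: w => [|[i j] w IHw] ww wc.
  rewrite /lead big_nil /= /vac eqxx oner_neq0; split=> // a; last by move=> _ /eqP/negPf ->.
  by case: eqP => [->|//]; rewrite diag0 ltxx.
have /= ij := ww _ (mem_head _ _).
have ne : i != j by rewrite -val_eqE /= gtn_eqF.
have ne' := negPf ne.
have ww' d : d \in w -> (d.2 < d.1)%N by move=> dw; rewrite ww // inE dw orbT.
have [|H1 H2 H3] := IHw ww'.
  by move=> d; apply: leq_ltn_trans (wc d); rewrite /= leq_addl.
have wt a r : diagX (a - u (i, r) + u (j, r)) =
    diagX a + (i == r)%:Z - (j == r)%:Z.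
  by rewrite diagXD diagXB !diagX_u opprK.
(* At a level r other than j, this letter does not raise [diagX], so the rest of the word would have
   to exceed its own bound. *)
have low r a : (size w)%:Z < diagX a -> r != j -> owords w (a - u (i, r) + u (j, r)) = 0.
  move=> lt rj; apply: H1; rewrite wt (eq_sym j) (negPf rj) subr0.
  by apply: lt_le_trans lt _; rewrite lerDl.
have ltS : (size w)%:Z < (size w).+1%:Z by rewrite ltz_nat.
have red a : (size w)%:Z < diagX a ->
    glosc i j (owords w) a = coef i j j a * owords w (a - u (i, j) + u (j, j)).
  move=> lt; rewrite gloscE (bigD1 j) //= big1 ?addr0 // => r rj.
  by rewrite low ?mulr0.
split=> [a|a ea ne_a|].
- move=> lt; rewrite red ?(lt_trans ltS) // H1 ?mulr0 // wt ne' eqxx addr0.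
  by rewrite ltrBrDr -PoszD addn1.
- rewrite red ?ea // H2 ?mulr0 //; first by rewrite wt ne' eqxx addr0 ea -addn1 PoszD addrK.
  move=> e; apply: ne_a; rewrite /lead big_cons -/(lead w) -e /=.
  by rewrite [X in _ + X]subBD addrC subrK.
- have dl : diagX (lead ((i, j) :: w)) = size ((i, j) :: w).
    elim: ((i, j) :: w) ww => [|d l IHl] dl; first by rewrite /lead big_nil diag0.
    rewrite /lead big_cons diagXD -/(lead l) IHl; last first.
      by move=> e el; rewrite dl // inE el orbT.
    rewrite diagXB !diagX_u eqxx opprK.
    have -> : (d.1 == d.2) = false by rewrite -val_eqE /= gtn_eqF // dl ?mem_head.
    by rewrite oppr0 add0r -PoszD.
  have ll : lead ((i, j) :: w) - u (i, j) + u (j, j) = lead w.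
    by rewrite subBD /lead big_cons /= addrC addKr.
  rewrite red ?dl // ll mulf_neq0 // /coef.
  rewrite !mulf_neq0 ?invr_eq0 ?sgn_neq0 //; last by rewrite /beta eqxx oner_neq0.
  rewrite lead_count //; last by move=> d dw; rewrite -val_eqE /= gtn_eqF // ww.
  rewrite /= eqxx PoszD addrC addKr /alpha /= ne' ij.
  (* Here the restriction on exponents is used: the creation coefficient at the present occupation
     number c is nonzero since c + 1 < p for an even root and c = 0 for an odd one. *)
  have := wc (i, j); rewrite /= eqxx add1n.
  case: ifP => _ lt.
    suff -> : ((count_mem (i, j) w)%:Z + 1)%:~R != 0 :> F by exact: oner_neq0.
    by rewrite -PoszD addn1 -pmulrn -(dvdn_pcharf pchF) gtnNdvd.
  by move: lt; rewrite ltnS ltnS leqn0 => /eqP->; rewrite oner_neq0.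
Qed.

Lemma quad_comm i j r r' : bc (dg i - dg j) (dg i - dg j) = 1 -> r != r' ->
  quad Aosc Bosc (i, r) (j, r) * quad Aosc Bosc (i, r') (j, r') =
  quad Aosc Bosc (i, r') (j, r') * quad Aosc Bosc (i, r) (j, r).
Proof.
move=> ev rr'; rewrite (quadM (slotqK dg bcP thK) AoscM BoscM BoscA).
rewrite (slotq_edge dg bcP thK) ev !xpair_eqE (negPf rr') (eq_sym r') (negPf rr').
by rewrite !andbF mulr0 !scale0r addr0 subr0 scale1r.
Qed.

Lemma intr_zero (x : int) : exists2 k : nat, (k < p)%N & (x - k%:Z)%:~R = 0 :> F.
Proof.
have p_gt0 := prime_gt0 (pcharf_prime pchF).
have p0 : p%:Z != 0 by case: (p) p_gt0.
have := modz_ge0 x p0; case e: (x %% p)%Z => [k|//] _.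
exists k; first by have := ltz_pmod x (d := p) p_gt0; rewrite e ltz_nat.
rewrite -e {1}(divz_eq x p) addrK rmorphM /=.
by rewrite -[p%:~R]/(p%:R) (pcharf0 pchF) mulr0.
Qed.

(** Among p consecutive integers one is divisible by p, and both parities occur. *)
Lemma alpha_zero s (x : int) : s.1 != s.2 -> exists2 k : nat, (k < p)%N & alpha s (x - k%:Z) = 0.
Proof.
have p_gt1 := prime_gt1 (pcharf_prime pchF).
move=> /negPf ss; rewrite /alpha ss.
have par2 (b : bool) : exists2 k : nat, (k < p)%N & oddz (x - k%:Z) = b.
  have [<-|ne] := eqVneq (oddz x) b; first by exists 0%N; rewrite ?subr0 // ltnW.
  by exists 1%N => //; rewrite oddzB1; case: b ne; case: oddz.
case: (s.2 < s.1)%N; case: (q s s == 1).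
- have [k kp e] := intr_zero (x + 1); exists k => //.
  by rewrite addrAC e eqxx.
- by have [k kp e] := par2 true; exists k; rewrite ?e.
- by have [k kp e] := intr_zero x; exists k.
- by have [k kp e] := par2 false; exists k; rewrite ?e.
Qed.

Lemma beta_zero s (x : int) : s.1 != s.2 -> exists2 k : nat, (k < p)%N & beta s (x + k%:Z) = 0.
Proof.
have p_gt1 := prime_gt1 (pcharf_prime pchF).
move=> /negPf ss; rewrite /beta ss.
have par2 (b : bool) : exists2 k : nat, (k < p)%N & oddz (x + k%:Z) = b.
  have [<-|ne] := eqVneq (oddz x) b; first by exists 0%N; rewrite ?addr0 // ltnW.
  by exists 1%N => //; rewrite oddzD1; case: b ne; case: oddz.
have opp (y : int) : exists2 k : nat, (k < p)%N & (y + k%:Z)%:~R = 0 :> F.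
  have [k kp e] := intr_zero (- y); exists k => //.
  by apply/eqP; rewrite -oppr_eq0 -mulrNz opprD e.
case: (s.2 < s.1)%N; case: (q s s == 1).
- by have [k kp e] := opp x; exists k.
- by have [k kp e] := par2 false; exists k; rewrite ?e.
- by have [k kp e] := opp (x - 1); exists k; rewrite // addrAC e eqxx.
- by have [k kp e] := par2 true; exists k; rewrite ?e.
Qed.

Lemma unit_expMn s t (k : nat) : (u s *+ k) t = (k * (t == s))%:Z.
Proof. by rewrite ffunMnE ffunE -mulr_natl natz PoszM. Qed.

(** At most one of the slots (i, r), (j, r) is diagonal. The other one meets a zero of its
    coefficient during p consecutive shifts. *)
Lemma quad_pth i j r : i != j -> quad Aosc Bosc (i, r) (j, r) ^+ p = 0.
Proof.
move=> ij; rewrite quadE wshX; apply: opr_eqP => f a; rewrite wshE op0E.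
have ne : ((i, r) == (j, r)) = false by rewrite xpair_eqE eqxx andbT (negPf ij).
have ne' : ((j, r) == (i, r)) = false by rewrite eq_sym.
suff [k kp e] : exists2 k : nat, (k < p)%N & coef i j r (a - (u (i, r) - u (j, r)) *+ k) = 0.
  by rewrite (bigD1 (Ordinal kp)) //= e !mul0r.
have [er|nr] := eqVneq i r.
  have jr : (j, r).1 != (j, r).2 by rewrite /= -er eq_sym.
  have [k kp e] := beta_zero (a (j, r) + 1) jr; exists k => //.
  rewrite /coef [X in _ * (_ * X)](_ : _ = 0) ?mulr0 // -[RHS]e; congr (beta _ _).
  rewrite !ffunE mulrnBl !ffunE !unit_expMn ne' eqxx muln0 muln1 /= !subr0.
  by rewrite sub0r opprK addrAC.
have [k kp e] := alpha_zero (a (i, r) - 1) (s := (i, r)) nr; exists k => //.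
rewrite /coef [X in _ * X * _](_ : _ = 0) ?mulr0 ?mul0r // -[RHS]e; congr (alpha _ _).
by rewrite !ffunE mulrnBl !ffunE !unit_expMn ne eqxx muln0 muln1 /= subr0 addrAC.
Qed.

Lemma intr_fermat (x : int) : x%:~R ^+ p = x%:~R :> F.
Proof.
case: x => k; first exact: natr_fermat.
by rewrite NegzE rmorphN /= -(pFrobenius_autE pchF) rmorphN /= pFrobenius_autE natr_fermat.
Qed.

Lemma bool_pth (b : bool) : b%:R ^+ p = b%:R :> F.
Proof. exact: natr_fermat. Qed.

(** Off the diagonal the eigenvalues lie in the prime field and are fixed by Frobenius; only the
    shift [sv i] at (i, i) contributes. *)
Lemma occ_pth i r a :
  occ i r a ^+ p = occ i r a + (if i == r then sv i ^+ p - sv i else 0).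
Proof.
rewrite /occ /alpha /beta /=; case: eqP => [->|_].
  rewrite !mulr1 subrK -(pFrobenius_autE pchF) rmorphD /= !pFrobenius_autE intr_fermat.
  by move: (sv i ^+ p) => z; ring.
rewrite addr0 exprMn; congr (_ * _); do 2!case: ifP => _; exact: intr_fermat || exact: bool_pth.
Qed.

(** For i <> j the levels commute, since e_ij is even, so the p-th power of their sum is the sum of
    p-th powers, all zero. For i = j the operator is diagonal, and its eigenvalues are fixed by
    Frobenius up to sv^p - sv. *)
Lemma glosc_pth (chi : 'I_n.+1 -> F) i j :
  (forall i, sv i ^+ p - sv i = chi i ^+ p) ->
  bc (dg i - dg j) (dg i - dg j) = 1 ->
  glosc i j ^+ p = if i == j then glosc i i + (chi i ^+ p) *: 1 else 0.
Proof.
move=> chiE ev; case: eqP => [e|/eqP ne]; last first.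
  rewrite /glop (@exprD_comm_pchar p) ?index_enum_uniq //.
  - by apply: big1 => r _; exact: quad_pth.
  - exact: pchar_alg.
  - by move=> r r'; exact: quad_comm.
rewrite -{j ev}e; have Ek (k : nat) f a : (glosc i i ^+ k) f a = (\sum_r occ i r a) ^+ k * f a.
  elim: k => [|k IHk]; first by rewrite expr0 mul1r.
  by rewrite exprS opME glosc_diag IHk exprS mulrA.
apply: opr_eqP => f a; rewrite Ek opDE opZE glosc_diag -mulrDl; congr (_ * _).
rewrite -(pFrobenius_autE pchF) rmorph_sum /=.
under eq_bigr => r _ do rewrite pFrobenius_autE occ_pth.
rewrite big_split /=; congr (_ + _).
by rewrite -big_mkcond (big_pred1 i) ?chiE // => r; rewrite /= eq_sym.
Qed.

End Oscillators.

(** * Finite matrices and reduced enveloping algebras *)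

Section FreeEval.
Variables (F : fieldType) (I : choiceType) (A : algType F) (f : I -> A).
Local Notation fa := {malg F[{fmonom I}]}.
Implicit Types t : fa.

Definition fev t : A := \sum_(k <- msupp t) t@_k *: \prod_(x <- (k : seq I)) f x.

Lemma fevEw (d : {fset {fmonom I}}) t : fsubset (msupp t) d ->
  fev t = \sum_(k <- d) t@_k *: \prod_(x <- (k : seq I)) f x.
Proof.
move=> le; rewrite [LHS](big_fset_incl _ le) => //= x xd /mcoeff_outdom ->.
by rewrite scale0r.
Qed.

Lemma fevU c (k : {fmonom I}) : fev << c *g k >> = c *: \prod_(x <- (k : seq I)) f x.
Proof. by rewrite (fevEw msuppU_le) big_seq_fset1 mcoeffUU. Qed.

Lemma fev_linear : linear fev.
Proof.
move=> a x y; pose d := (msupp x `|` msupp y `|` msupp (a *: x + y))%fset.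
have [dx dy dxy] : [/\ fsubset (msupp x) d, fsubset (msupp y) d
  & fsubset (msupp (a *: x + y)) d].
  by split; apply/fsubsetP => k; rewrite !inE => ->; rewrite ?orbT.
rewrite (fevEw dx) (fevEw dy) (fevEw dxy) scaler_sumr -big_split.
by apply: eq_bigr => k _; rewrite mcoeffD mcoeffZ scalerDl scalerA.
Qed.
HB.instance Definition _ := GRing.isLinear.Build F fa A *:%R fev fev_linear.

Lemma fev1 : fev 1 = 1.
Proof.
have -> : (1 : fa) = << (mone : {fmonom I}) >> by [].
by rewrite fevU scale1r fm1 big_nil.
Qed.

Lemma fevM x y : fev (x * y) = fev x * fev y.
Proof.
rewrite malgME [in RHS](monalgE x) [in RHS](monalgE y) !linear_sum mulr_suml.
apply: eq_bigr => k _; rewrite mulr_sumr linear_sum; apply: eq_bigr => l _ /=.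
rewrite !fevU -scalerAl -scalerAr scalerA; congr (_ *: _).
by rewrite fmM big_cat.
Qed.

Lemma fev_gen x : fev << fmu x >> = f x.
Proof. by rewrite fevU scale1r fmU big_seq1. Qed.

Lemma fevX t n : fev (t ^+ n) = fev t ^+ n.
Proof. by elim: n => [|n IHn]; rewrite ?fev1 // !exprS fevM IHn. Qed.

End FreeEval.

Section IntegerEval.
Variables (K : choiceType) (W : zmodType) (g : K -> W).
Local Notation free := {malg int[K]}.

Definition zev (t : free) : W := \sum_(k <- msupp t) g k *~ t@_k.

Lemma zevEw (d : {fset K}) t : fsubset (msupp t) d -> zev t = \sum_(k <- d) g k *~ t@_k.
Proof.
move=> le; rewrite [LHS](big_fset_incl _ le) => //= x xd /mcoeff_outdom ->.
by rewrite mulr0z.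
Qed.

Lemma zevB x y : zev (x - y) = zev x - zev y.
Proof.
pose d := (msupp x `|` msupp y `|` msupp (x - y))%fset.
have [dx dy dxy] : [/\ fsubset (msupp x) d, fsubset (msupp y) d
  & fsubset (msupp (x - y)) d].
  by split; apply/fsubsetP => k; rewrite !inE => ->; rewrite ?orbT.
rewrite (zevEw dx) (zevEw dy) (zevEw dxy) -sumrB.
by apply: eq_bigr => k _; rewrite mcoeffB mulrzBr.
Qed.

Lemma zev0 : zev 0 = 0.
Proof. by have := zevB 0 0; rewrite !subrr. Qed.

Lemma zevU k : zev << k >> = g k.
Proof. by rewrite (zevEw msuppU_le) big_seq_fset1 mcoeffUU. Qed.

Lemma zev2 k1 k2 : zev (<< k1 >> - << k2 >>) = g k1 - g k2.
Proof. by rewrite zevB !zevU. Qed.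

Lemma zev3 k1 k2 k3 : zev (<< k1 >> - << k2 >> - << k3 >>) = g k1 - g k2 - g k3.
Proof. by rewrite zevB zev2 zevU. Qed.

End IntegerEval.

Section GradedSum.
Variables (V : zmodType) (I : eqType) (P : I -> set V).
Hypothesis P0 : forall i, P i 0.
Hypothesis PD : forall i x y, P i x -> P i y -> P i (x + y).

Definition graded_sum : set V :=
  [set m | exists (s : seq I) (c : I -> V), (forall i, P i (c i)) /\ m = \sum_(i <- s) c i].

Lemma graded_sum_in i x : P i x -> graded_sum x.
Proof.
move=> Px; exists [:: i], (fun j => if j == i then x else 0); rewrite big_seq1 eqxx.
by split=> // j; case: eqP => [->|].
Qed.

(** The two index lists may differ and may have repetitions. Both sums are rewritten over a common
    duplicate-free list, with multiplicities absorbed into the components. *)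
Lemma graded_sumD x y : graded_sum x -> graded_sum y -> graded_sum (x + y).
Proof.
move=> [s [c [Pc ->]]] [s' [c' [Pc' ->]]].
pose t := undup (s ++ s').
have sumE (r : seq I) (e : I -> V) : {subset r <= t} ->
    \sum_(i <- r) e i = \sum_(i <- t) e i *+ count_mem i r.
  elim: r => [|i r IHr] rt; first by rewrite big_nil big1.
  rewrite big_cons IHr; last by move=> j jr; rewrite rt // inE jr orbT.
  have it : i \in t by rewrite rt ?mem_head.
  rewrite !(bigD1_seq i it (undup_uniq _)) /= eqxx add1n mulrS -addrA; congr (_ + (_ + _)).
  by apply: eq_bigr => j /negPf ji; rewrite eq_sym ji.
exists t, (fun i => c i *+ count_mem i s + c' i *+ count_mem i s'); split=> [i|].
  have PM n z : P i z -> P i (z *+ n).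
    by move=> Pz; elim: n => [|n IHn]; rewrite ?mulr0n // mulrS; exact: PD.
  by apply: PD; exact: PM.
rewrite big_split /= -!sumE // => i ir; rewrite mem_undup mem_cat ir ?orbT //.
Qed.

End GradedSum.

Section FiniteMatrices.
Variables (F : fieldType) (D : colorSpace F).
Local Notation V := (Vsp D).
Local Notation G := (Gamma D).
Local Notation E := (V -> V).
Local Notation vb := (@vb F D).
Local Notation eij := (@eij F D).
Implicit Types (x y z : V) (f g : E) (k l m : nat).

Lemma crd0 k : crd k (0 : V) = 0.
Proof.
have := crd_lin k 1 (0 : V) 0; rewrite scaler0 addr0 mul1r => /eqP.
by rewrite -subr_eq subrr eq_sym => /eqP.
Qed.

Lemma crdZ k a x : crd k (a *: x) = a * crd k x.
Proof. by have := crd_lin k a x 0; rewrite crd0 !addr0. Qed.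

Lemma crdD k x y : crd k (x + y) = crd k x + crd k y.
Proof. by have := crd_lin k 1 x y; rewrite scale1r mul1r. Qed.

Lemma crd_sum k (I : Type) (r : seq I) (P : pred I) (h : I -> V) :
  crd k (\sum_(i <- r | P i) h i) = \sum_(i <- r | P i) crd k (h i).
Proof. by elim/big_rec2: _ => [|i y x _ <-]; rewrite ?crd0 ?crdD. Qed.

(** [vb_span] gives each vector its own length, so both expansions are padded to a common one. *)
Lemma crd_ext x y : (forall k, crd k x = crd k y) -> x = y.
Proof.
move=> e; have [n ex] := vb_span x; have [m ey] := vb_span y.
have wide (z : V) (j : nat) : z = \sum_(k < j) crd k z *: vb k ->
    forall k, (j <= k)%N -> crd k z = 0.
  move=> ez k jk; rewrite ez crd_sum big1 // => i _.
  by rewrite crdZ crd_vb gtn_eqF ?mulr0 // (leq_trans (ltn_ord i)).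
have pad (z : V) (j i : nat) : (j <= i)%N -> z = \sum_(k < j) crd k z *: vb k ->
    z = \sum_(k < i) crd k z *: vb k.
  move=> ji ez; rewrite {1}ez (big_ord_widen i (fun k => crd k z *: vb k) ji).
  rewrite big_mkcond; apply: eq_bigr => k _; case: ltnP => // jk.
  by rewrite (wide _ _ ez) // scale0r.
rewrite (pad x _ _ (leq_maxl n m) ex) (pad y _ _ (leq_maxr n m) ey).
by apply: eq_bigr => k _; rewrite e.
Qed.

Definition ent f k l : F := crd k (f (vb l)).

Lemma is_linear0 f : is_linear f -> f 0 = 0.
Proof.
move=> lf; have := lf 1 0 0; rewrite !scale1r addr0 => /eqP.
by rewrite -subr_eq subrr eq_sym => /eqP.
Qed.

Lemma is_linearZ f a x : is_linear f -> f (a *: x) = a *: f x.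
Proof. by move=> lf; have := lf a x 0; rewrite (is_linear0 lf) !addr0. Qed.

Lemma is_linearD f x y : is_linear f -> f (x + y) = f x + f y.
Proof. by move=> lf; have := lf 1 x y; rewrite !scale1r. Qed.

Lemma is_linear_sum f (I : Type) (r : seq I) (P : pred I) (h : I -> V) :
  is_linear f -> f (\sum_(i <- r | P i) h i) = \sum_(i <- r | P i) f (h i).
Proof.
by move=> lf; elim/big_rec2: _ => [|i y x _ <-]; rewrite ?(is_linear0 lf) ?(is_linearD _ _ lf).
Qed.

Lemma linear_ext f g : is_linear f -> is_linear g ->
  (forall k l, ent f k l = ent g k l) -> f = g.
Proof.
move=> lf lg e; apply/funext => x; have [n ->] := vb_span x.
rewrite !is_linear_sum //; apply: eq_bigr => l _; rewrite !is_linearZ //.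
by congr (_ *: _); apply: crd_ext => k; exact: e.
Qed.

Lemma entD f g k l : ent (f + g) k l = ent f k l + ent g k l.
Proof. exact: crdD. Qed.
Lemma entZ a f k l : ent (a *: f) k l = a * ent f k l.
Proof. exact: crdZ. Qed.

Lemma is_linear_eij i j : is_linear (eij i j).
Proof. by move=> a x y; rewrite /eij crd_lin scalerDl scalerA. Qed.

Lemma ent_eij i j k l : ent (eij i j) k l = (k == i)%:R * (j == l)%:R.
Proof. by rewrite /ent /eij crdZ !crd_vb mulrC. Qed.

Lemma is_linear_comb a f g : is_linear f -> is_linear g -> is_linear (a *: f + g).
Proof.
move=> lf lg b x y; rewrite /= !fctE lf lg !scalerDr !scalerA (mulrC a b).
by rewrite addrACA.
Qed.

Lemma zeroE x : (0 : E) x = 0. Proof. by []. Qed.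

Lemma is_linear_zero : is_linear (0 : E).
Proof. by move=> a x y; rewrite !zeroE scaler0 addr0. Qed.

Lemma glhom0 (h : G) : glhom h (0 : E).
Proof.
split; first exact: is_linear_zero.
by move=> d x _ k; rewrite zeroE crd0 eqxx.
Qed.

Lemma glhom_comb h a f g : glhom h f -> glhom h g -> glhom h (a *: f + g).
Proof.
move=> [lf hf] [lg hg]; split; first exact: is_linear_comb.
move=> d x dx k; rewrite !fctE crdD crdZ => nz.
have [e|] := eqVneq (crd k (f x)) 0; last exact: hf.
by apply: (hg d x dx); rewrite e mulr0 add0r in nz.
Qed.

Lemma glhomD h f g : glhom h f -> glhom h g -> glhom h (f + g).
Proof. by move=> hf hg; rewrite -[f]scale1r; exact: glhom_comb. Qed.

Lemma gl_graded_sum : @gl F D = graded_sum (@glhom F D).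
Proof. by []. Qed.

Lemma cgl_linear f : cgl D f -> is_linear f.
Proof.
case=> [[s [c [hc ->]]] _]; elim: s => [|g s IHs].
  by rewrite big_nil; exact: is_linear_zero.
by rewrite big_cons -[c g]scale1r; apply: is_linear_comb => //; case: (hc g).
Qed.

Lemma cglD f g : cgl D f -> cgl D g -> cgl D (f + g).
Proof.
move=> [f1 [s1 k1]] [g1 [s2 k2]]; split.
  by rewrite gl_graded_sum; apply: graded_sumD => //; [exact: glhom0 | exact: glhomD].
exists (s1 ++ s2) => h; rewrite mem_cat negb_or => /andP[h1 h2] x hx.
by rewrite fctE (k1 _ h1) ?(k2 _ h2) ?addr0.
Qed.

Lemma cglZ a f : cgl D f -> cgl D (a *: f).
Proof.
move=> [[s [c [hc ef]]] [s1 k1]]; split.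
  exists s, (fun h : G => a *: c h); split=> [h|]; last by rewrite ef scaler_sumr.
  by rewrite -[_ *: _]addr0; apply: glhom_comb => //; exact: glhom0.
by exists s1 => h h1 x hx; rewrite fctE (k1 _ h1) // scaler0.
Qed.

Lemma cgl0 : cgl D (0 : E).
Proof.
split; last by exists [::].
by exists [::], (fun=> 0); rewrite big_nil; split=> // g; exact: glhom0.
Qed.

Lemma glhom_eij i j : glhom (edeg D i j) (eij i j).
Proof.
split; first exact: is_linear_eij.
move=> d x dx k; rewrite /eij crdZ crd_vb mulf_eq0 negb_or => /andP[/dx <-].
by have [->|] := eqVneq k i; rewrite ?eqxx // /edeg subrK.
Qed.

Lemma cgl_eij i j : cgl D (eij i j).
Proof.
split; first by rewrite gl_graded_sum; apply: graded_sum_in (glhom_eij i j); exact: glhom0.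
exists [:: vdeg D j] => g; rewrite inE => gj x gx; rewrite /eij.
suff -> : crd j x = 0 by rewrite scale0r.
by apply: contrapT => /eqP /gx e; rewrite e eqxx in gj.
Qed.

Lemma cgl_sum (I : Type) (r : seq I) (P : pred I) (h : I -> E) :
  (forall i, P i -> cgl D (h i)) -> cgl D (\sum_(i <- r | P i) h i).
Proof. by move=> hh; apply: big_ind => //; [exact: cgl0 | exact: cglD]. Qed.

Definition bounded m f : Prop := forall k l, (m <= k)%N || (m <= l)%N -> ent f k l = 0.

Lemma crd_bounded x : exists m, forall k, (m <= k)%N -> crd k x = 0.
Proof.
have [m ex] := vb_span x; exists m => k mk; rewrite ex crd_sum big1 // => i _.
by rewrite crdZ crd_vb gtn_eqF ?mulr0 // (leq_trans (ltn_ord i)).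
Qed.

(** All but finitely many degrees are killed and each degree has finitely many basis vectors, so
    only finitely many columns are nonzero; each of them is finite. *)
Lemma cgl_bounded f : cgl D f -> exists m, bounded m f.
Proof.
move=> cf; have lf := cgl_linear cf; case: cf => _ [s ks].
have [alphaI alphaK1 alphaK2] := alpha_bij D.
have [m Hm] : exists m, forall l, vdeg D l \in s -> (l < m)%N.
  elim: s {ks} => [|g s [m Hm]]; first by exists 0%N.
  have [m' Hm'] := blk_fin D (alphaI g); exists (maxn m m') => l.
  rewrite inE leq_max => /orP[/eqP e|/Hm ->//]; rewrite Hm' ?orbT //.
  by rewrite -e alphaK1.
have fv l : (m <= l)%N -> f (vb l) = 0.
  move=> ml; apply: (ks (vdeg D l)); first by apply: contraTN ml => /Hm; rewrite -ltnNge.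
  by move=> k; rewrite crd_vb; have [->|] := eqVneq k l; rewrite ?eqxx.
have [m' Hm'] : exists m', forall k l, (m' <= k)%N -> (l < m)%N -> ent f k l = 0.
  elim: m {Hm fv} => [|m [m' Hm']]; first by exists 0%N.
  have [m2 H2] := crd_bounded (f (vb m)); exists (maxn m' m2) => k l.
  rewrite geq_max => /andP[k1 k2]; rewrite ltnS leq_eqVlt => /orP[/eqP->|].
    exact: H2.
  exact: Hm'.
exists (maxn m m') => k l; rewrite !geq_max.
have [lm|ml] := ltnP l m; last by move=> _; rewrite /ent fv // crd0.
by rewrite andFb orbF => /andP[_ kk]; exact: Hm'.
Qed.

Lemma bounded_sum m f : is_linear f -> bounded m f ->
  f = \sum_(k < m) \sum_(l < m) ent f k l *: eij k l.
Proof.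
move=> lf bf; apply: linear_ext => //.
  apply: big_ind => [|g h|k _]; first exact: is_linear_zero.
    by move=> lg lh; rewrite -[g]scale1r; exact: is_linear_comb.
  apply: big_ind => [|g h|l _]; first exact: is_linear_zero.
    by move=> lg lh; rewrite -[g]scale1r; exact: is_linear_comb.
  by rewrite -[_ *: _]addr0; apply: is_linear_comb;
    [exact: is_linear_eij | exact: is_linear_zero].
have ent_sum (I : Type) (r : seq I) (h : I -> E) k l :
    ent (\sum_(i <- r) h i) k l = \sum_(i <- r) ent (h i) k l.
  by elim: r => [|i r IHr]; rewrite ?big_nil ?big_cons ?entD ?IHr // /ent zeroE crd0.
move=> k l; rewrite ent_sum.
under eq_bigr => i _ do (rewrite ent_sum; under eq_bigr => j _ do rewrite entZ ent_eij).
have [km|mk] := ltnP k m; last first.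
  rewrite bf ?mk // big1 // => i _; rewrite big1 // => j _.
  by rewrite gtn_eqF ?mul0r ?mulr0 // (leq_trans (ltn_ord i)).
have [lm|ml] := ltnP l m; last first.
  rewrite bf ?ml ?orbT // big1 // => i _; rewrite big1 // => j _.
  by rewrite [j == l :> nat]ltn_eqF ?mulr0 // (leq_trans (ltn_ord j)).
rewrite (bigD1 (Ordinal km)) //= (bigD1 (Ordinal lm)) //= !eqxx !mulr1.
rewrite big1 ?addr0 => [|j /negPf jl]; last first.
  by rewrite -[_ == l]/(j == Ordinal lm) jl !mulr0.
rewrite big1 ?addr0 // => i /negPf ik; rewrite big1 // => j _.
by rewrite eq_sym -[_ == k]/(i == Ordinal km) ik mul0r mulr0.
Qed.

Lemma boundedW m m' f : (m <= m')%N -> bounded m f -> bounded m' f.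
Proof.
by move=> mm bf k l /orP[] h; apply: bf; rewrite (leq_trans mm h) ?orbT.
Qed.

End FiniteMatrices.

Lemma malgUU (R : nzRingType) (K : monomType) (a b : R) (k l : K) :
  << a *g k >> * << b *g l >> = << a * b *g mmul k l >> :> {malg R[K]}.
Proof. by rewrite malgM_def fgmulUU. Qed.

Lemma malgZU (R : nzRingType) (K : choiceType) (a b : R) (k : K) :
  a *: << b *g k >> = << a * b *g k >> :> {malg R[K]}.
Proof. by apply/malgP => l; rewrite mcoeffZ !mcoeffU mulrnAr. Qed.

Section Uchi.
Variables (F : fieldType) (D : colorSpace F) (p : nat).
Local Notation E := (Vsp D -> Vsp D).
Variables (chi : E -> F) (S : set E).
Local Notation U := (uchi p chi S).
Local Notation uin := (uin p chi S).
Local Notation uscal := (uscal p chi S).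
Local Notation pi := (qpi (urel p chi (S := S))).
Implicit Types (a b : F) (u w : U) (x y z : E) (t : freealg S).

Definition upi t : U := pi t.

Lemma upiM t t' : upi (t * t') = upi t * upi t'.
Proof. exact: qpiM. Qed.

Lemma pi_eq t t' : urel p chi (t - t') -> upi t = upi t'.
Proof. by move=> r; apply/qpi_eqP/gen_ideal2R. Qed.

Lemma upi1 : upi 1 = 1.
Proof. exact: qpi1. Qed.

Lemma upiD t t' : upi (t + t') = upi t + upi t'.
Proof. exact: qpiD. Qed.

Lemma upi0 : upi 0 = 0.
Proof. exact: qpi0. Qed.

Lemma upiX t n : upi (t ^+ n) = upi t ^+ n.
Proof. by elim: n => [|n IHn]; rewrite ?upi1 // !exprS upiM IHn. Qed.

Lemma uscalE a : uscal a = upi (a *: 1). Proof. by []. Qed.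

Lemma uscalD a b : uscal (a + b) = uscal a + uscal b.
Proof. by rewrite !uscalE scalerDl upiD. Qed.

Lemma uscalZ a t : upi (a *: t) = uscal a * upi t.
Proof. by rewrite uscalE -upiM -scalerAl mul1r. Qed.

Lemma uscalM a b : uscal (a * b) = uscal a * uscal b.
Proof. by rewrite -uscalZ uscalE scalerA. Qed.

Lemma uscal1 : uscal 1 = 1.
Proof. by rewrite uscalE scale1r upi1. Qed.

Lemma uscal0 : uscal 0 = 0.
Proof. by rewrite uscalE scale0r upi0. Qed.

Lemma scale_one_comm a t : t * (a *: 1) = a *: t.
Proof.
have one : (1 : freealg S) = << mone >> by [].
rewrite [t in LHS]monalgE [t in RHS]monalgE mulr_suml scaler_sumr.
apply: eq_bigr => k _; rewrite one !malgZU malgUU mulr1 mulrC.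
by rewrite mulm1.
Qed.

Lemma upi_repr u : upi (qrepr u) = u.
Proof. exact: qreprK. Qed.

Lemma uscal_comm a u : u * uscal a = uscal a * u.
Proof. by rewrite -(upi_repr u) -uscalZ uscalE -upiM scale_one_comm. Qed.

Lemma uin_val (r : S) : uin (val r) = upi (gen r).
Proof. by rewrite /uin valK. Qed.

Lemma uinE x (Sx : x \in S) : uin x = upi (gen (SigSub Sx)).
Proof. by rewrite -uin_val. Qed.

Lemma uin_lin a x y z : S x -> S y -> S z -> z = a *: x + y ->
  uin z = uscal a * uin x + uin y.
Proof.
move=> /mem_set Sx /mem_set Sy /mem_set Sz e.
rewrite (uinE Sx) (uinE Sy) (uinE Sz) -uscalZ -upiD; apply: pi_eq.
exact: urel_lin.
Qed.

Lemma uin_bracket g h x y z : S x -> S y -> S z -> glhom g x -> glhom h y ->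
  z = cbracket g h x y -> uin x * uin y = uscal (bichar g h) * (uin y * uin x) + uin z.
Proof.
move=> /mem_set Sx /mem_set Sy /mem_set Sz gx hy e.
rewrite (uinE Sx) (uinE Sy) (uinE Sz); set gX := gen _; set gY := gen _.
rewrite -(upiM gX gY) -(upiM gY gX) -(uscalZ _ (gY * gX)) -upiD.
apply: pi_eq; rewrite opprD addrA.
exact: (@urel_bracket _ _ _ _ _ g h (SigSub Sx) (SigSub Sy) (SigSub Sz)).
Qed.

Lemma uin_power g x z : S x -> S z -> gammaP D g -> glhom g x ->
  z = iter p (comp x) id -> uin x ^+ p = uin z + uscal (chi x ^+ p).
Proof.
move=> /mem_set Sx /mem_set Sz gg gx e.
rewrite (uinE Sx) (uinE Sz) uscalE -upiX -upiD.
apply: pi_eq; rewrite opprD addrA.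
exact: (@urel_power _ _ _ _ _ g (SigSub Sx) (SigSub Sz)).
Qed.

Definition uword (w : seq E) : U := \prod_(x <- w) uin x.

Lemma upi_monom (l : seq S) :
  upi (<< FMonom l >> : freealg S) = uword [seq val r | r <- l].
Proof.
elim: l => [|r l IHl]; first by rewrite /uword big_nil -upi1 -fmoneE.
have e : << FMonom (r :: l) >> = gen r * << FMonom l >> :> freealg S.
  by rewrite /gen malgUU mulr1 -[mmul _ _]/(fmmul _ _) fmmulE fmuE.
by rewrite e upiM IHl -uin_val /uword big_cons.
Qed.

Lemma upi_span t : upi t =
  \sum_(k <- msupp t) uscal t@_k * uword [seq val r | r <- (k : seq S)].
Proof.
rewrite {1}(monalgE t) (big_morph upi upiD upi0); apply: eq_bigr => k _ /=.
by rewrite -[t@_k]mulr1 -malgZU uscalZ mulr1 -upi_monom fmK.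
Qed.

End Uchi.

(** * Evaluation in the oscillator model *)

Section ModelEvaluation.
Variables (F : fieldType) (p : nat) (D : colorSpace F).
Local Notation V := (Vsp D).
Local Notation G := (Gamma D).
Local Notation E := (V -> V).
Local Notation bc := (@bichar F D).
Local Notation eij := (@eij F D).
Variables (chi : E -> F) (L : nat -> F).
Hypothesis pchF : p \in [pchar F].
Hypothesis chi_lin : linear_on (cgl D) chi.
Hypothesis chi_std : standard_semisimple chi.
Hypothesis L_pow : forall k, L k ^+ p - L k = chi (eij k k) ^+ p.
Local Notation U := (uchi p chi (cgl D)).
Implicit Types (m : nat) (u : U) (f g : E).

Let bcP : bicharacter bc := bicharP D.

Lemma lspan_in (X : set E) f : X f -> lspan X f.
Proof.
by move=> Xf; exists [:: (1, f)]; rewrite big_seq1 scale1r; split=> // t; rewrite inE => /eqP->.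
Qed.

Lemma chi_eij k l : k != l -> chi (eij k l) = 0.
Proof.
have [sp sm] := chi_std; rewrite neq_ltn => /orP[kl|lk].
  by apply: sp; apply: lspan_in; exists (k, l).
by apply: sm; apply: lspan_in; exists (k, l).
Qed.

Lemma chi_sum (I : Type) (r : seq I) (a : I -> F) (h : I -> E) :
  (forall i, cgl D (h i)) -> chi (\sum_(i <- r) a i *: h i) = \sum_(i <- r) a i * chi (h i).
Proof.
move=> ch; have chi0 : chi 0 = 0.
  have := chi_lin 1 (cgl0 D) (cgl0 D); rewrite scaler0 addr0 mul1r => /eqP.
  by rewrite -subr_eq subrr eq_sym => /eqP.
elim: r => [|i r IHr]; first by rewrite !big_nil.
by rewrite !big_cons chi_lin ?IHr //; apply: cgl_sum => j _; exact: cglZ.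
Qed.

Lemma chi_bounded m f : cgl D f -> bounded m f ->
  chi f = \sum_(k < m) ent f k k * chi (eij k k).
Proof.
move=> cf bf; rewrite {1}(bounded_sum (cgl_linear cf) bf).
have e : \sum_(k < m) \sum_(l < m) ent f k l *: eij k l =
    \sum_(k < m) 1 *: \sum_(l < m) ent f k l *: eij k l.
  by apply: eq_bigr => k _; rewrite scale1r.
rewrite {}e chi_sum => [|k]; last by apply: cgl_sum => l _; exact/cglZ/cgl_eij.
apply: eq_bigr => k _; rewrite mul1r chi_sum => [|l]; last exact: cgl_eij.
rewrite (bigD1 k) //= big1 ?addr0 // => l lk.
by rewrite chi_eij ?mulr0 // eq_sym.
Qed.

Variable m : nat.
Definition deg_ord (i : 'I_m.+1) : G := vdeg D i.
(** The zero-point value is subtracted, so that the vacuum has weight [L]. *)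
Definition sv_ord (i : 'I_m.+1) : F := L i - sub_vac bc deg_ord i.
Local Notation X := {ffun 'I_m.+1 * 'I_m.+1 -> int}.
Local Notation Aop := (Aosc bc deg_ord sv_ord).
Local Notation Bop := (Bosc bc deg_ord).
Definition repM (x : 'M[F]_m.+1) : opr F X := glrep Aop Bop x.
HB.instance Definition _ := GRing.Linear.copy repM (glrep Aop Bop).
Definition matM f : 'M[F]_m.+1 := \matrix_(i, j) ent f i j.

Lemma matM_lin a f g : matM (a *: f + g) = a *: matM f + matM g.
Proof. by apply/matrixP => i j; rewrite !mxE entD entZ. Qed.

(** Truncation is multiplicative once the columns of the inner factor stay inside the window, which
    happens only for m large. This is why the models have to be taken in the limit. *)
Lemma matM_comp f g : is_linear f -> bounded m.+1 g -> matM (f \o g) = matM f *m matM g.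
Proof.
move=> lf bg; apply/matrixP => i j; rewrite !mxE.
have -> : ent (f \o g) i j = crd i (f (\sum_(k < m.+1) ent g k j *: vb D k)).
  rewrite /ent /=; congr (crd i (f _)); apply: crd_ext => k.
  rewrite crd_sum; under eq_bigr => l _ do rewrite crdZ crd_vb.
  have [km|mk] := ltnP k m.+1; last first.
    rewrite -[LHS]/(ent g k j) bg ?mk // big1 // => l _.
    by rewrite gtn_eqF ?mulr0 // (leq_trans (ltn_ord l)).
  rewrite (bigD1 (Ordinal km)) //= eqxx mulr1 big1 ?addr0 // => l /negPf lk.
  by rewrite eq_sym -[_ == k]/(l == Ordinal km) lk mulr0.
rewrite is_linear_sum // crd_sum; apply: eq_bigr => k _.
by rewrite is_linearZ // crdZ !mxE mulrC.
Qed.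

Lemma matM_hom (g : G) f : glhom g f -> mxhom deg_ord g (matM f).
Proof.
move=> [lf hf] i j; rewrite mxE => nz; rewrite /deg_ord.
have vj : Vgr (vdeg D j) (vb D j).
  by move=> k; rewrite crd_vb; have [->|] := eqVneq k j; rewrite ?eqxx.
by rewrite (hf _ _ vj i nz) addrK.
Qed.

Lemma matM_eij (i j : 'I_m.+1) : matM (eij i j) = delta_mx i j.
Proof. by apply/matrixP => k l; rewrite !mxE ent_eij -mulnb natrM (eq_sym l). Qed.

(** The correction [sub_vac] lies in the prime field, so it does not change x^p - x. *)
Lemma sv_ord_pow i : sv_ord i ^+ p - sv_ord i = chi (eij i i) ^+ p.
Proof.
have fix_p : sub_vac bc deg_ord i ^+ p = sub_vac bc deg_ord i.
  rewrite /sub_vac -(pFrobenius_autE pchF) rmorph_sum; apply: eq_bigr => r _ /=.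
  by case: ifP; rewrite ?rmorphN !rmorph1.
rewrite -L_pow /sv_ord -(pFrobenius_autE pchF) rmorphB /= !pFrobenius_autE fix_p.
by rewrite opprB addrA subrK.
Qed.

Definition evM (t : freealg (cgl D)) : opr F X := fev (fun r => repM (matM (val r))) t.
HB.instance Definition _ := GRing.Linear.copy evM (fev (fun r : cgl D => repM (matM (val r)))).

Lemma evM_gen (r : cgl D) : evM (gen r) = repM (matM (val r)).
Proof. exact: fev_gen. Qed.

Lemma evMM t t' : evM (t * t') = evM t * evM t'.
Proof. exact: fevM. Qed.

Lemma evMX t n : evM (t ^+ n) = evM t ^+ n.
Proof. exact: fevX. Qed.

Lemma evM1 : evM 1 = 1.
Proof. exact: fev1. Qed.

Lemma evMD t t' : evM (t + t') = evM t + evM t'.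
Proof. exact: linearD. Qed.

Lemma evMB t t' : evM (t - t') = evM t - evM t'.
Proof. exact: linearB. Qed.

Lemma evMZ a t : evM (a *: t) = a *: evM t.
Proof. exact: linearZ. Qed.

Lemma evM0 : evM 0 = 0.
Proof. exact: linear0. Qed.

Lemma repM_bracket (g h : G) f f' : glhom g f -> glhom h f' -> bounded m.+1 f -> bounded m.+1 f' ->
  repM (matM f) * repM (matM f') - bc g h *: (repM (matM f') * repM (matM f)) =
  repM (matM (cbracket g h f f')).
Proof.
move=> hf hf' bf bf'; have [lf lf'] := (hf.1, hf'.1).
rewrite /repM (glrep_bracket bcP (thK bc deg_ord) (AoscM _ _ bcP) (BoscM _ bcP)
  (BoscA _ _ bcP) (matM_hom hf) (matM_hom hf')).
congr (glrep _ _ _); rewrite -!matM_comp //; apply/matrixP => i j.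
by rewrite !mxE /cbracket entD -scaleNr entZ mulNr.
Qed.

Lemma bounded_comp f g : is_linear f -> bounded m.+1 f -> bounded m.+1 g ->
  bounded m.+1 (f \o g).
Proof.
move=> lf bf bg k l kl.
have [ml|lm] := leqP m.+1 l.
  have g0 : g (vb D l) = 0.
    by apply: crd_ext => i; rewrite crd0; apply: bg; rewrite ml orbT.
  by rewrite /ent /= g0 is_linear0 // crd0.
have {}kl : (m < k)%N by move: kl; rewrite (leqNgt _ l) lm orbF.
rewrite /ent /= ; have [n ->] := vb_span (g (vb D l)).
rewrite is_linear_sum // crd_sum big1 // => i _.
by rewrite is_linearZ // crdZ -/(ent f k i) bf ?mulr0 // kl.
Qed.

Lemma matM_iter f n : is_linear f -> bounded m.+1 f -> (0 < n)%N ->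
  bounded m.+1 (iter n (comp f) id) /\ matM (iter n (comp f) id) = matM f ^+ n.
Proof.
move=> lf bf; elim: n => [//|[|n] IHn] _; first by rewrite expr1.
have [//|bn en] := IHn; split; first exact: bounded_comp.
by rewrite exprS -en -mulmxE -matM_comp.
Qed.

Lemma repM_power (g : G) f : gammaP D g -> glhom g f -> cgl D f -> bounded m.+1 f ->
  repM (matM f) ^+ p = repM (matM (iter p (comp f) id)) + (chi f ^+ p) *: 1.
Proof.
move=> gg hf cf bf; have p_gt0 := prime_gt0 (pcharf_prime pchF).
have [_ ->] := matM_iter hf.1 bf p_gt0.
rewrite /repM (glrep_pth pchF bcP (thK bc deg_ord) (AoscM _ _ bcP) (BoscM _ bcP)
  (BoscA _ _ bcP) _ gg (matM_hom hf) (chi := fun i => chi (eij i i))).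
  by rewrite (chi_bounded cf bf); under eq_bigr => i _ do rewrite mxE.
move=> i j ev; apply: (glosc_pth bcP pchF (chi := fun i => chi (eij i i))) => // k.
exact: sv_ord_pow.
Qed.

End ModelEvaluation.

Definition eventually (P : nat -> Prop) : Prop := exists m0, forall m, (m0 <= m)%N -> P m.

Lemma eventuallyW (P Q : nat -> Prop) :
  (forall m, P m -> Q m) -> eventually P -> eventually Q.
Proof. by move=> PQ [m0 H]; exists m0 => m /H /PQ. Qed.

Lemma eventuallyT (P : nat -> Prop) : (forall m, P m) -> eventually P.
Proof. by move=> H; exists 0%N => m _. Qed.

Lemma eventually2 (P Q R : nat -> Prop) : (forall m, P m -> Q m -> R m) ->
  eventually P -> eventually Q -> eventually R.
Proof.
move=> PQR [m1 H1] [m2 H2]; exists (maxn m1 m2) => m; rewrite geq_max => /andP[k1 k2].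
exact: PQR (H1 _ k1) (H2 _ k2).
Qed.

(** * Detecting nonzero tensors by large models *)

Section Detection.
Variables (F : fieldType) (p : nat) (D : colorSpace F).
Local Notation V := (Vsp D).
Local Notation G := (Gamma D).
Local Notation E := (V -> V).
Local Notation bc := (@bichar F D).
Local Notation eij := (@eij F D).
Variables (chi : E -> F) (L : nat -> F).
Hypothesis pchF : p \in [pchar F].
Hypothesis chi_lin : linear_on (cgl D) chi.
Hypothesis chi_std : standard_semisimple chi.
Hypothesis L_pow : forall k, L k ^+ p - L k = chi (eij k k) ^+ p.
Local Notation U := (uchi p chi (cgl D)).
Implicit Types (m : nat) (u : U) (f h : E).
Local Notation ev := (@evM F D L).

Let bcP : bicharacter bc := bicharP D.
Let p_gt0 : (0 < p)%N. Proof. exact/prime_gt0/(pcharf_prime pchF). Qed.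

Definition null (t : freealg (cgl D)) : Prop := eventually (fun m => ev m t = 0).

Lemma null_ideal : is_ideal2 null.
Proof.
split.
- split=> [|x y]; first by apply: eventuallyT => m; rewrite evM0.
  by apply: eventually2 => m ex ey; rewrite evMB ex ey subr0.
- by move=> a x; apply: eventuallyW => m e; rewrite evMM e mulr0.
- by move=> a x; apply: eventuallyW => m e; rewrite evMM e mul0r.
Qed.

Lemma cgl_eventually f : cgl D f -> eventually (fun m => bounded m.+1 f).
Proof.
move=> /cgl_bounded[m0 b]; exists m0 => m mm; apply: boundedW b.
by rewrite ltnW // ltnS.
Qed.

(* The values are passed as equations, which avoids a costly unification of
   distinct generators. *)
Lemma evM_linear m (b : F) (x y z : freealg (cgl D)) X Y Z :
  ev m x = X -> ev m y = Y -> ev m z = Z ->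
  ev m (z - (b *: x + y)) = Z - (b *: X + Y).
Proof.
move=> <- <- <-; rewrite evMB; congr (_ - _); rewrite [LHS]evMD; congr (_ + _).
exact: evMZ.
Qed.

Lemma evM_bracket m (b : F) (x y z : freealg (cgl D)) X Y Z :
  ev m x = X -> ev m y = Y -> ev m z = Z ->
  ev m (x * y - b *: (y * x) - z) = X * Y - b *: (Y * X) - Z.
Proof.
move=> <- <- <-; rewrite evMB; congr (_ - _); rewrite [LHS]evMB; congr (_ - _).
  exact: evMM.
by rewrite [LHS]evMZ; congr (_ *: _); exact: evMM.
Qed.

Lemma evM_power m (c : F) (x z : freealg (cgl D)) X Z :
  ev m x = X -> ev m z = Z -> ev m (x ^+ p - z - c *: 1) = X ^+ p - Z - c *: 1.
Proof.
move=> <- <-; rewrite evMB; congr (_ - _); last by rewrite [LHS]evMZ evM1.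
by rewrite [LHS]evMB; congr (_ - _); exact: evMX.
Qed.

Lemma urel_null t : urel p chi t -> null t.
Proof.
case=> {t} [a x y z e|g h x y z gx hy e|g x z gg gx e].
- apply: eventuallyT => m.
  apply: (etrans (evM_linear _ (evM_gen L m x) (evM_gen L m y) (evM_gen L m z))).
  by rewrite e matM_lin /repM linearP subrr.
- have [cx cy] := (cgl_eventually (set_valP x), cgl_eventually (set_valP y)).
  apply: (eventually2 _ cx cy) => m bx by_.
  apply: (etrans (evM_bracket _ (evM_gen L m x) (evM_gen L m y) (evM_gen L m z))).
  by rewrite (repM_bracket L gx hy bx by_) e subrr.
- have cx := cgl_eventually (set_valP x); apply: eventuallyW cx => m bx.
  apply: (etrans (evM_power _ (evM_gen L m x) (evM_gen L m z))).
  rewrite e (repM_power pchF chi_lin chi_std L_pow gg gx (set_valP x) bx).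
  by rewrite -addrA -opprD subrr.
Qed.

Lemma gen_null t : gen_ideal2 (urel p chi (S := cgl D)) t -> null t.
Proof. by apply: gen_ideal2_ind; [exact: null_ideal | exact: urel_null]. Qed.

Lemma ev_upi t : eventually (fun m => ev m (qrepr (upi p chi t)) = ev m t).
Proof.
have : null (qrepr (upi p chi t) - t) by apply/gen_null/qpi_eqP; rewrite qreprK.
by apply: eventuallyW => m /eqP; rewrite evMB subr_eq0 => /eqP.
Qed.

(* A relation of u_chi(cgl(V)) only involves finitely many matrix units, so that it
   holds in the m-th model for all large m. *)
Definition evU m u := ev m (qrepr u).

Lemma evU_D u u' : eventually (fun m => evU m (u + u') = evU m u + evU m u').
Proof.
have := ev_upi (qrepr u + qrepr u'); apply: eventuallyW => m.
by rewrite upiD !upi_repr evMD.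
Qed.

Lemma evU_M u u' : eventually (fun m => evU m (u * u') = evU m u * evU m u').
Proof.
have := ev_upi (qrepr u * qrepr u'); apply: eventuallyW => m.
by rewrite upiM !upi_repr evMM.
Qed.

Lemma evU_scal a : eventually (fun m => evU m (uscal p chi (cgl D) a) = a *: 1).
Proof.
have := ev_upi (a *: 1); apply: eventuallyW => m.
by rewrite -uscalE evMZ evM1.
Qed.

Lemma evU_uin f : cgl D f ->
  eventually (fun m => evU m (uin p chi (cgl D) f) = repM D L (matM m f)).
Proof.
move=> /mem_set cf; have := ev_upi (gen (SigSub cf)); apply: eventuallyW => m.
by rewrite -uinE evM_gen.
Qed.

Lemma evU_0 : eventually (fun m => evU m 0 = 0).
Proof.
have := ev_upi 0; apply: eventuallyW => m.
by rewrite upi0 evM0.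
Qed.

Lemma evU_1 : eventually (fun m => evU m 1 = 1).
Proof.
have := ev_upi 1; apply: eventuallyW => m.
by rewrite upi1 evM1.
Qed.

Definition iword m (w : seq rootpair) : seq ('I_m.+1 * 'I_m.+1) :=
  [seq (inord d.1, inord d.2) | d <- w].

(** The bound on the indices is carried along because [inord] returns a default value outside its
    range. *)
Lemma evU_word (w : seq rootpair) : eventually (fun m =>
  (forall d, d \in w -> (d.1 <= m)%N /\ (d.2 <= m)%N) /\
  evU m (\prod_(d <- w) uin p chi (cgl D) (eij d.1 d.2)) (@vac F m) =
    owords bc (@deg_ord F D m) (sv_ord D L (m := m)) (iword m w)).
Proof.
elim: w => [|[i j] w IHw].
  by apply: eventuallyW evU_1 => m e; rewrite big_nil e.
have bnd : eventually (fun m => (i <= m)%N /\ (j <= m)%N).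
  by exists (maxn i j) => m; rewrite geq_max => /andP.
have HM := evU_M (uin p chi (cgl D) (eij i j))
  (\prod_(d <- w) uin p chi (cgl D) (eij d.1 d.2)).
have HU := evU_uin (cgl_eij D i j).
apply: (eventually2 _ (eventually2 _ HM HU) (eventually2 _ IHw bnd)); last first.
- by move=> m; exact: conj.
- by move=> m; exact: conj.
move=> m [eM eU] [[bw ew] [im jm]]; split.
  by move=> d; rewrite inE => /orP[/eqP->|/bw].
rewrite big_cons eM opME ew eU /=.
have -> : eij i j = eij (inord i : 'I_m.+1) (inord j : 'I_m.+1) by rewrite !inordK.
by rewrite matM_eij /repM glrep_delta.
Qed.

Variables (Mo : lmodType (uchi p chi (Bsub D))) (v : Mo) (lam : E -> F).
Hypothesis v0 : v != 0.
Hypothesis v_gen : forall w : Mo, exists a : F, w = fscale a v.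
Hypothesis N_v : forall x, Nplus D x -> uin p chi (Bsub D) x *: v = 0.
Hypothesis lam_lin : linear_on (Hsub D) lam.
Hypothesis H_v : forall x, Hsub D x -> uin p chi (Bsub D) x *: v = fscale (lam x) v.
Hypothesis L_lam : forall k, L k = lam (eij k k).

Lemma fscaleD a b (w : Mo) : fscale (a + b) w = fscale a w + fscale b w.
Proof. exact: etrans (congr1 ( *:%R^~ w) (uscalD p chi _ a b)) (scalerDl w _ _). Qed.

Lemma fscaleM a b (w : Mo) : fscale (a * b) w = fscale a (fscale b w).
Proof.
apply: etrans (congr1 ( *:%R^~ w) (uscalM p chi _ a b)) _.
by rewrite /fscale scalerA.
Qed.

Lemma fscale1 (w : Mo) : fscale 1 w = w.
Proof. exact: etrans (congr1 ( *:%R^~ w) (uscal1 p chi _)) (scale1r w). Qed.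

Lemma fscale_inj a b : fscale a v = fscale b v -> a = b.
Proof.
move=> e; apply/eqP; rewrite -subr_eq0; apply: contraT => nz; case/eqP: v0.
have z : fscale (a - b) v = 0.
  have := fscaleD (a - b) b v; rewrite subrK e => /eqP.
  by rewrite -subr_eq subrr => /eqP.
have e1 := congr1 (fun c => fscale c v) (mulVf nz).
have e2 := congr1 (fscale (a - b)^-1) z.
have e3 : v = fscale (a - b)^-1 0.
  exact: etrans (etrans (esym (fscale1 v)) (esym e1)) (etrans (fscaleM _ _ v) e2).
by rewrite e3 /fscale scaler0.
Qed.

Lemma Hsub_sum x : Hsub D x ->
  exists s : seq (F * nat), x = \sum_(t <- s) t.1 *: eij t.2 t.2.
Proof.
case=> s [Hs ->]; elim: s Hs => [|[a f] s IHs] Hs; first by exists [::]; rewrite !big_nil.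
have [|r er] := IHs; first by move=> t ts; apply: Hs; rewrite inE ts orbT.
have [i _ ei] := Hs _ (mem_head _ _); exists ((a, i) :: r).
by rewrite !big_cons er /=; rewrite -[f]/((a, f).2) -ei.
Qed.

Lemma Nplus_sum x : Nplus D x -> exists2 s : seq (F * rootpair),
  (forall t, t \in s -> (t.2.1 < t.2.2)%N) & x = \sum_(t <- s) t.1 *: eij t.2.1 t.2.2.
Proof.
case=> s [Hs ->]; elim: s Hs => [|[a f] s IHs] Hs; first by exists [::]; rewrite ?big_nil.
have [|r rr er] := IHs; first by move=> t ts; apply: Hs; rewrite inE ts orbT.
have [d dd ed] := Hs _ (mem_head _ _); exists ((a, d) :: r).
  by move=> t; rewrite inE => /orP[/eqP->|/rr].
by rewrite !big_cons er /=; rewrite -[f]/((a, f).2) -ed.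
Qed.

Lemma Hsub_lspan (s : seq (F * nat)) : Hsub D (\sum_(t <- s) t.1 *: eij t.2 t.2).
Proof.
exists [seq (t.1, eij t.2 t.2) | t <- s]; split; last by rewrite big_map.
by move=> _ /mapP[t _ ->]; exists t.2.
Qed.

Lemma lam_sum (s : seq (F * nat)) :
  lam (\sum_(t <- s) t.1 *: eij t.2 t.2) = \sum_(t <- s) t.1 * L t.2.
Proof.
have H0 : Hsub D 0 by have := Hsub_lspan [::]; rewrite big_nil.
have lam0 : lam 0 = 0.
  have := lam_lin 1 H0 H0; rewrite scaler0 addr0 mul1r => /eqP.
  by rewrite -subr_eq subrr eq_sym => /eqP.
elim: s => [|t s IHs]; first by rewrite !big_nil.
rewrite !big_cons lam_lin ?IHs ?L_lam //; last exact: Hsub_lspan.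
by apply: lspan_in; exists t.2.
Qed.

Definition acts u c := eventually (fun m => evU m u (@vac F m) = fun a => c * vac F a).

Lemma acts_uin x n : Hsub D x -> Nplus D n -> acts (uin p chi (cgl D) (x + n)) (lam x).
Proof.
move=> /Hsub_sum[s ->] /Nplus_sum[r rr ->]; rewrite lam_sum.
have cs : cgl D (\sum_(t <- s) t.1 *: eij t.2 t.2).
  by apply: cgl_sum => t _; exact/cglZ/cgl_eij.
have cr : cgl D (\sum_(t <- r) t.1 *: eij t.2.1 t.2.2).
  by apply: cgl_sum => t _; exact/cglZ/cgl_eij.
have bs : eventually (fun m => forall t, t \in s -> (t.2 <= m)%N).
  exists (\max_(t <- s) t.2) => m mm t ts; apply: leq_trans mm.
  rewrite (big_rem t ts); exact: leq_maxl.
have br : eventually (fun m => forall t, t \in r -> (t.2.2 <= m)%N).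
  exists (\max_(t <- r) t.2.2) => m mm t ts; apply: leq_trans mm.
  rewrite (big_rem t ts); exact: leq_maxl.
apply: (eventually2 _ (evU_uin (cglD cs cr)) (eventually2 (fun m => @conj _ _) bs br)).
move=> m -> [ms mr].
have rsum (I : Type) (l : seq I) (c : I -> F) (f : I -> E) :
    repM D L (matM m (\sum_(i <- l) c i *: f i)) = \sum_(i <- l) c i *: repM D L (matM m (f i)).
  elim: l => [|i l IHl].
    rewrite !big_nil /repM (_ : matM m 0 = 0) ?linear0 //.
    by apply/matrixP => i j; rewrite !mxE /ent crd0.
  by rewrite !big_cons matM_lin -IHl /repM linearP.
have -> : matM m (\sum_(t <- s) t.1 *: eij t.2 t.2 + \sum_(t <- r) t.1 *: eij t.2.1 t.2.2) =
    matM m (\sum_(t <- s) t.1 *: eij t.2 t.2) +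
    matM m (\sum_(t <- r) t.1 *: eij t.2.1 t.2.2).
  by rewrite -[X in matM m (X + _)]scale1r matM_lin scale1r.
have rD (X Y : 'M[F]_m.+1) : repM D L (X + Y) = repM D L X + repM D L Y.
  exact: linearD.
rewrite rD !rsum; apply/funext => a.
rewrite opDE !op_sumE [X in _ + X]big_seq [X in _ + X]big1 ?addr0 => [|t tr]; last first.
  have tt := rr _ tr; have tm := mr _ tr.
  have -> : eij t.2.1 t.2.2 = eij (inord t.2.1 : 'I_m.+1) (inord t.2.2 : 'I_m.+1).
    by rewrite !inordK // ltnS (leq_trans (ltnW tt)).
  rewrite opZE matM_eij /repM glrep_delta glosc_vac ?mulr0 //.
  by rewrite !inordK // ltnS (leq_trans (ltnW tt)).
rewrite mulr_suml big_seq [RHS]big_seq; apply: eq_bigr => t ts.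
have tm := ms _ ts.
have -> : eij t.2 t.2 = eij (inord t.2 : 'I_m.+1) (inord t.2 : 'I_m.+1).
  by rewrite !inordK.
rewrite opZE matM_eij /repM glrep_delta (glosc_vac_diag _ _ bcP) /sv_ord subrK inordK //.
by rewrite mulrA.
Qed.

Lemma actsD u u' c c' : acts u c -> acts u' c' -> acts (u + u') (c + c').
Proof.
move=> hu hu'; apply: (eventually2 _ (evU_D u u') (eventually2 (fun m => @conj _ _) hu hu')).
by move=> m eD [e e']; rewrite eD; apply/funext => a; rewrite opDE e e' mulrDl.
Qed.

Lemma actsM u u' c c' : acts u c -> acts u' c' -> acts (u * u') (c * c').
Proof.
move=> hu hu'; apply: (eventually2 _ (evU_M u u') (eventually2 (fun m => @conj _ _) hu hu')).
move=> m eM [e e']; rewrite eM opME e' opZfun e.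
by apply/funext => a; rewrite mulrCA mulrA.
Qed.

Lemma acts_scal c : acts (uscal p chi (cgl D) c) c.
Proof. by apply: eventuallyW (evU_scal c) => m ->; apply/funext => a; rewrite opZE. Qed.

Lemma acts0 : acts 0 0.
Proof. by apply: eventuallyW evU_0 => m ->; apply/funext => a; rewrite op0E mul0r. Qed.

Lemma acts1 : acts 1 1.
Proof. by apply: eventuallyW evU_1 => m ->; apply/funext => a; rewrite mul1r. Qed.

Lemma uin_Bsub (x : E) : Bsub D x -> exists2 c,
  acts (uin p chi (cgl D) x) c & uin p chi (Bsub D) x *: v = fscale c v.
Proof.
case=> h Hh [n Nn <-]; exists (lam h); first exact: acts_uin.
have H0 : Hsub D 0 by have := Hsub_lspan [::]; rewrite big_nil.
have N0 : Nplus D 0 by exists [::]; rewrite big_nil.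
have Bh : Bsub D h by exists h => //; exists 0 => //; rewrite addr0.
have Bn : Bsub D n by exists 0 => //; exists n => //; rewrite add0r.
have Bx : Bsub D (h + n) by exists h => //; exists n.
have ex : h + n = 1 *: h + n by rewrite scale1r.
apply: etrans (congr1 ( *:%R^~ v) (uin_lin p chi Bh Bn Bx ex)) _.
apply: etrans (scalerDl v _ _) _.
rewrite (N_v Nn) addr0.
apply: etrans (esym (scalerA _ _ v)) _.
rewrite (H_v Hh); exact: fscale1.
Qed.

Lemma scaler_fscale (b : uchi p chi (Bsub D)) c (w : Mo) : b *: fscale c w = fscale c (b *: w).
Proof.
rewrite /fscale scalerA [RHS]scalerA.
exact: (congr1 ( *:%R^~ w) (uscal_comm c b)).
Qed.

Lemma uword_Bsub (l : seq (Bsub D)) : exists2 c,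
  acts (\prod_(x <- l) uin p chi (cgl D) (val x)) c
  & uword p chi (Bsub D) [seq val x | x <- l] *: v = fscale c v.
Proof.
elim: l => [|x l [c ac vc]].
  by exists 1; rewrite ?big_nil; [exact: acts1 | rewrite /uword big_nil fscale1; exact: scale1r].
have [d ad vd] := uin_Bsub (set_valP x); exists (d * c); first by rewrite big_cons; exact: actsM.
rewrite /uword /= big_cons; apply: etrans (esym (scalerA _ _ v)) _.
rewrite -/(uword p chi (Bsub D) _) vc; apply: etrans (scaler_fscale _ _ _) _.
apply: etrans (congr1 (fscale c) vd) (etrans (esym (fscaleM c d v)) _).
exact: (congr1 (fun e : F => fscale e v) (mulrC c d)).
Qed.

(** An element of u_chi(B) is a combination of words in B. Each letter has the same eigenvalue on
    the vacuum as on [v], so the words do too, and [v] being nonzero determines the scalar. *)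
Lemma incl_acts (b : uchi p chi (Bsub D)) c : b *: v = fscale c v -> acts (uchi_incl (cgl D) b) c.
Proof.
suff [d ad vd] : exists2 d, acts (uchi_incl (cgl D) b) d & b *: v = fscale d v.
  by rewrite vd => /fscale_inj <-.
have eb := etrans (esym (upi_repr b)) (upi_span p chi (qrepr b)).
pose t : freealg (Bsub D) := qrepr b; rewrite -/t in eb.
suff [d ad vd] : exists2 d, acts (\sum_(k <- msupp t) uscal p chi (cgl D) t@_k *
      \prod_(x <- (k : seq (Bsub D))) uin p chi (cgl D) (val x)) d
    & (\sum_(k <- msupp t) uscal p chi (Bsub D) t@_k *
      uword p chi (Bsub D) [seq val x | x <- (k : seq (Bsub D))]) *: v = fscale d v.
  by exists d => //; exact: etrans (congr1 ( *:%R^~ v) eb) vd.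
elim: (enum_fset (msupp t)) => [|k s [c1 a1 v1]].
  by exists 0; rewrite big_nil; [exact: acts0 | rewrite /fscale uscal0].
have [c2 a2 v2] := uword_Bsub (k : seq (Bsub D)).
exists (t@_k * c2 + c1); rewrite big_cons.
  by apply: actsD a1; apply: actsM a2; exact: acts_scal.
apply: etrans (scalerDl v _ _) _; rewrite v1 fscaleD fscaleM; congr (_ + _).
by apply: etrans (esym (scalerA _ _ v)) _; rewrite v2.
Qed.

(** The coordinate of [w] along [v]. The default 0 is never taken, by [v_gen]. *)
Definition kap (w : Mo) : F := xget 0 [set a | w = fscale a v].

Lemma kapE w : w = fscale (kap w) v.
Proof. by have [a wa] := v_gen w; exact: (xgetPex 0 (ex_intro [set a | w = fscale a v] a wa)). Qed.

Lemma kap_eq w c : w = fscale c v -> kap w = c.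
Proof. by move=> e; apply: fscale_inj; rewrite -kapE. Qed.

(** The pairing of a and w that sends a (x) w to kap(w) times the value of a on the vacuum. It
    respects each tensor relation in all sufficiently large models. *)
Definition pev1 m (k : U * Mo) : {ffun 'I_m.+1 * 'I_m.+1 -> int} -> F :=
  fun a => kap k.2 * evU m k.1 (@vac F m) a.
Definition pev m (t : {malg int[(U * Mo)%type]}) := zev (@pev1 m) t.
Arguments pev : clear implicits.

Local Notation tens := (@tensor _ _ (@uchi_incl F D p chi (Bsub D) (cgl D)) Mo).

Lemma pev_rel t : tensor_rel (@uchi_incl F D p chi (Bsub D) (cgl D)) t ->
  eventually (fun m => pev m t = 0).
Proof.
case=> {t} [a b w|a w x|a b w].
- apply: eventuallyW (evU_D a b) => m e; apply: etrans (zev3 _ _ _ _) _; apply/funext => y.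
  rewrite /pev1 /= e.
  change (kap w * (evU m a (@vac F m) y + evU m b (@vac F m) y) -
    kap w * evU m a (@vac F m) y - kap w * evU m b (@vac F m) y = 0).
  by rewrite mulrDr addrAC addrK subrr.
- have ekap : kap (w + x) = kap w + kap x.
    by apply: kap_eq; rewrite fscaleD -!kapE.
  apply: eventuallyT => m; apply: etrans (zev3 _ _ _ _) _; apply/funext => y.
  rewrite /pev1 /= ekap; change ((kap w + kap x) * evU m a (@vac F m) y -
    kap w * evU m a (@vac F m) y - kap x * evU m a (@vac F m) y = 0).
  by rewrite mulrDl addrAC addrK subrr.
- have ab := incl_acts (kapE (b *: v)).
  have ekap : kap (b *: w) = kap w * kap (b *: v).
    apply: kap_eq; rewrite {1}(kapE w).
    apply: etrans (scaler_fscale _ _ _) _; rewrite {1}(kapE (b *: v)).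
    exact: esym (fscaleM _ _ v).
  apply: (eventually2 _ (evU_M a (uchi_incl (cgl D) b)) ab) => m eM eb.
  apply: etrans (zev2 _ _ _) _; apply/funext => y.
  rewrite /pev1 /= ekap eM opME eb opZfun.
  change (kap w * (kap (b *: v) * evU m a (@vac F m) y) -
    kap w * kap (b *: v) * evU m a (@vac F m) y = 0).
  by rewrite mulrA subrr.
Qed.

(** A vanishing tensor is a finite combination of tensor relations, each of which the pairing kills
    in all large models. *)
Lemma tensor_eq0 u : tens u v = 0 -> eventually (fun m => evU m u (@vac F m) = 0).
Proof.
move=> e; have {}e : tpi (@uchi_incl F D p chi (Bsub D) (cgl D)) << (u, v) >> = tpi _ 0.
  by rewrite tpi0.
have {e} := (tpi_eqP _ _ _).1 e; rewrite subr0 => g.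
have sub : is_subgroup (fun t => eventually (fun m => pev m t = 0)).
  split; first by apply: eventuallyT => m; exact: zev0.
  by move=> x y; apply: eventually2 => m ex ey; rewrite /pev zevB -!/(pev _ _) ex ey subr0.
have := gen_subgroup_ind sub pev_rel g; apply: eventuallyW => m h.
have {}h : @pev1 m (u, v) = 0 := etrans (esym (zevU _ _)) h.
apply/funext => y; have := congr1 (fun k => k y) h.
by rewrite /pev1 /= (kap_eq (esym (fscale1 v))) mul1r.
Qed.

Lemma eventually_ex (P : nat -> Prop) : eventually P -> exists m, P m.
Proof. by case=> m Pm; exists m; exact: Pm. Qed.

Lemma pbarE d : pbar D p d = if bc (edeg D d.1 d.2) (edeg D d.1 d.2) == 1 then p else 2%N.
Proof.
rewrite /pbar; congr (if _ then _ else _).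
by apply/asboolP/eqP.
Qed.

Local Notation uwd w := (\prod_(d <- w) uin p chi (cgl D) (eij d.1 d.2)).

Lemma tensor_word_neq0 (w : seq rootpair) : (forall d, d \in w -> (d.2 < d.1)%N) ->
  (forall d, (count_mem d w < pbar D p d)%N) -> tens (uwd w) v != 0.
Proof.
move=> wlow wcount; apply/eqP => /tensor_eq0 e0.
have [m [e [bw ew]]] := eventually_ex (eventually2 (fun m => @conj _ _) e0 (evU_word w)).
have inw (d : rootpair) : d \in w -> (inord d.1 : 'I_m.+1) = d.1 :> nat /\
    (inord d.2 : 'I_m.+1) = d.2 :> nat.
  by move=> /bw[b1 b2]; rewrite !inordK.
have wl d : d \in iword m w -> (d.2 < d.1)%N.
  by move=> /mapP[x xw ->]; have [-> ->] := inw _ xw; exact: wlow.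
have wc d : (count_mem d (iword m w) <
    (if slotq bc (@deg_ord F D m) (th bc (@deg_ord F D m)) d d == 1%R then p else 2))%N.
  rewrite (q_diagE _ bcP) count_map.
  have := wcount (d.1 : nat, d.2 : nat); rewrite pbarE; apply: leq_ltn_trans.
  apply/eq_leq/eq_in_count => x xw /=; have [x1 x2] := inw _ xw.
  apply/eqP/eqP => [<-|->] /=; first by rewrite x1 x2; case: (x).
  by rewrite !inord_val; case: (d).
have [_ _] := owords_lead (sv_ord D L (m := m)) bcP pchF wl wc.
by rewrite -ew e eqxx.
Qed.

Lemma evU_words (s : seq (F * seq rootpair)) : eventually (fun m =>
  forall a, evU m (\sum_(t <- s) uscal p chi (cgl D) t.1 * uwd t.2) (@vac F m) a =
    \sum_(t <- s) t.1 * owords bc (@deg_ord F D m) (sv_ord D L (m := m)) (iword m t.2) a /\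
  (forall t, t \in s -> forall d, d \in t.2 -> (d.1 <= m)%N /\ (d.2 <= m)%N)).
Proof.
elim: s => [|t s IHs].
  apply: eventuallyW evU_0 => m e a; rewrite !big_nil e op0E; split=> //.
pose g (t : F * seq rootpair) : U := uscal p chi (cgl D) t.1 * uwd t.2.
rewrite -/(g _) in IHs *; set Y := \sum_(t <- s) g t in IHs.
have -> : \sum_(t <- t :: s) g t = g t + Y by exact: big_cons.
pose X := g t; rewrite -/X.
have HX : eventually (fun m => forall a, evU m X (@vac F m) a =
    t.1 * owords bc (@deg_ord F D m) (sv_ord D L (m := m)) (iword m t.2) a /\
    forall d, d \in t.2 -> (d.1 <= m)%N /\ (d.2 <= m)%N).
  apply: (eventually2 _ (eventually2 (fun m => @conj _ _) (evU_M (uscal p chi (cgl D) t.1) (uwd t.2))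
    (evU_scal t.1)) (evU_word t.2)).
  by move=> m [eM eS] [bw ew] a; rewrite eM eS opME ew opZE.
apply: (eventually2 _ (evU_D X Y) (eventually2 (fun m => @conj _ _) HX IHs)).
move=> m eD [eX eY] a; have [x1 x2] := eX a; have [y1 y2] := eY a; rewrite eD opDE x1.
split; first by rewrite big_cons y1.
by move=> t'; rewrite inE => /orP[/eqP->|/y2].
Qed.

(** Compare coefficients at the exponent 0: the vacuum has coefficient 1 there, a word of nonzero
    height has coefficient 0. *)
Lemma tensor_words_neq (s : seq (F * seq rootpair)) :
  (forall t, t \in s -> \sum_(d <- t.2) ((d.2)%:Z - (d.1)%:Z) != 0) ->
  tens (\sum_(t <- s) uscal p chi (cgl D) t.1 * uwd t.2) v != tens 1 v.
Proof.
move=> hs; apply/eqP; have := evU_words s; set X := \sum_(_ <- _) _ => ews e.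
have e0 : tens (X - 1) v = 0.
  have h := tensorDl (@uchi_incl F D p chi (Bsub D) (cgl D)) (X - 1) 1 v.
  rewrite subrK e in h.
  exact: (addIr _ (etrans (esym h) (esym (add0r _)))).
have eD : eventually (fun m => evU m X = evU m (X - 1) + evU m 1).
  by apply: eventuallyW (evU_D (X - 1) 1) => m <-; rewrite subrK.
have [m [[e2 e3] [e4 e5]]] := eventually_ex (eventually2 (fun m => @conj _ _)
  (eventually2 (fun m => @conj _ _) eD evU_1)
  (eventually2 (fun m => @conj _ _) (tensor_eq0 e0) ews)).
have [sm bs] := e5 0; have : evU m X (@vac F m) 0 = 1.
  rewrite e2 opDE e4 e3; change (0 + @vac F m 0 = 1).
  by rewrite add0r /vac eqxx.
rewrite sm big_seq big1 => [/esym/eqP|t ts]; first by rewrite oner_eq0.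
apply/eqP; rewrite mulf_eq0; apply/orP; right; apply: contraT => nz.
have := owords_hgt0 nz; rewrite big_map => hh; case/eqP: (hs _ ts).
rewrite -[LHS]opprK -sumrN; apply/eqP; rewrite oppr_eq0; apply/eqP; rewrite -[RHS]hh.
rewrite big_seq [RHS]big_seq; apply: eq_bigr => d dt /=.
have [b1 b2] := bs _ ts _ dt; rewrite (@inordK m d.1 b1) (@inordK m d.2 b2).
exact: opprB.
Qed.

End Detection.

(** * FP triples *)

Section FPTriples.
Variables (F : fieldType) (p : nat) (D : colorSpace F) (n : nat) (s : seq rootpair).
Local Notation E := (Vsp D -> Vsp D).
Local Notation eij := (@eij F D).
Hypothesis FP : FP_triple D n s.

Lemma root_sum a b c : is_root_sum D n (a, b) (a, c) (c, b).
Proof. by move=> h _; rewrite /rootf /= addrA subrK. Qed.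

Lemma FP_pos (d : rootpair) : d \in s -> (d.1 < d.2)%N.
Proof. by case: FP => _ sP _ /sP[]. Qed.

Lemma FP_flipped i : (i < size s)%N ->
  positive_system D n (flipped s i) /\ simple_root D n (flipped s i) (nth (0, 0)%N s i).
Proof. by case: FP => _ _ /[apply] -[]. Qed.

(** The root d - b cannot lie in the positive system, since d = (d - b) + b would contradict
    simplicity. Totality then puts b - d there. *)
Lemma FP_simple i : (i < size s)%N -> simple_closed (flipped s i) (nth (0, 0)%N s i).
Proof.
move=> /FP_flipped[[Proot Ptot _ _]]; set d := nth _ _ _; case: d => i1 i2 [Pd simple].
have [/= dd b1 b2] := Proot _ Pd; case=> a1 a2 Pa /eqP ad; have [/= aa a3 a4] := Proot _ Pa.
split=> e /=; subst.
  have ne : a1 != i1 by apply: contra_notN ad => /eqP ->.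
  split; last by apply/eqP => -[_ e]; rewrite e eqxx in dd.
  have [//|P'] : flipped s i (a1, i1) \/ flipped s i (i1, a1) by apply: (Ptot (a1, i1)).
  by case: (simple _ _ P' Pa); exact: root_sum.
have ne : i2 != a2 by apply: contra_notN ad => /eqP ->.
split; last by apply/eqP => -[e _]; rewrite e eqxx in dd.
have [//|P'] : flipped s i (i2, a2) \/ flipped s i (a2, i2) by apply: (Ptot (i2, a2)).
by case: (simple _ _ Pa P'); exact: root_sum.
Qed.

(** By additivity the sum lies in the i-th system. Being positive it is not one of the negated
    roots, so it belongs to the tail. *)
Lemma FP_closed i : (i < size s)%N -> forall d1 d2 : rootpair,
  d1 \in drop i s -> d2 \in drop i s -> d1.2 = d2.1 -> (d1.1, d2.2) \in drop i s.
Proof.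
move=> /FP_flipped[[Proot _ _ Padd] _] [a b] [c d] s1 s2 /= e; subst c.
have P1 : flipped s i (a, b) by rewrite /flipped /= mem_cat s1 orbT.
have P2 : flipped s i (b, d) by rewrite /flipped /= mem_cat s2 orbT.
have [/= _ r1 _] := Proot _ P1; have [/= _ _ r2] := Proot _ P2.
have lt : (a < d)%N.
  by have := FP_pos (mem_drop s1); move/ltn_trans; apply; exact: (FP_pos (mem_drop s2)).
have r : is_root D n (a, d) by split=> //=; rewrite neq_ltn lt.
have := Padd _ _ _ P1 P2 r (@root_sum a d b).
rewrite /flipped /= mem_cat => /orP[|//] /mapP[[x y] /mem_take /FP_pos /= xy [e1 e2]].
by move: lt; rewrite e1 e2 ltnNge ltnW.
Qed.

Definition inside : pred nat := fun k => (blk D k < n)%N.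

Lemma inside_down a b : (a <= b)%N -> inside b -> inside a.
Proof. by move=> ab; apply: leq_ltn_trans (blk_mono D ab). Qed.

Lemma FP_complete (d : rootpair) : (d.1 < d.2)%N -> inside d.2 -> d \in s.
Proof.
case: FP => _ sP _ dd id2; apply/sP; split=> //; split=> //; first by rewrite neq_ltn dd.
exact: inside_down (ltnW dd) id2.
Qed.

Lemma FP_inside (d : rootpair) : d \in s -> inside d.2.
Proof. by case: FP => _ sP _ /sP[[]]. Qed.

Variable lam : E -> F.
Hypothesis lam_lin : linear_on (Hsub D) lam.

Definition even_root (d : rootpair) : bool := `[< gammaP D (edeg D d.1 d.2) >].

Lemma Hsub_eij k : Hsub D (eij k k).
Proof. by apply: lspan_in; exists k. Qed.

Lemma lam_shiftE i h :
  lam_shift p lam s i h = lam h - \sum_(d <- take i s) rootf d h *+ (pbar D p d).-1.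
Proof.
rewrite /lam_shift -[LHS]/(lam h - (\sum_(d <- take i s) rootf d *+ (pbar D p d).-1) h).
congr (_ - _); elim: (take i s) => [|d r IHr]; first by rewrite !big_nil.
rewrite !big_cons -IHr -[LHS]/((rootf d *+ (pbar D p d).-1) h + _); congr (_ + _).
elim: (pbar D p d).-1 => [//|k IHk]; rewrite !mulrSr -IHk; by [].
Qed.

Lemma rootf_eij (d : rootpair) k : rootf d (eij k k) = (k == d.1)%:R - (k == d.2)%:R.
Proof.
have e i : eps i (eij k k) = (k == i)%:R.
  by rewrite -[LHS]/(ent (eij k k) i i) ent_eij (eq_sym i) -natrM mulnb andbb.
by rewrite /rootf !e.
Qed.

Lemma rootfD (d : rootpair) c x y : rootf d (c *: x + y : E) = c * rootf d x + rootf d y.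
Proof.
have e i : eps i (c *: x + y : E) = c * eps i x + eps i y.
  by rewrite -![eps i _]/(ent _ i i) entD entZ.
by rewrite /rootf !e mulrBr opprD addrACA.
Qed.

Lemma lam_shift_eij i k :
  lam_shift p lam s i (eij k k) = shift (pbar D p) (fun k => lam (eij k k)) (take i s) k.
Proof. by rewrite lam_shiftE /shift; under eq_bigr => d _ do rewrite rootf_eij. Qed.

Lemma lam_shiftD i c x y : Hsub D x -> Hsub D y ->
  lam_shift p lam s i (c *: x + y) = c * lam_shift p lam s i x + lam_shift p lam s i y.
Proof.
move=> hx hy; rewrite !lam_shiftE lam_lin //.
under eq_bigr => d _ do rewrite rootfD mulrnDl -mulrnAr.
by rewrite big_split /= -mulr_sumr opprD addrACA mulrBr.
Qed.

Lemma lam_shift_Hroot i (d : rootpair) : lam_shift p lam s i (Hroot d) =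
  Hval even_root (shift (pbar D p) (fun k => lam (eij k k)) (take i s)) d.
Proof.
rewrite /Hroot /Hval -!lam_shift_eij /even_root; case: ifP => _.
  by rewrite addrC -scaleN1r lam_shiftD ?mulN1r 1?addrC //; exact: Hsub_eij.
by rewrite -[eij d.1 d.1]scale1r lam_shiftD ?mul1r ?scale1r //; exact: Hsub_eij.
Qed.

Lemma fpoly_neq0 : fpoly p lam s != 0 <-> forall i, (i < size s)%N ->
  factor (pbar D p) even_root s (fun k => lam (eij k k)) i != 0.
Proof.
have e i : (let d := nth (0, 0)%N s i in
    (lam_shift p lam s i (Hroot d) + 1) ^+ (pbar D p d).-1 - 1) =
    factor (pbar D p) even_root s (fun k => lam (eij k k)) i.
  by rewrite /factor lam_shift_Hroot.
split=> [/prodf_neq0 h i lti|h]; first by rewrite -e; exact: (h (Ordinal lti)).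
by apply/prodf_neq0 => i _; rewrite e h.
Qed.

End FPTriples.

Section FreeAlgebra.
Variables (F : fieldType) (I : choiceType).

(** An alias of the free algebra with the structure of an F-algebra, so that it can be a target of
    [fev]. *)
Definition falg : Type := {malg F[{fmonom I}]}.
HB.instance Definition _ := GRing.Lalgebra.on falg.

Lemma falg_scaleAr a (x y : falg) : a *: (x * y) = x * (a *: y).
Proof.
have one : (1 : falg) = << mone >> by [].
have comm (t : falg) : t * (a *: 1) = a *: t.
  rewrite [t in LHS]monalgE [t in RHS]monalgE mulr_suml scaler_sumr.
  by apply: eq_bigr => k _; rewrite one !malgZU malgUU mulr1 mulrC mulm1.
by rewrite -(comm y) mulrA comm.
Qed.
HB.instance Definition _ := GRing.Lalgebra_isAlgebra.Build F falg falg_scaleAr.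

End FreeAlgebra.

(** * Functoriality of the reduced enveloping algebra *)

Section Inclusion.
Variables (F : fieldType) (D : colorSpace F) (p : nat).
Local Notation E := (Vsp D -> Vsp D).
Variables (chi : E -> F) (S S' : set E).
Hypothesis SS : S `<=` S'.

Definition widen (r : S) : S' := SigSub (mem_set (SS (set_valP r))).
Local Notation wgen := (fun r : S => gen (widen r) : falg F S').
Definition wfree (t : freealg S) : freealg S' := fev wgen t.

Lemma wfreeM x y : wfree (x * y) = wfree x * wfree y.
Proof. exact: (fevM wgen). Qed.
Lemma wfreeX x n : wfree (x ^+ n) = wfree x ^+ n.
Proof. exact: (fevX wgen). Qed.
Lemma wfree1 : wfree 1 = 1.
Proof. exact: (fev1 wgen). Qed.
Lemma wfreeB x y : wfree (x - y) = wfree x - wfree y.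
Proof. exact: (linearB (fev wgen)). Qed.
Lemma wfreeD x y : wfree (x + y) = wfree x + wfree y.
Proof. exact: (linearD (fev wgen)). Qed.
Lemma wfreeZ a x : wfree (a *: x) = a *: wfree x.
Proof. exact: (linearZ_LR (fev wgen) a x). Qed.
Lemma wfree0 : wfree 0 = 0.
Proof. exact: (linear0 (fev wgen)). Qed.
Lemma wfree_gen r : wfree (gen r) = gen (widen r).
Proof. exact: (fev_gen wgen). Qed.

Lemma wfree_rel t : urel p chi t -> gen_ideal2 (urel p chi (S := S')) (wfree t).
Proof.
case=> {t} [a x y z e|g h x y z gx hy e|g x z gg gx e]; apply: gen_ideal2R.
- suff -> : wfree (gen z - (a *: gen x + gen y)) =
      gen (widen z) - (a *: gen (widen x) + gen (widen y)) by exact: urel_lin.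
  rewrite wfreeB wfree_gen; congr (_ - _); rewrite [LHS]wfreeD; congr (_ + _).
    by rewrite [LHS]wfreeZ; congr (_ *: _); exact: wfree_gen.
  exact: wfree_gen.
- suff -> : wfree (gen x * gen y - bichar g h *: (gen y * gen x) - gen z) =
      gen (widen x) * gen (widen y) - bichar g h *: (gen (widen y) * gen (widen x))
        - gen (widen z) by exact: urel_bracket.
  rewrite wfreeB; congr (_ - _); last exact: wfree_gen.
  rewrite [LHS]wfreeB; congr (_ - _).
    by rewrite [LHS]wfreeM; congr (_ * _); exact: wfree_gen.
  rewrite [LHS]wfreeZ; congr (_ *: _).
  by rewrite [LHS]wfreeM; congr (_ * _); exact: wfree_gen.
- suff -> : wfree (gen x ^+ p - gen z - (chi (val x) ^+ p) *: 1) =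
      gen (widen x) ^+ p - gen (widen z) - (chi (val (widen x)) ^+ p) *: 1.
    exact: (@urel_power _ _ _ _ _ g (widen x) (widen z)).
  rewrite wfreeB; congr (_ - _); last by rewrite [LHS]wfreeZ wfree1.
  rewrite [LHS]wfreeB; congr (_ - _); last exact: wfree_gen.
  exact: etrans (wfreeX (gen x) p) (congr1 (fun t => t ^+ p) (wfree_gen x)).
Qed.

Lemma wfree_ideal t : gen_ideal2 (urel p chi (S := S)) t ->
  gen_ideal2 (urel p chi (S := S')) (wfree t).
Proof.
have id0 : is_ideal2 (fun t => gen_ideal2 (urel p chi (S := S')) (wfree t)).
  split; first split.
  - by rewrite wfree0; exact: (rpred0 (gen_ideal2_zmod _)).
  - by move=> x y Ix Iy; rewrite wfreeB; exact: (gen_ideal2_closed _).2 Ix Iy.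
  - by move=> a x Ix; rewrite wfreeM; exact: gen_ideal2Ml.
  - by move=> a x Ix; rewrite wfreeM; exact: gen_ideal2Mr.
exact: (gen_ideal2_ind id0 wfree_rel).
Qed.

Lemma uchi_inclE (u : uchi p chi S) : uchi_incl S' u = upi p chi (wfree (qrepr u)).
Proof.
rewrite /uchi_incl /wfree /fev (big_morph _ (upiD p chi (S := S')) (upi0 p chi S')).
apply: eq_bigr => k _; apply: etrans _ (esym (uscalZ p chi _ _)); congr (_ * _).
elim: (k : seq S) => [|r l IHl]; first by rewrite !big_nil upi1.
rewrite !big_cons; apply: etrans _ (esym (upiM p chi _ _)); rewrite -IHl; congr (_ * _).
exact: (uin_val p chi (widen r)).
Qed.

(** [uchi_incl] is computed on a chosen representative. Another choice differs by an element of the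
    ideal, which [wfree] maps into the ideal of the larger algebra. *)
Lemma uchi_incl_upi t : uchi_incl S' (upi p chi t) = upi p chi (wfree t).
Proof.
rewrite uchi_inclE; apply/qpi_eqP; rewrite -wfreeB; apply: wfree_ideal.
by apply/qpi_eqP; rewrite qreprK.
Qed.

Lemma uchi_incl_uin x : S x -> uchi_incl S' (uin p chi S x) = uin p chi S' x.
Proof.
move=> /mem_set Sx; rewrite (uinE p chi Sx) uchi_incl_upi wfree_gen.
exact: esym (uin_val p chi (widen (SigSub Sx))).
Qed.

Lemma uchi_incl_scal a : uchi_incl S' (uscal p chi S a) = uscal p chi S' a.
Proof. by rewrite uscalE uchi_incl_upi wfreeZ wfree1. Qed.

End Inclusion.

(** * The criterion in terms of root operators *)

Section Criterion.
Variables (F : fieldType) (p : nat) (D : colorSpace F) (delta : nat -> seq rootpair).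
Variable lam : (Vsp D -> Vsp D) -> F.
Hypothesis pchF : p \in [pchar F].
Hypothesis FP : forall n, (0 < n)%N -> FP_triple D n (delta n).
Hypothesis lam_lin : linear_on (Hsub D) lam.
Local Notation q := (fun d d' : rootpair => bichar (edeg D d.1 d.2) (edeg D d'.1 d'.2)).
Local Notation pb := (pbar D p).
Local Notation L := (fun k => lam (@eij F D k k)).
Variables (Z : lmodType F) (E : rootpair -> {linear Z -> Z}) (v : Z).
Hypothesis E_bracket : forall a b i j (z : Z),
  E (a, b) (E (i, j) z) = q (a, b) (i, j) *: E (i, j) (E (a, b) z)
    + (b == i)%:R *: E (a, j) z - (q (a, b) (i, j) * (j == a)%:R) *: E (i, b) z.
Hypothesis E_nilp : forall (d : rootpair) (z : Z), d.1 != d.2 -> iter (pb d) (E d) z = 0.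
Hypothesis v_kills : forall d : rootpair, (d.1 < d.2)%N -> E d v = 0.
Hypothesis v_weight : weight E L v.
Hypothesis v_free : forall w : seq rootpair, (forall d, d \in w -> lower d) ->
  (forall d, (count_mem d w < pb d)%N) -> act E w v != 0.
Hypothesis v_Below : ~ Below E v (-1) v.
Hypothesis v_gen : forall z, Gen E [set: rootpair] (line v) z.

Let bcP := bicharP D.
Let pb_gt0 d : (0 < pb d)%N.
Proof. by rewrite pbarE; case: ifP => // _; exact/prime_gt0/(pcharf_prime pchF). Qed.
Let pbE d : pb d = if even_root D d then p else 2%N.
Proof. by []. Qed.
Let edeg_opp i j : edeg D j i = - edeg D i j.
Proof. by rewrite /edeg opprB. Qed.
Let even_ropp d : even_root D (ropp d) = even_root D d.
Proof.
rewrite /even_root edeg_opp /gammaP /=; apply/asboolP/asboolP => /=;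
  by rewrite (bcNl bcP) (bcNr bcP) invrK.
Qed.
Let q_nz (d1 d2 : rootpair) : q d1 d2 != 0.
Proof. exact: bc_neq0. Qed.
Let q_ropp (d : rootpair) : q d (ropp d) = if even_root D d then 1 else -1.
Proof.
rewrite /= (edeg_opp d.1 d.2) (bcNr bcP) /even_root; case: asboolP => [->|ne]; first exact: invr1.
by have [//|->] := bc_sign bcP (edeg D d.1 d.2); rewrite invrN1.
Qed.
Let q_diag k (d : rootpair) : q (k, k) d = 1.
Proof. by rewrite /= /edeg subrr (bc0l bcP). Qed.

Lemma v_low z : Gen E lower (line v) z.
Proof.
move: z (v_gen z); apply: Gen_sub.
- by split; [apply: Gen_in; exists 0; rewrite scale0r | exact: Gen_D | exact: Gen_Z].
- by move=> x; exact: Gen_in.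
move=> d z _ Gz; apply: (Low_stable (q := q) E_bracket _ _ _ Gz); first exact: line_subspace.
move=> [i j] x /= ij [c ->]; rewrite linearZ /=.
move: ij; rewrite leq_eqVlt => /orP[/eqP->|lt].
  by rewrite v_weight scalerA; exists (c * L j).
by rewrite v_kills // scaler0; exists 0; rewrite scale0r.
Qed.

Lemma Gen_mono (P P' : set rootpair) (X : set Z) z : P `<=` P' -> Gen E P X z -> Gen E P' X z.
Proof.
move=> PP; elim=> {z} [z Xz|d z Pd _|y z _ Gy _ Gz|a z _].
- exact: Gen_in.
- by apply: Gen_E; exact: PP.
- exact: Gen_D.
- exact: Gen_Z.
Qed.

(** An expression of [z] uses finitely many lowering vectors, and the root sets of the g_n are
    nested, so some n contains them all. *)
Lemma Gen_delta z : exists2 n, (0 < n)%N &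
  Gen E [set d | d \in [seq ropp d | d <- delta n]] (line v) z.
Proof.
have mono m n : (0 < m)%N -> (m <= n)%N -> [set d | d \in [seq ropp d | d <- delta m]] `<=`
    [set d | d \in [seq ropp d | d <- delta n]].
  move=> m0 mn _ /= /mapP[d ds ->]; apply: map_f; have fm := FP m0.
  apply: (FP_complete (FP (leq_trans m0 mn)) (FP_pos fm ds)).
  exact: leq_trans (FP_inside fm ds) mn.
elim: (v_low z) => {z} [z lz|[i j] z /= ij _ [n n0 Gz]|y z _ [n n0 Gy] _ [n' n'0 Gz]|a z _ [n n0 Gz]].
- by exists 1%N => //; exact: Gen_in.
(* The successor is there because g_n consists of the blocks with index strictly below n, counted
   from 0. *)
- have n1 : (0 < maxn n (blk D i).+1)%N by rewrite leq_max n0.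
  exists (maxn n (blk D i).+1) => //; apply: Gen_E.
    rewrite -[(i, j)]/(ropp (j, i)) /=; apply: map_f.
    by apply: (FP_complete (FP n1)); rewrite //= /inside leq_max leqnn orbT.
  by apply: Gen_mono Gz; apply: mono => //; exact: leq_maxl.
- exists (maxn n n'); first by rewrite leq_max n0.
  by apply: Gen_D; [apply: Gen_mono Gy | apply: Gen_mono Gz]; apply: mono => //;
    rewrite ?leq_maxl ?leq_maxr.
- by exists n => //; exact: Gen_Z.
Qed.

Lemma fpoly_Span z : (forall n, (0 < n)%N -> fpoly p lam (delta n) != 0) ->
  z != 0 -> Span E z v.
Proof.
move=> fn nz; have [n n0 Gz] := Gen_delta z.
have fs := (fpoly_neq0 p (delta n) lam_lin).1 (fn n n0).
exact: (factor_neq0 (q := q) E_bracket E_nilp pb_gt0 pchF pbE even_ropp q_nz q_ropp q_diag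
  (let: And3 u _ _ := FP n0 in u) (FP_pos (FP n0)) (FP_simple (FP n0)) (FP_closed (FP n0))
  v_kills v_weight v_free fs Gz nz).
Qed.

Lemma fpoly_notSpan n : (0 < n)%N -> fpoly p lam (delta n) = 0 ->
  exists2 s : seq rootpair, flips E pb s v != 0 & ~ Span E (flips E pb s v) v.
Proof.
move=> n0 f0; have us : uniq (delta n) by case: (FP n0).
have [i lti fi] : exists2 i, (i < size (delta n))%N &
    factor pb (even_root D) (delta n) L i = 0.
  apply: contrapT => nf; have : fpoly p lam (delta n) != 0; last by rewrite f0 eqxx.
  apply/(fpoly_neq0 p (delta n) lam_lin) => i lti; apply/eqP => fi.
  by apply: nf; exists i.
exists (take i.+1 (delta n)); last first.
  move=> sp; apply: v_Below.
  exact: (factor_zero (q := q) E_bracket E_nilp pb_gt0 pchF pbE even_ropp q_ropp q_diag us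
    (FP_pos (FP n0)) (FP_simple (FP n0)) (FP_closed (FP n0)) v_kills v_weight
    (@inside_down _ D n) (FP_complete (FP n0)) (FP_inside (FP n0)) lti fi sp).
rewrite (flips_top _ pbE even_ropp) top_act; apply: v_free => [d|d].
  move=> /flattenP[w]; rewrite mem_rev => /mapP[e /mapP[e' /mem_take /(FP_pos (FP n0)) ee ->] ->].
  by rewrite mem_nseq => /andP[_ /eqP->].
by apply: count_top => //; rewrite map_inj_uniq ?take_uniq //; exact: ropp_inj.
Qed.

End Criterion.

(** * The baby Verma module *)

Section Restriction.
Variables (F : fieldType) (p : nat) (D : colorSpace F).
Local Notation V := (Vsp D).
Variable chi : (V -> V) -> F.
Local Notation U := (uchi p chi (cgl D)).
Local Notation uin := (uin p chi (cgl D)).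
Local Notation uscal := (uscal p chi (cgl D)).
Local Notation eij := (@eij F D).
Variable W : lmodType U.
Implicit Types (u : U) (h : V -> V).

(* [W] with its scalars restricted to F along [uscal]. *)
Definition resF : Type := W.
HB.instance Definition _ := GRing.Zmodule.on resF.

Definition uact u (z : resF) : resF := u *: (z : W).

Lemma uactM u u' z : uact (u * u') z = uact u (uact u' z).
Proof. exact: esym (@scalerA U W u u' z). Qed.
Lemma uact1 z : uact 1 z = z.
Proof. exact: (@scale1r U W z). Qed.
Lemma uactDr u z z' : uact u (z + z') = uact u z + uact u z'.
Proof. exact: (@scalerDr U W u z z'). Qed.
Lemma uactDl u u' z : uact (u + u') z = uact u z + uact u' z.
Proof. exact: (@scalerDl U W z u u'). Qed.
Lemma uact0 z : uact 0 z = 0.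
Proof. exact: (@scale0r U W z). Qed.

Definition vscale a (z : resF) : resF := uact (uscal a) z.

Lemma vscaleA a b z : vscale a (vscale b z) = vscale (a * b) z.
Proof.
exact: etrans (esym (uactM _ _ z)) (congr1 (uact^~ z) (esym (uscalM p chi _ a b))).
Qed.
Lemma vscale1 : left_id 1 vscale.
Proof. by move=> z; exact: etrans (congr1 (uact^~ z) (uscal1 p chi _)) (uact1 z). Qed.
Lemma vscaleDr : right_distributive vscale +%R.
Proof. by move=> a z z'; exact: uactDr. Qed.
Lemma vscaleDl z : {morph vscale^~ z : a b / a + b}.
Proof.
move=> a b; apply: etrans (congr1 (uact^~ z) (uscalD p chi _ a b)) _.
exact: (uactDl (uscal a) (uscal b) z).
Qed.
HB.instance Definition _ :=
  GRing.Zmodule_isLmodule.Build F resF vscaleA vscale1 vscaleDr vscaleDl.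

Lemma uact_scal a z : uact (uscal a) z = a *: z.
Proof. by []. Qed.

Lemma uactS a u z : uact (uscal a * u) z = a *: uact u z.
Proof. exact: uactM. Qed.

Lemma uact_linear u : linear (uact u).
Proof.
move=> a x y; apply: etrans (uactDr u (a *: x) y) _; congr (_ + _).
apply: etrans (esym (uactM u (uscal a) x)) (etrans _ (uactM (uscal a) u x)).
exact: (congr1 (uact^~ x) (uscal_comm a u)).
Qed.
HB.instance Definition _ u := GRing.isLinear.Build F resF resF *:%R (uact u) (uact_linear u).

Definition rootE (d : rootpair) : {linear resF -> resF} := uact (uin (eij d.1 d.2)).

Lemma uin0 : uin 0 = 0.
Proof.
have e0 : (0 : V -> V) = 1 *: 0 + 0 by rewrite scaler0 addr0.
have := uin_lin p chi (cgl0 D) (cgl0 D) (cgl0 D) e0.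
rewrite uscal1 mul1r => /eqP.
by rewrite -subr_eq subrr => /eqP.
Qed.

Lemma uact_uin_comb a h h' z : cgl D h -> cgl D h' ->
  uact (uin (a *: h + h')) z = a *: uact (uin h) z + uact (uin h') z.
Proof.
move=> ch ch'; have cc : cgl D (a *: h + h') by apply: cglD => //; exact: cglZ.
by rewrite (uin_lin p chi ch ch' cc erefl) uactDl uactM.
Qed.

Lemma uact_uinZ a h z : cgl D h -> uact (uin (a *: h)) z = a *: uact (uin h) z.
Proof.
by move=> ch; rewrite -[a *: h]addr0 (uact_uin_comb _ _ ch (cgl0 D)) uin0 uact0 addr0.
Qed.

Lemma uact_uin_sum (I : Type) (r : seq I) (c : I -> F) (h : I -> V -> V) z :
  (forall i, cgl D (h i)) ->
  uact (uin (\sum_(i <- r) c i *: h i)) z = \sum_(i <- r) c i *: uact (uin (h i)) z.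
Proof.
move=> ch; elim: r => [|i r IHr]; first by rewrite !big_nil uin0 uact0.
rewrite !big_cons uact_uin_comb ?IHr //.
by apply: cgl_sum => j _; exact: cglZ.
Qed.

Lemma eij_comp a b i j : eij a b \o eij i j = (b == i)%:R *: eij a j.
Proof. by apply/funext => x; rewrite /Defs.eij /= crdZ crd_vb mulrC -scalerA. Qed.

Lemma resF_bracket a b i j (z : resF) : rootE (a, b) (rootE (i, j) z) =
  bichar (edeg D a b) (edeg D i j) *: rootE (i, j) (rootE (a, b) z)
  + (b == i)%:R *: rootE (a, j) z
  - (bichar (edeg D a b) (edeg D i j) * (j == a)%:R) *: rootE (i, b) z.
Proof.
have e : cbracket (edeg D a b) (edeg D i j) (eij a b) (eij i j) =
    (b == i)%:R *: eij a j + - (bichar (edeg D a b) (edeg D i j) * (j == a)%:R) *: eij i b.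
  by rewrite /cbracket !eij_comp scalerA scaleNr.
have cc : cgl D ((b == i)%:R *: eij a j +
    - (bichar (edeg D a b) (edeg D i j) * (j == a)%:R) *: eij i b).
  by apply: cglD; apply/cglZ/cgl_eij.
have eU := uin_bracket p chi (cgl_eij D a b) (cgl_eij D i j) cc
  (glhom_eij D a b) (glhom_eij D i j) (esym e).
apply: etrans (esym (uactM _ _ z)) (etrans (congr1 (uact^~ z) eU) _).
apply: etrans (uactDl _ _ z) _; rewrite -[RHS]addrA; congr (_ + _).
  exact: etrans (uactS _ _ z) (congr1 ( *:%R _) (uactM _ _ z)).
apply: etrans (uact_uin_comb _ _ _ _) _; [exact: cgl_eij | exact/cglZ/cgl_eij |].
by congr (_ + _); rewrite -scaleNr; apply: uact_uinZ; exact: cgl_eij.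
Qed.

Lemma iter_rootE k d z : iter k (rootE d) z = uact (uin (eij d.1 d.2) ^+ k) z.
Proof. by elim: k => [|k IHk]; rewrite ?uact1 //= IHk exprS uactM. Qed.

Lemma act_uact (w : seq rootpair) z :
  act rootE w z = uact (\prod_(d <- w) uin (eij d.1 d.2)) z.
Proof.
elim: w => [|d w IHw]; first by rewrite big_nil uact1.
by rewrite big_cons uactM -IHw.
Qed.

Hypothesis pchF : p \in [pchar F].
Hypothesis p_gt3 : (3 < p)%N.
Hypothesis chi_std : standard_semisimple chi.

(** For an even root both e^[p] and chi(e) vanish. For an odd root the exchange rule of e with
    itself reads e^2 = -e^2, and 2 is invertible. *)
Lemma resF_nilp (d : rootpair) z : d.1 != d.2 -> iter (pbar D p d) (rootE d) z = 0.
Proof.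
move=> dd; rewrite pbarE; case: eqP => [gg|ng].
  have z0 : 0 = iter p (comp (eij d.1 d.2)) id.
    case: p p_gt3 => [//|[//|k]] _; rewrite !iterS compA.
    have -> : eij d.1 d.2 \o eij d.1 d.2 = 0 by rewrite eij_comp eq_sym (negPf dd) scale0r.
    by apply/funext.
  have eU := uin_power chi (cgl_eij D d.1 d.2) (cgl0 D) gg (glhom_eij D d.1 d.2) z0.
  apply: etrans (iter_rootE _ _ _) (etrans (congr1 (uact^~ z) eU) _).
  apply: etrans (uactDl _ _ z) _; rewrite uin0 uact0 add0r uact_scal (chi_eij chi_std dd).
  by rewrite expr0n gtn_eqF ?scale0r // (ltn_trans _ p_gt3).
case: d dd ng => i j /= dd ng; have := resF_bracket i j i j z.
rewrite eq_sym in dd; rewrite (negPf dd) mulr0 !scale0r addr0 subr0.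
have [//|->] := bc_sign (bicharP D) (edeg D i j).
set y := rootE (i, j) _; rewrite scaleN1r => /eqP; rewrite -addr_eq0 -mulr2n -scaler_nat.
rewrite scaler_eq0 => /orP[|/eqP //]; rewrite -(dvdn_pcharf pchF) => /dvdn_leq.
by move=> /(_ isT); rewrite leqNgt (ltn_trans _ p_gt3).
Qed.

(** Elements of cgl(V) are finite combinations of matrix units and words in them span the algebra,
    so stability under root operators and Cartan elements is enough for a submodule. *)
Lemma uact_closed (X : set resF) : subspace X ->
  (forall d z, X z -> X (rootE d z)) -> forall u z, X z -> X (uact u z).
Proof.
move=> sX EX u z Xz; have [X0 XD XZ] := sX.
have uX h y : cgl D h -> X y -> X (uact (uin h) y).
  move=> ch Xy; have [m bm] := cgl_bounded ch.
  rewrite (bounded_sum (cgl_linear ch) bm) -(eq_bigr _ (fun k _ => scale1r _)).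
  rewrite uact_uin_sum => [|k]; last by apply: cgl_sum => l _; exact/cglZ/cgl_eij.
  apply: subspace_sum => // k _; apply/XZ.
  rewrite uact_uin_sum => [|l]; last exact: cgl_eij.
  by apply: subspace_sum => // l _; apply/XZ; exact: (EX (k : nat, l : nat)).
rewrite -(upi_repr u) upi_span; elim: (enum_fset _) => [|k r IHr].
  by rewrite big_nil uact0.
rewrite big_cons uactDl; apply: (XD _ _ _ IHr); apply: (eq_ind_r X _ (uactS _ _ z)); apply/XZ.
rewrite /uword; elim: (k : seq (cgl D)) => [|x l IHl]; first by rewrite big_nil uact1.
by rewrite /= big_cons uactM; apply: uX => //; exact: set_valP.
Qed.

End Restriction.

Section HighestWeight.
Variables (F : fieldType) (p : nat) (D : colorSpace F).
Local Notation V := (Vsp D).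
Variable chi : (V -> V) -> F.
Local Notation U := (uchi p chi (cgl D)).
Local Notation eij := (@eij F D).
Variables (Mo : lmodType (uchi p chi (Bsub D))) (v : Mo) (lam : (V -> V) -> F).
Hypothesis pchF : p \in [pchar F].
Hypothesis chi_lin : linear_on (cgl D) chi.
Hypothesis chi_std : standard_semisimple chi.
Hypothesis v0 : v != 0.
Hypothesis v_gen : forall w : Mo, exists a : F, w = fscale a v.
Hypothesis N_v : forall x, Nplus D x -> uin p chi (Bsub D) x *: v = 0.
Hypothesis lam_lin : linear_on (Hsub D) lam.
Hypothesis H_v : forall x, Hsub D x -> uin p chi (Bsub D) x *: v = fscale (lam x) v.
Local Notation L := (fun k => lam (eij k k)).
Local Notation incl := (@uchi_incl F D p chi (Bsub D) (cgl D)).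
Local Notation Z := (resF (babyVerma Mo)).

Lemma Hsub_Bsub x : Hsub D x -> Bsub D x.
Proof. by move=> hx; exists x => //; exists 0; rewrite ?addr0 //; exists [::]; rewrite big_nil. Qed.

Lemma Nplus_Bsub x : Nplus D x -> Bsub D x.
Proof. by move=> nx; exists 0; [exists [::]; rewrite big_nil | exists x; rewrite ?add0r]. Qed.

Lemma Bsub_cgl : Bsub D `<=` cgl D.
Proof.
move=> _ [h /Hsub_sum[s ->] [n /Nplus_sum[t _ ->] <-]].
by apply: cglD; apply: cgl_sum => ? _; exact/cglZ/cgl_eij.
Qed.

(** Apply the p-th power relation of e_kk, which has degree 0 and satisfies e_kk^[p] = e_kk, to the
    vector [v]. *)
Lemma lam_pow k : L k ^+ p - L k = chi (eij k k) ^+ p.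
Proof.
have hk : Hsub D (eij k k) by exact: Hsub_eij.
have Bk := Hsub_Bsub hk.
have g0 : gammaP D (edeg D k k) by rewrite /gammaP /= /edeg subrr (bc0l (bicharP D)).
have ek n : iter n.+1 (comp (eij k k)) id = eij k k.
  by elim: n => [|n IHn] //; rewrite iterS IHn eij_comp eqxx scale1r.
have ez : eij k k = iter p (comp (eij k k)) id.
  by have := prime_gt0 (pcharf_prime pchF); case: p => // n _; rewrite ek.
have pow n : uin p chi (Bsub D) (eij k k) ^+ n *: v = fscale (L k ^+ n) v.
  elim: n => [|n IHn]; first exact: etrans (scale1r v) (esym (fscale1 v)).
  apply: etrans (congr1 ( *:%R^~ v) (exprS _ n)) _; apply: etrans (esym (scalerA _ _ v)) _.
  rewrite IHn; apply: etrans (scaler_fscale _ _ _) _; rewrite (H_v hk).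
  rewrite exprSr; exact: esym (fscaleM _ _ v).
have eU := uin_power chi Bk Bk g0 (glhom_eij D k k) ez.
have : fscale (L k ^+ p) v = fscale (L k + chi (eij k k) ^+ p) v.
  apply: etrans (esym (pow p)) (etrans (congr1 ( *:%R^~ v) eU) _).
  apply: etrans (scalerDl v _ _) _; rewrite (H_v hk).
  exact: esym (fscaleD _ _ v).
by move/(fscale_inj v0) => ->; rewrite addrAC subrr add0r.
Qed.

Definition hwv : Z := tensor incl 1 v.

Lemma uact_hwv u : uact u hwv = tensor incl u v.
Proof. by apply: etrans (ext_scale_tensor _ _ _ _) _; rewrite mulr1. Qed.

Lemma uact_incl b : uact (incl b) hwv = tensor incl 1 (b *: v).
Proof.
rewrite uact_hwv; apply: etrans _ (tensorZ incl 1 b v).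
exact: (congr1 (fun u => tensor incl u v) (esym (mul1r _))).
Qed.

Lemma hwv_N x : Nplus D x -> uact (uin p chi (cgl D) x) hwv = 0.
Proof.
move=> nx; rewrite -(uchi_incl_uin p chi Bsub_cgl (Nplus_Bsub nx)) uact_incl (N_v nx).
by apply: (addrI (tensor incl 1 0)); rewrite -tensorDr !addr0.
Qed.

Lemma hwv_H x : Hsub D x -> uact (uin p chi (cgl D) x) hwv = lam x *: hwv.
Proof.
move=> hx; rewrite -(uchi_incl_uin p chi Bsub_cgl (Hsub_Bsub hx)) uact_incl (H_v hx).
have e : uact (incl (uscal p chi (Bsub D) (lam x))) hwv = lam x *: hwv.
  by rewrite (uchi_incl_scal p chi Bsub_cgl).
by rewrite -e uact_incl.
Qed.

Lemma hwv_gen (z : Z) : Gen (@rootE F p D chi (babyVerma Mo)) [set: rootpair] (line hwv) z.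
Proof.
have sG : subspace (Gen (@rootE F p D chi (babyVerma Mo)) [set: rootpair] (line hwv)).
  by split; [apply: Gen_in; exists 0; rewrite scale0r | exact: Gen_D | exact: Gen_Z].
have cl := uact_closed sG (fun d z => @Gen_E _ _ _ _ _ d z I).
have [G0 GD GZ] := sG.
have GB (x y : Z) : Gen (@rootE F p D chi (babyVerma Mo)) [set: rootpair] (line hwv) x ->
    Gen (@rootE F p D chi (babyVerma Mo)) [set: rootpair] (line hwv) y ->
    Gen (@rootE F p D chi (babyVerma Mo)) [set: rootpair] (line hwv) (x - y).
  by move=> Gx Gy; rewrite -scaleN1r; exact: (GD _ _ Gx (GZ (-1) _ Gy)).
apply: (tensor_ind (conj G0 GB) _ z) => u w; have [a ->] := v_gen w.
have -> : tensor incl u (fscale a v) = uact (u * incl (uscal p chi (Bsub D) a)) hwv.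
  by rewrite uact_hwv; exact: esym (tensorZ incl u _ v).
by apply: cl; exact/Gen_in/line_id.
Qed.

Lemma act_hwv (w : seq rootpair) : act (@rootE F p D chi (babyVerma Mo)) w hwv =
  tensor incl (\prod_(d <- w) uin p chi (cgl D) (eij d.1 d.2)) v.
Proof. by rewrite act_uact uact_hwv. Qed.

Lemma hwv_free (w : seq rootpair) : (forall d, d \in w -> lower d) ->
  (forall d, (count_mem d w < pbar D p d)%N) ->
  act (@rootE F p D chi (babyVerma Mo)) w hwv != 0.
Proof.
move=> wl wc; rewrite act_hwv.
exact: (tensor_word_neq0 pchF chi_lin chi_std lam_pow v0 v_gen N_v lam_lin H_v
  (fun k => erefl) wl wc).
Qed.

Lemma hwv_Below : ~ Below (@rootE F p D chi (babyVerma Mo)) hwv (-1) hwv.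
Proof.
case=> t tb e.
have := tensor_words_neq pchF chi_lin chi_std lam_pow v0 v_gen N_v lam_lin H_v
  (fun k => erefl) (s := t).
case/(_ _)/eqP => [u ut|].
  by apply: contraTneq (tb _ ut); rewrite /ht => ->.
apply: etrans (esym (uact_hwv _)) (etrans _ (uact_hwv 1)); rewrite uact1 [RHS]e.
have mD (a b : U) : uact (a + b) hwv = uact a hwv + uact b hwv := uactDl a b hwv.
rewrite (big_morph _ mD (uact0 hwv)); apply: eq_bigr => u _.
by apply: etrans (uactS _ _ _) _; rewrite act_uact.
Qed.

End HighestWeight.

(** * Homogeneity of the submodules generated by words *)

Section Grading.
Variables (F : fieldType) (p : nat) (D : colorSpace F).
Variable chi : (Vsp D -> Vsp D) -> F.
Variables (Mo : lmodType (uchi p chi (Bsub D))) (gr : Gamma D -> set Mo).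
Variables (g0 : Gamma D) (v : Mo).
Hypothesis gr_v : gr g0 v.
Local Notation Z := (resF (babyVerma Mo)).
Local Notation E := (@rootE F p D chi (babyVerma Mo)).

Lemma uchi_gr_word (w : seq rootpair) : exists g,
  uchi_gr g (\prod_(d <- w) uin p chi (cgl D) (eij d.1 d.2)).
Proof.
elim: w => [|d w [g gw]].
  by exists 0; rewrite big_nil -(uscal1 p chi (cgl D)); exact: uchi_gr_scal.
exists (edeg D d.1 d.2 + g); rewrite big_cons; apply: uchi_gr_mul gw.
by apply: uchi_gr_in; [exact: cgl_eij | exact: glhom_eij].
Qed.

Lemma act_homogeneous c (w : seq rootpair) : exists g,
  babyVerma_gr gr g (c *: act E w (hwv v)).
Proof.
have [g gw] := uchi_gr_word w; exists (0 + g + g0).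
have -> : c *: act E w (hwv v) = tensor (@uchi_incl F D p chi (Bsub D) (cgl D))
    (uscal p chi (cgl D) c * \prod_(d <- w) uin p chi (cgl D) (eij d.1 d.2)) v.
  rewrite -[RHS]uact_hwv; apply: etrans _ (esym (uactS _ _ _)).
  by rewrite act_uact.
by apply: bV_tensor gr_v; apply: uchi_gr_mul gw; exact: uchi_gr_scal.
Qed.

(** Words carry a homogeneous vector to homogeneous vectors, so each combination of them splits
    inside the span. *)
Lemma Span_graded (w0 : seq rootpair) :
  graded_submodule (babyVerma_gr gr) (Span E (act E w0 (hwv v))).
Proof.
have sS := Span_subspace E (act E w0 (hwv v)); have [S0 SD SZ] := sS.
split.
- split=> // x y Sx Sy.
  have := SD _ _ Sx (SZ (-1) _ Sy); rewrite scaleN1r; exact.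
- exact: (uact_closed sS (fun d z => @Span_actE _ _ E _ [:: d] z)).
move=> m Sm; have [t em] := Sm.
pose P g := [set x | Span E (act E w0 (hwv v)) x /\ babyVerma_gr gr g x].
suff [s [c [Pc ec]]] : graded_sum P m by exists s, c.
have P0 g : P g 0 by split; [exact: S0 | exact: bV_zero].
have PD g x y : P g x -> P g y -> P g (x + y).
  by move=> [Sx gx] [Sy gy]; split; [exact: SD | exact: bV_add].
rewrite em; elim: (t) => [|u r IHr].
  by rewrite big_nil; exists [::], (fun=> 0); rewrite big_nil.
rewrite big_cons; apply: (graded_sumD P0 PD _ IHr).
have [g gu] := act_homogeneous u.1 (u.2 ++ w0); rewrite act_cat in gu.
exact: (@graded_sum_in _ _ P P0 g _ (conj (SZ _ _ (Span_act E _ _)) gu)).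
Qed.

End Grading.

Theorem theorem4p5 (F : closedFieldType) (p : nat) (D : colorSpace F)
    (chi : (Vsp D -> Vsp D) -> F) (N : nat)
    (M : uTmodule p chi (Bsub D) N) (g0 : Gamma D) (v : M)
    (lam : (Vsp D -> Vsp D) -> F) (delta : nat -> seq rootpair) :
  p \in [pchar F] -> (3 < p)%N ->
  finite_dual0 chi -> standard_semisimple chi ->
  (forall i x, (N <= i)%N -> glblock D i x -> chi x = 0) ->
  categoryO M ->
  utgr g0 v -> v != 0 -> (forall m : M, exists a : F, m = fscale a v) ->
  (forall x, Nplus D x -> uin p chi (Bsub D) x *: v = 0) ->
  linear_on (Hsub D) lam ->
  (forall h, Hsub D h -> uin p chi (Bsub D) h *: v = fscale (lam h) v) ->
  (forall n, (0 < n)%N -> FP_triple D n (delta n)) ->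
  graded_simple (babyVerma_gr (@utgr _ _ _ _ _ _ M))
    <-> forall n, (0 < n)%N -> fpoly p lam (delta n) != 0.
Proof.
move=> pchF p_gt3 [chi_lin _ _] chi_std _ _ gr_v v0 v_gen N_v lam_lin H_v FP.
pose Z := resF (babyVerma M); pose E := @rootE F p D chi (babyVerma M).
pose vh : Z := hwv v.
have E_bracket a b i j (z : Z) := resF_bracket a b i j z.
have E_nilp (d : rootpair) (z : Z) := resF_nilp pchF p_gt3 chi_std (d := d) z.
have v_kills (d : rootpair) : (d.1 < d.2)%N -> E d vh = 0.
  by move=> dd; apply: (hwv_N N_v); apply: lspan_in; exists d.
have v_weight : weight E (fun k => lam (eij k k)) vh.
  by move=> k; apply: (hwv_H H_v); exact: Hsub_eij.
have v_free := hwv_free pchF chi_lin chi_std v0 v_gen N_v lam_lin H_v.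
have v_Below := hwv_Below pchF chi_lin chi_std v0 v_gen N_v lam_lin H_v.
have gen := hwv_gen v_gen.
have vh0 : vh != 0 by apply: (v_free [::]) => // d; rewrite /= pbarE; case: ifP => // _;
  exact: ltn_trans p_gt3.
split=> [[_ simple] n n0|fn].
  apply/negP => /eqP f0.
  have [s y0 ny] := fpoly_notSpan (E := E) (v := vh) pchF FP lam_lin E_bracket E_nilp v_kills v_weight v_free
    v_Below n0 f0.
  (* The flipped vector is a single word applied to the highest weight vector. Hence what it
     generates is a graded submodule, to which simplicity applies. *)
  have [w ew] : exists w, flips E (pbar D p) s vh = act E w vh.
    by elim/last_ind: s {y0 ny} => [|s d [w ew]]; [exists [::] |
      exists (nseq (pbar D p d).-1 (ropp d) ++ w);
      rewrite /flips -cats1 foldl_cat -/(flips E (pbar D p) s vh) ew act_cat act_nseq].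
  rewrite ew in y0 ny; have [] := simple _ (Span_graded gr_v w).
    by move=> all0; case/eqP: y0; exact: all0 _ (Span_act E _ [::]).
  by move/(_ vh).
split; first by exists vh.
move=> P [[P0 PB] PU _]; have [[z [Pz nz]]|nP] := pselect (exists z, P z /\ z != 0); last first.
  by left=> m Pm; apply: contrapT => /eqP m0; apply: nP; exists m.
right.
have PD x y : P x -> P y -> P (x + y).
  move=> Px Py; rewrite -[y]opprK; apply: (PB _ _ Px).
  by rewrite -sub0r; exact: PB.
have sP : @subspace F Z P by split=> // a x; exact: PU.
have PE d z' : P z' -> P (E d z') by exact: PU.
have [t et] := fpoly_Span (E := E) (v := vh) pchF FP lam_lin E_bracket E_nilp v_kills v_weight v_free gen fn nz.
have Pv : P vh.
  rewrite et; apply: subspace_sum => // u _; case: sP => _ _ PZ; apply: PZ.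
  by elim: u.2 => [//|d w IHw]; exact: PE.
move=> m; apply: (Gen_sub sP _ _ (gen m)) => [_ [a ->]|d z' _]; last exact: PE.
by case: sP => _ _ PZ; exact: PZ.
Qed.
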